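(* Let $n\ge 1$ and let $f:\mathbf{C}\to\mathbf{P}^n$ be a Brody curve whose image omits $n$ hyperplanes of $\mathbf{P}^n$ in general position. Then the Nevanlinna characteristic of $f$ satisfies $$T(r,f)=O(r),\qquad r\to\infty.$$
   Context: $\mathbf{P}^n$ is the complex projective space of dimension $n$. A holomorphic curve is a holomorphic map $f:\mathbf{C}\to\mathbf{P}^n$. A homogeneous representation of $f$ is a tuple $(f_0,\ldots,f_n)$ of entire functions which never simultaneously vanish, with $f(z)=[f_0(z):\cdots:f_n(z)]$. Put $\|f\|^2=\sum_{j=0}^n|f_j|^2$. The spherical derivative $\|f'\|\ge 0$ (the length distortion from the Euclidean metric in $\mathbf{C}$ to the Fubini–Study metric in $\mathbf{P}^n$) is given by $$\|f'\|^2=\|f\|^{-4}\sum_{0\le i<j\le n}|f_i'f_j-f_if_j'|^2,$$ which does not depend on the choice of homogeneous representation. A holomorphic curve is called a Brody curve if its spherical derivative is bounded on $\mathbf{C}$ (equivalently, the family of translations $\{z\mapsto f(z+a):a\in\mathbf{C}\}$ is normal). The Nevanlinna characteristic is $$T(r,f)=\int_0^r\frac{dt}{t}\left(\frac1\pi\int_{|z|\le t}\|f'\|^2(z)\,dm_z\right),$$ where $dm$ is the area element in $\mathbf{C}$. Hyperplanes $H_1,\ldots,H_n$ in $\mathbf{P}^n$ are in general position if their defining linear forms are linearly independent. *)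

(* Defs.v *)
From mathcomp Require Import all_boot all_order all_algebra.
From mathcomp Require Import all_classical all_reals all_analysis.
From mathcomp Require Import complex ring.

Set Implicit Arguments.
Unset Strict Implicit.
Unset Printing Implicit Defensive.

Import Order.TTheory GRing.Theory Num.Theory.
Import numFieldNormedType.Exports.

Local Open Scope classical_set_scope.
Local Open Scope ring_scope.
Local Open Scope complex_scope.

(* Points of P^n are the lines through the origin of C^(n+1). *)
Definition projective_space (R : realType) (n : nat) :=
  {L : {vspace 'rV[R[i]]_n.+1} | \dim L == 1%N}.

(* [f z = [F_0 z : ... : F_n z]]; the homogeneous coordinates must not all
   vanish at [z]. *)
Definition represents_at (R : realType) (n : nat)
    (f : R[i] -> projective_space R n) (F : 'I_n.+1 -> R[i] -> R[i])
    (z : R[i]) : Prop :=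
  \row_j F j z != 0 /\ val (f z) = <[\row_j F j z]>%VS.

(* R[i]^o is C as a normed space over the field C, so that differentiability in
   the direction 1 is complex differentiability.  R[i] itself carries no
   topology. *)
Definition holomorphic_at (R : realType) (g : R[i]^o -> R[i]^o) (z : R[i]^o) :
    Prop :=
  derivable g z 1.

Definition cderiv (R : realType) (g : R[i]^o -> R[i]^o) : R[i] -> R[i] :=
  derive1 g.

Definition entire (R : realType) (g : R[i] -> R[i]) : Prop :=
  forall z, holomorphic_at g z.

(* A map into P^n is holomorphic when it has, locally, homogeneous coordinates
   that are holomorphic functions. *)
Definition holomorphic_curve (R : realType) (n : nat)
    (f : R[i] -> projective_space R n) : Prop :=
  forall a : R[i]^o, exists F : 'I_n.+1 -> R[i] -> R[i],
    \forall z \near a, (forall j, holomorphic_at (F j) z) /\ represents_at f F z.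

Definition homogeneous_representation (R : realType) (n : nat)
    (f : R[i] -> projective_space R n) (F : 'I_n.+1 -> R[i] -> R[i]) : Prop :=
  (forall j, entire (F j)) /\ forall z, represents_at f F z.

(* The modulus in R; the norm of R[i] is R[i]-valued. *)
Definition cmod (R : realType) (z : R[i]) : R := ComplexField.Normc.normc z.

Definition sph_deriv_rep (R : realType) (n : nat)
    (F : 'I_n.+1 -> R[i] -> R[i]) (z : R[i]) : R :=
  Num.sqrt ((\sum_j cmod (F j z) ^+ 2) ^- 2 *
    \sum_(i < n.+1) \sum_(j < n.+1 | (i < j)%N)
      cmod (cderiv (F i) z * F j z - F i z * cderiv (F j) z) ^+ 2).

(* Every holomorphic curve C -> P^n has a homogeneous representation; the value
   does not depend on the one chosen here, see [sph_derivE]. *)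
Definition sph_deriv (R : realType) (n : nat)
    (f : R[i] -> projective_space R n) : R[i] -> R :=
  sph_deriv_rep (xget (fun _ _ => 0) [set F | homogeneous_representation f F]).

Definition Brody_curve (R : realType) (n : nat)
    (f : R[i] -> projective_space R n) : Prop :=
  holomorphic_curve f /\ exists M : R, forall z, sph_deriv f z <= M.

(* The hyperplane is that of the linear form [x |-> \sum_j a_j x_j]. *)
Definition on_hyperplane (R : realType) (n : nat)
    (a : 'rV[R[i]]_n.+1) (p : projective_space R n) : Prop :=
  forall x : 'rV[R[i]]_n.+1, x \in val p -> \sum_j a 0 j * x 0 j = 0.

Definition omits_hyperplane (R : realType) (n : nat)
    (f : R[i] -> projective_space R n) (a : 'rV[R[i]]_n.+1) : Prop :=
  forall z, ~ on_hyperplane a (f z).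

(* Extended-real valued, so that no integrability assumption is hidden.  The
   area element is the planar Lebesgue measure, z = x + i y being encoded as the
   pair (x, y). *)
Definition nevanlinna (R : realType) (n : nat)
    (f : R[i] -> projective_space R n) (r : R) : \bar R :=
  (\int[@lebesgue_measure R]_(t in `[0%R, r])
    ((t^-1)%R%:E * ((pi^-1)%R%:E *
      \int[@lebesgue_measure R \x @lebesgue_measure R]_(p in
           [set p : R * R | (cmod (p.1 +i* p.2) <= t)%R])
        (sph_deriv f (p.1 +i* p.2) ^+ 2)%R%:E)))%E.

Lemma solve_aux (K : fieldType) (a b c d l g h : K) : h != 0 ->
  a * h + l * g * b = c * g + l * h * d -> a = l * d + (c - l * b) / h * g.
Proof.
move=> h0 e; have -> : a = (c * g + l * h * d - l * g * b) / h.
  by rewrite -e addrK mulfK.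
by field.
Qed.

Lemma minor_aux (K : fieldType) (a b c d l m : K) :
  (l * a + m * c) * (l * d) - l * c * (l * b + m * d) =
  l * l * (a * d - c * b).
Proof. by ring. Qed.

Lemma scale_aux (K : fieldType) (a s t : K) : a != 0 ->
  (a * s) ^- 2 * (a ^+ 2 * t) = s ^- 2 * t.
Proof.
by move=> a0; rewrite exprMn invfM mulrACA mulVf ?mul1r// expf_neq0.
Qed.

Lemma derive1M_field (K : numFieldType) (p q : K -> K) (z : K) :
  derivable p z 1 -> derivable q z 1 ->
  derive1 (fun w => p w * q w) z = derive1 p z * q z + p z * derive1 q z.
Proof.
move=> hp hq; rewrite !derive1E [LHS](deriveM hp hq) addrC.
by congr (_ + _); exact: mulrC.
Qed.

Lemma cderivM (R : realType) (p q : R[i] -> R[i]) (z : R[i]) :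
  holomorphic_at p z -> holomorphic_at q z ->
  cderiv (fun w => p w * q w) z = cderiv p z * q z + p z * cderiv q z.
Proof. exact: (@derive1M_field R[i] p q z). Qed.

Lemma sph_deriv_rep_indep (R : realType) (n : nat)
    (f : R[i] -> projective_space R n) (F G : 'I_n.+1 -> R[i] -> R[i]) :
  homogeneous_representation f F -> homogeneous_representation f G ->
  sph_deriv_rep F =1 sph_deriv_rep G.
Proof.
move=> [Fe Ff] [Ge Gf] z.
have col w : exists l : R[i], forall j, F j w = l * G j w.
  have [_ e1] := Ff w; have [_ e2] := Gf w.
  have : \row_j F j w \in <[\row_j G j w]>%VS by rewrite -e2 e1 memv_line.
  move=> /vlineP[l el]; exists l => j.
  by have /rowP/(_ j) := el; rewrite !mxE.
have [l Fl] := col z.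
have l0 : l != 0.
  apply/eqP => l0; have [/eqP + _] := Ff z; apply.
  by apply/rowP => j; rewrite !mxE Fl l0 mul0r.
have [k Gk] : exists k, G k z != 0.
  have [/rV0Pn[k] + _] := Gf z; rewrite mxE => ?; by exists k.
have cross i : cderiv (F i) z * G k z + F i z * cderiv (G k) z =
               cderiv (F k) z * G i z + F k z * cderiv (G i) z.
  have e : (fun w => F i w * G k w) = (fun w => F k w * G i w).
    by apply/funext => w; have [m Fm] := col w; rewrite !Fm; ring.
  by rewrite -!cderivM ?e//; [exact: Fe|exact: Ge|exact: Fe|exact: Ge].
pose m := (cderiv (F k) z - l * cderiv (G k) z) / G k z.
have dF i : cderiv (F i) z = l * cderiv (G i) z + m * G i z.
  by have := cross i; rewrite !Fl; exact: solve_aux.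
have nM (x y : R[i]) : cmod (x * y) = cmod x * cmod y.
  exact: ComplexField.Normc.normcM.
have eS : \sum_j cmod (F j z) ^+ 2 = cmod l ^+ 2 * \sum_j cmod (G j z) ^+ 2.
  by rewrite mulr_sumr; apply: eq_bigr => j _; rewrite Fl nM exprMn.
have eN : \sum_(i < n.+1) \sum_(j < n.+1 | (i < j)%N)
      cmod (cderiv (F i) z * F j z - F i z * cderiv (F j) z) ^+ 2 =
    (cmod l ^+ 2) ^+ 2 * \sum_(i < n.+1) \sum_(j < n.+1 | (i < j)%N)
      cmod (cderiv (G i) z * G j z - G i z * cderiv (G j) z) ^+ 2.
  rewrite mulr_sumr; apply: eq_bigr => i _.
  rewrite mulr_sumr; apply: eq_bigr => j _.
  have -> : cderiv (F i) z * F j z - F i z * cderiv (F j) z =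
      l * l * (cderiv (G i) z * G j z - G i z * cderiv (G j) z).
    by rewrite !dF !Fl; exact: minor_aux.
  by rewrite !nM -expr2 exprMn.
have a0 : cmod l ^+ 2 != 0.
  rewrite expf_neq0//; apply: contra l0 => /eqP.
  by move=> /ComplexField.Normc.eq0_normc ->.
have := f_equal2 (fun s t : R => Num.sqrt (s ^- 2 * t)) eS eN.
by rewrite /= (scale_aux _ _ a0).
Qed.

Lemma sph_derivE (R : realType) (n : nat)
    (f : R[i] -> projective_space R n) (F : 'I_n.+1 -> R[i] -> R[i]) :
  homogeneous_representation f F -> sph_deriv f =1 sph_deriv_rep F.
Proof.
by move=> hF; apply: sph_deriv_rep_indep (hF); exact: xgetI hF.
Qed.

(* Main.v *)
Require Import Defs.
From mathcomp Require Import all_boot all_order all_algebra.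
From mathcomp Require Import all_classical all_reals all_analysis.
From mathcomp Require Import complex ring lra.

Import Order.TTheory GRing.Theory Num.Theory.
Import numFieldNormedType.Exports.

Local Open Scope classical_set_scope.
Local Open Scope ring_scope.
Local Open Scope complex_scope.

Set Implicit Arguments.
Unset Strict Implicit.
Unset Printing Implicit Defensive.

(** Since the curve omits a hyperplane, it has a representation [F] on which the
    linear form of that hyperplane equals 1 ([normalized_representation]).  On it,
    the linear forms of the omitted hyperplanes are zero-free entire functions
    [G k], one of them the constant 1; one more coordinate [g] completes them to a
    basis of the linear forms ([row_free_control]).  Let [U] be the logarithm of
    [norm2 F], the square of the norm of [F].  The claim reduces to
    [U = O(1 + |z|)], which is obtained from a bound [M] of the spherical
    derivative in two ways.

    First, the Laplacian of [U] is four times the square of the spherical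
    derivative ([wder_dlog]), so it is bounded and the circle means of [U] are
    [O(r ^ 2)] ([mean_log_norm2_le]).  The harmonic function [ln |G k|] is at most
    [U / 2 + O(1)], and comparison of Fourier coefficients shows that [G k' / G k]
    is an affine function ([dominated_L2]).

    Second, the Wronskian of two linear forms on [F] is at most a constant times
    [norm2 F].  Thus, where two of the functions [g] and [G k] tie for the largest
    modulus, their logarithmic derivatives differ by a bounded amount.  Where [g]
    dominates strictly, the functions [ln |g / G k|] are harmonic and positive.
    Hopf's lemma at the nearest point where [g] does not dominate bounds
    [ln |g / G l|], for some [l], by a multiple of the distance to that point
    ([outside_low]); with Harnack's gradient estimate this gives the same
    conclusion for two functions [G j] and [G k] that are the largest among the
    [G l], even where [g] is larger ([tie_bound]).  If some [G k' / G k] were not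
    constant, two of the quadratic polynomials [ln |G l|] with distinct quadratic
    parts would tie for the maximum at points arbitrarily far away, where their
    gradients are far apart ([no_quadratic]).  So [ln |G k|] is [O(1 + |z|)], and
    [outside_low] gives the same upper bound for [ln |g|] ([linear_growth]),
    whence the bound for [U] ([log_norm2_growth]).

    Finally, integrating the Laplacian of [U] against a cut-off function and
    moving the derivatives to the latter bounds the area covered over the disc of
    radius [t] by a constant times [t] ([area_le]), so that the integrand in the
    definition of the characteristic is bounded.

    The function theory used (Cauchy's formulas, mean value properties) rests on
    Gauss's theorem for rectangles as an inequality, [gauss_le], proved by
    repeated quadrisection in the manner of Goursat; it needs no continuity of
    the derivatives. *)

(** * Real differentiability in the complex plane *)

Section Modulus.
Variable R : realType.
Implicit Types (x y z w : R[i]) (r : R).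

Lemma cmodE z : cmod z = Num.sqrt (complex.Re z ^+ 2 + complex.Im z ^+ 2).
Proof. by case: z. Qed.

Lemma cmod_ge0 z : 0 <= cmod z.
Proof. by rewrite cmodE sqrtr_ge0. Qed.

Lemma cmod_sqr z : cmod z ^+ 2 = complex.Re z ^+ 2 + complex.Im z ^+ 2.
Proof. by rewrite cmodE sqr_sqrtr// addr_ge0 ?sqr_ge0. Qed.

Lemma cmodM z w : cmod (z * w) = cmod z * cmod w.
Proof. exact: ComplexField.Normc.normcM. Qed.

Lemma cmodV z : cmod z^-1 = (cmod z)^-1.
Proof. exact: ComplexField.Normc.normcV. Qed.

Lemma cmod0 : cmod (0 : R[i]) = 0.
Proof. exact: ComplexField.Normc.normc0. Qed.

Lemma cmod1 : cmod (1 : R[i]) = 1.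
Proof. exact: ComplexField.Normc.normc1. Qed.

Lemma cmodX z k : cmod (z ^+ k) = cmod z ^+ k.
Proof. by elim: k => [|k ih]; rewrite ?expr0 ?cmod1// !exprS cmodM ih. Qed.

Lemma cmodN z : cmod (- z) = cmod z.
Proof. by rewrite !cmodE; case: z => a b /=; rewrite !sqrrN. Qed.

Lemma cmodJ z : cmod (conjc z) = cmod z.
Proof. by rewrite !cmodE; case: z => a b /=; rewrite !sqrrN. Qed.

Lemma cmodD z w : cmod (z + w) <= cmod z + cmod w.
Proof. exact: le_normcD. Qed.

Lemma cmodB z w : cmod (z - w) <= cmod z + cmod w.
Proof. by rewrite -[cmod w]cmodN cmodD. Qed.

Lemma cmod_distC z w : cmod (z - w) = cmod (w - z).
Proof. by rewrite -cmodN opprB. Qed.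

Lemma cmod_eq0 z : (cmod z == 0) = (z == 0).
Proof.
by apply/eqP/eqP => [/ComplexField.Normc.eq0_normc//|->]; exact: cmod0.
Qed.

Lemma cmod_gt0 z : (0 < cmod z) = (z != 0).
Proof. by rewrite lt_def cmod_ge0 andbT cmod_eq0. Qed.

Lemma cmodC r : cmod r%:C = `|r|.
Proof. by rewrite cmodE /= expr0n addr0 sqrtr_sqr. Qed.

Lemma cmodi : cmod ('i : R[i]) = 1.
Proof. by rewrite cmodE /= expr0n add0r expr1n sqrtr1. Qed.

Lemma normRe_le z : `|complex.Re z| <= cmod z.
Proof. by rewrite cmodE -sqrtr_sqr ler_wsqrtr// lerDl sqr_ge0. Qed.

Lemma normIm_le z : `|complex.Im z| <= cmod z.
Proof. by rewrite cmodE -sqrtr_sqr ler_wsqrtr// lerDr sqr_ge0. Qed.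

Lemma Re_le_cmod z : complex.Re z <= cmod z.
Proof. exact: le_trans (ler_norm _) (normRe_le z). Qed.

Lemma cmod_le_ReIm z : cmod z <= `|complex.Re z| + `|complex.Im z|.
Proof.
rewrite cmodE -[leRHS]ger0_norm ?addr_ge0// -sqrtr_sqr ler_wsqrtr// sqrrD.
by rewrite !real_normK ?num_real// lerD2r lerDl mulrn_wge0// mulr_ge0.
Qed.

Lemma mulcJ z : z * conjc z = (cmod z ^+ 2)%:C.
Proof. by rewrite cmod_sqr; case: z => a b; simpc; congr (_ +i* _); ring. Qed.

Lemma normcR z : `|z| = (cmod z)%:C.
Proof. by rewrite normc_def cmodE. Qed.

Lemma ReD z w : complex.Re (z + w) = complex.Re z + complex.Re w.
Proof. by case: z; case: w. Qed.
Lemma ImD z w : complex.Im (z + w) = complex.Im z + complex.Im w.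
Proof. by case: z; case: w. Qed.
Lemma ReN z : complex.Re (- z) = - complex.Re z.
Proof. by case: z. Qed.
Lemma ImN z : complex.Im (- z) = - complex.Im z.
Proof. by case: z. Qed.
Lemma ReM z w : complex.Re (z * w) =
  complex.Re z * complex.Re w - complex.Im z * complex.Im w.
Proof. by case: z; case: w. Qed.
Lemma ImM z w : complex.Im (z * w) =
  complex.Re z * complex.Im w + complex.Im z * complex.Re w.
Proof. by case: z => ? ?; case: w => ? ? /=. Qed.
Lemma ReJ z : complex.Re (conjc z) = complex.Re z.
Proof. by case: z. Qed.
Lemma ImJ z : complex.Im (conjc z) = - complex.Im z.
Proof. by case: z. Qed.

Lemma eqcP z w :
  complex.Re z = complex.Re w -> complex.Im z = complex.Im w -> z = w.
Proof. by case: z => ? ?; case: w => ? ? /= -> ->. Qed.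

End Modulus.

Definition ReImE := (ReD, ImD, ReN, ImN, ReM, ImM, ReJ, ImJ).

Section LittleO.
Variable R : realType.
Implicit Types (r s k : R[i] -> R[i]).

(** [r h = o(h)] as [h] tends to [0].  Landau notions on C are stated with the
    real-valued modulus, since the norm of [R[i]] takes its values in [R[i]]. *)
Definition small_o r := forall e : R, 0 < e ->
  exists2 d : R, 0 < d & forall h, cmod h <= d -> cmod (r h) <= e * cmod h.

(** [r h = O(h)] as [h] tends to [0]. *)
Definition big_O r := exists K : R, 0 < K /\
  exists2 d : R, 0 < d & forall h, cmod h <= d -> cmod (r h) <= K * cmod h.

(** [r h = O(1)] as [h] tends to [0]. *)
Definition big_1 r := exists K : R, 0 < K /\
  exists2 d : R, 0 < d & forall h, cmod h <= d -> cmod (r h) <= K.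

Lemma small_oD r s : small_o r -> small_o s -> small_o (fun h => r h + s h).
Proof.
move=> hr hs e e0; have e20 : 0 < e / 2 by rewrite divr_gt0.
have [d d0 H] := hr _ e20; have [d' d'0 H'] := hs _ e20.
exists (Num.min d d'); first by rewrite lt_min d0.
move=> h; rewrite le_min => /andP[h1 h2].
apply: le_trans (cmodD _ _) _; rewrite [e]splitr mulrDl.
by rewrite lerD ?H ?H'.
Qed.

Lemma small_oM r s : small_o r -> big_1 s -> small_o (fun h => s h * r h).
Proof.
move=> hr [K [K0 [d' d'0 H']]] e e0.
have [d d0 H] := hr (e / K) (divr_gt0 e0 K0).
exists (Num.min d d'); first by rewrite lt_min d0.
move=> h; rewrite le_min => /andP[h1 h2]; rewrite cmodM.
apply: (@le_trans _ _ (K * (e / K * cmod h))).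
  by rewrite ler_pM ?cmod_ge0 ?H ?H'.
by rewrite mulrA mulrCA divff ?mulr1 ?gt_eqF.
Qed.

Lemma big_1_cst (c : R[i]) : big_1 (fun=> c).
Proof.
exists (cmod c + 1); split; first by rewrite ltr_wpDl ?cmod_ge0.
by exists 1 => // h _; rewrite lerDl.
Qed.

Lemma small_oZ r (c : R[i]) : small_o r -> small_o (fun h => c * r h).
Proof. by move=> hr; apply: small_oM hr (big_1_cst c). Qed.

Lemma small_oJ r : small_o r -> small_o (fun h => conjc (r h)).
Proof.
by move=> hr e /hr[d d0 H]; exists d => // h /H; rewrite cmodJ.
Qed.

Lemma small_big r : small_o r -> big_O r.
Proof.
by move=> /(_ 1 ltr01)[d d0 H]; exists 1; split => //; exists d.
Qed.

Lemma big_OD r s : big_O r -> big_O s -> big_O (fun h => r h + s h).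
Proof.
move=> [K [K0 [d d0 H]]] [K' [K'0 [d' d'0 H']]].
exists (K + K'); split; first by rewrite addr_gt0.
exists (Num.min d d'); first by rewrite lt_min d0.
move=> h; rewrite le_min => /andP[h1 h2].
by apply: le_trans (cmodD _ _) _; rewrite mulrDl lerD ?H ?H'.
Qed.

Lemma big_O_lin (a b : R[i]) : big_O (fun h => a * h + b * conjc h).
Proof.
exists (cmod a + cmod b + 1); split.
  by rewrite ltr_wpDl// addr_ge0 ?cmod_ge0.
exists 1 => // h _; apply: le_trans (cmodD _ _) _.
by rewrite !cmodM cmodJ -mulrDl ler_wpM2r ?cmod_ge0// lerDl.
Qed.

Lemma big_O_mul r s : big_O r -> big_O s -> small_o (fun h => r h * s h).
Proof.
move=> [K [K0 [d d0 H]]] [K' [K'0 [d' d'0 H']]] e e0.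
have KK : 0 < K * K' by rewrite mulr_gt0.
exists (Num.min (Num.min d d') (e / (K * K'))).
  by rewrite !lt_min d0 d'0 divr_gt0.
move=> h; rewrite !le_min => /andP[/andP[h1 h2] h3]; rewrite cmodM.
apply: (@le_trans _ _ ((K * cmod h) * (K' * cmod h))).
  by rewrite ler_pM ?cmod_ge0 ?H ?H'.
rewrite mulrACA mulrA ler_wpM2r ?cmod_ge0// mulrC.
by rewrite -ler_pdivlMr.
Qed.

Lemma small_o_comp r k : small_o r -> big_O k -> small_o (fun h => r (k h)).
Proof.
move=> hr [K [K0 [d' d'0 H']]] e e0.
have [d d0 H] := hr (e / K) (divr_gt0 e0 K0).
exists (Num.min d' (d / K)); first by rewrite lt_min d'0 divr_gt0.
move=> h; rewrite le_min => /andP[h1 h2].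
apply: (@le_trans _ _ (e / K * cmod (k h))).
  by apply: H; apply: le_trans (H' _ h1) _; rewrite mulrC -ler_pdivlMr.
apply: le_trans (ler_wpM2l _ (H' _ h1)) _; first by rewrite divr_ge0// ltW.
by rewrite mulrA divfK// gt_eqF.
Qed.

End LittleO.

Section Wirtinger.
Variable R : realType.
Implicit Types (f g : R[i] -> R[i]) (z w a b c : R[i]).

(** Real differentiability of a function of a complex variable, with the
    differential written as [h |-> a * h + b * conjc h]: [a] and [b] are the
    derivatives of [f] with respect to [z] and to its conjugate; [f] is complex
    differentiable at [z] when [b = 0]. *)
Definition wder f z a b :=
  small_o (fun h => f (z + h) - f z - (a * h + b * conjc h)).

Lemma small_o_ext (r s : R[i] -> R[i]) : r =1 s -> small_o r -> small_o s.
Proof. by move=> /funext ->. Qed.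

Lemma wder_eq f z a b a' b' : wder f z a b -> a = a' -> b = b' ->
  wder f z a' b'.
Proof. by move=> ? <- <-. Qed.

Lemma wder_ext f g z a b : f =1 g -> wder f z a b -> wder g z a b.
Proof. by move=> /funext ->. Qed.

Lemma small_o0 : small_o (fun=> 0 : R[i]).
Proof. by move=> e e0; exists 1 => // h _; rewrite cmod0 mulr_ge0 ?cmod_ge0// ltW. Qed.

Lemma wder_near f g z a b (e : R) : 0 < e ->
  (forall h, cmod h <= e -> f (z + h) = g (z + h)) ->
  wder f z a b -> wder g z a b.
Proof.
move=> e0 fg H e1 /H[d d0 {}H]; exists (Num.min d e); first by rewrite lt_min d0.
move=> h; rewrite le_min => /andP[h1 h2].
have fz : f z = g z by rewrite -[z]addr0 fg// cmod0 ltW.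
by rewrite -fz -fg// H.
Qed.

Lemma wder_cst c z : wder (fun=> c) z 0 0.
Proof.
by apply: small_o_ext small_o0 => h; rewrite subrr !mul0r addr0 subrr.
Qed.

Lemma wder_id z : wder id z 1 0.
Proof. by apply: small_o_ext small_o0 => h /=; ring. Qed.

Lemma wderD f g z a b a' b' : wder f z a b -> wder g z a' b' ->
  wder (fun x => f x + g x) z (a + a') (b + b').
Proof.
by move=> hf hg; apply: small_o_ext (small_oD hf hg) => h /=; ring.
Qed.

Lemma wderJ f z a b : wder f z a b ->
  wder (fun x => conjc (f x)) z (conjc b) (conjc a).
Proof.
move=> /small_oJ; apply: small_o_ext => h.
by rewrite !(rmorphB, rmorphD, rmorphM) /= conjcK addrC [conjc a * _ + _]addrC addrC.
Qed.

Lemma wder_big f z a b : wder f z a b -> big_O (fun h => f (z + h) - f z).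
Proof.
move=> /small_big /big_OD /(_ (big_O_lin a b)).
by congr big_O; apply/funext => h; rewrite subrK.
Qed.

Lemma wderM f g z a b a' b' : wder f z a b -> wder g z a' b' ->
  wder (fun x => f x * g x) z (a * g z + f z * a') (b * g z + f z * b').
Proof.
move=> hf hg; have H1 := small_oZ (g z) hf; have H2 := small_oZ (f z) hg.
have H3 := big_O_mul (wder_big hf) (wder_big hg).
by apply: small_o_ext (small_oD (small_oD H1 H2) H3) => h /=; ring.
Qed.

Lemma wderZ f z a b c : wder f z a b ->
  wder (fun x => c * f x) z (c * a) (c * b).
Proof.
move=> hf; apply: (wder_eq (wderM (wder_cst c z) hf)).
  by rewrite mul0r add0r.
by rewrite mul0r add0r.
Qed.

Lemma wderN f z a b : wder f z a b -> wder (fun x => - f x) z (- a) (- b).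
Proof.
move=> /(wderZ (-1)); rewrite !mulN1r; apply: wder_ext => x.
by rewrite mulN1r.
Qed.

Lemma wderB f g z a b a' b' : wder f z a b -> wder g z a' b' ->
  wder (fun x => f x - g x) z (a - a') (b - b').
Proof. by move=> hf hg; apply: wderD hf (wderN hg). Qed.

Lemma wder_comp f g z a b a' b' : wder f (g z) a b -> wder g z a' b' ->
  wder (fun x => f (g x)) z (a * a' + b * conjc b') (a * b' + b * conjc a').
Proof.
move=> hf hg; have H1 := small_o_comp hf (wder_big hg).
have H2 := small_oZ a hg; have H3 := small_oZ b (small_oJ hg).
apply: small_o_ext (small_oD (small_oD H1 H2) H3) => h /=.
by rewrite subrKC !(rmorphB, rmorphD, rmorphM) /= conjcK; ring.
Qed.

Lemma wder_sum (I : Type) (s : seq I) (P : pred I) (F : I -> R[i] -> R[i])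
    z (a b : I -> R[i]) : (forall i, P i -> wder (F i) z (a i) (b i)) ->
  wder (fun x => \sum_(i <- s | P i) F i x) z
    (\sum_(i <- s | P i) a i) (\sum_(i <- s | P i) b i).
Proof.
move=> H; elim: s => [|i s ih].
  rewrite !big_nil; apply: wder_ext (wder_cst 0 z) => x.
  by rewrite big_nil.
rewrite !big_cons; case: ifP => Pi; last first.
  by apply: wder_ext ih => x; rewrite big_cons Pi.
by apply: wder_ext (wderD (H _ Pi) ih) => x; rewrite big_cons Pi.
Qed.

Lemma wder_inv z : z != 0 -> wder (fun x => x^-1) z (- z ^- 2) 0.
Proof.
move=> z0; have cz0 : 0 < cmod z by rewrite cmod_gt0.
move=> e e0.
exists (Num.min (cmod z / 2) (e * cmod z ^+ 3 / 2)).
  by rewrite lt_min !(divr_gt0, mulr_gt0, exprn_gt0).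
move=> h; rewrite le_min => /andP[h1 h2].
have zh : cmod z / 2 <= cmod (z + h).
  have := cmodB (z + h) h; rewrite addrK => H; lra.
have zh0 : z + h != 0.
  by rewrite -cmod_gt0; apply: lt_le_trans zh; rewrite divr_gt0.
have -> : (z + h)^-1 - z^-1 - (- z ^- 2 * h + 0 * conjc h)
    = h * (h * ((z + h)^-1 * z^-1 ^+ 2)).
  by field; rewrite z0 zh0.
rewrite cmodM mulrC ler_wpM2r ?cmod_ge0// cmodM [X in _ * X]cmodM cmodX !cmodV.
have H1 : (cmod (z + h))^-1 <= (cmod z / 2)^-1.
  by rewrite lef_pV2// ?posrE ?divr_gt0// cmod_gt0.
apply: (@le_trans _ _ (e * cmod z ^+ 3 / 2 * ((cmod z / 2)^-1 * (cmod z)^-1 ^+ 2))).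
  have c2 : 0 <= (cmod z)^-1 ^+ 2 by rewrite exprn_ge0 ?invr_ge0 ?cmod_ge0.
  apply: ler_pM; rewrite ?cmod_ge0 ?mulr_ge0 ?invr_ge0 ?cmod_ge0//.
  by rewrite ler_wpM2r.
by rewrite le_eqVlt; apply/orP; left; apply/eqP; field; rewrite gt_eqF.
Qed.

Lemma wderV f z a b : f z != 0 -> wder f z a b ->
  wder (fun x => (f x)^-1) z (- (f z) ^- 2 * a) (- (f z) ^- 2 * b).
Proof.
move=> fz hf; apply: (wder_eq (wder_comp (wder_inv fz) hf)).
  by rewrite mul0r addr0.
by rewrite mul0r addr0.
Qed.

Lemma wder_shift f z w a b : wder f (w + z) a b ->
  wder (fun x => f (w + x)) z a b.
Proof.
by apply: small_o_ext => h; rewrite addrA.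
Qed.

Lemma wder_continuous f z a b : wder f z a b -> forall e : R, 0 < e ->
  exists2 d : R, 0 < d & forall h, cmod h <= d -> cmod (f (z + h) - f z) <= e.
Proof.
move=> /wder_big[K [K0 [d d0 H]]] e e0.
exists (Num.min d (e / K)); first by rewrite lt_min d0 divr_gt0.
move=> h; rewrite le_min => /andP[h1 h2]; apply: le_trans (H _ h1) _.
by rewrite mulrC -ler_pdivlMr.
Qed.

End Wirtinger.

(** * Complex derivatives, restriction to lines, and the exponential *)

Section DeriveEps.
Variable K : numFieldType.
Implicit Types (f : K -> K) (x d : K).

Lemma is_derive_eps f x d : is_derive x 1 f d -> forall e : K, 0 < e ->
  exists2 r : K, 0 < r & forall h, `|h| < r ->
    `|f (x + h) - f x - d * h| <= e * `|h|.
Proof.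
move=> [fx fd] e e0.
have := fx; rewrite /derivable => /cvg_ex[l hl].
have ld : l = d by rewrite -fd /derive; apply/esym/cvg_lim.
move: hl; rewrite {}ld => /cvgrPdist_le/(_ e e0).
rewrite near_withinE => /nbhs_ballP[r r0 H]; exists r => // h hr.
have [->|h0] := eqVneq h 0.
  by rewrite addr0 subrr mulr0 subrr normr0 mulr0.
have := H h; rewrite /ball /= sub0r normrN => /(_ hr h0).
rewrite /= -[_ *: 1]/(h * 1) mulr1 -[_ *: _]/(h^-1 * _) [h + x]addrC distrC.
move=> H1; have -> : f (x + h) - f x - d * h = (h^-1 * (f (x + h) - f x) - d) * h.
  by rewrite mulrBl; congr (_ - _); rewrite mulrC mulVKf.
by rewrite normrM ler_wpM2r.
Qed.

Lemma eps_is_derive f x d : (forall e : K, 0 < e ->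
  exists2 r : K, 0 < r & forall h, `|h| < r ->
    `|f (x + h) - f x - d * h| <= e * `|h|) -> is_derive x 1 f d.
Proof.
move=> H.
have hl : (fun h : K => h^-1 *: ((f \o shift x) (h *: 1) - f x)) @ 0^' --> d.
  apply/cvgrPdist_le => e e0; have [r r0 {}H] := H _ e0.
  rewrite near_withinE; apply/nbhs_ballP; exists r => //= h.
  rewrite /ball /= sub0r normrN => hr h0.
  rewrite -[_ *: 1]/(h * 1) mulr1 -[_ *: _]/(h^-1 * _) [h + x]addrC distrC.
  have := H _ hr; have -> : f (x + h) - f x - d * h =
      (h^-1 * (f (x + h) - f x) - d) * h.
    by rewrite mulrBl; congr (_ - _); rewrite mulrC mulVKf.
  by rewrite normrM ler_pM2r// normr_gt0.
apply: DeriveDef; first by apply/cvg_ex; exists d.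
by rewrite /derive; apply/cvg_lim.
Qed.

End DeriveEps.

Section Links.
Variable R : realType.
Implicit Types (f g : R[i] -> R[i]) (z w a b c : R[i]).

Lemma gt0_real (e : R[i]) : 0 < e -> exists2 r : R, 0 < r & e = r%:C.
Proof.
case: e => r s; rewrite ltcE /= => /andP[/eqP -> r0].
by exists r.
Qed.

Lemma ler_cmod z w (e : R) : (`|z| <= e%:C * `|w|) = (cmod z <= e * cmod w).
Proof. by rewrite !normcR -rmorphM lecR. Qed.

Lemma ltr_cmod z (e : R) : (`|z| < e%:C) = (cmod z < e).
Proof. by rewrite normcR ltcR. Qed.

(** [R[i]^o] carries the norm of C that complex derivatives refer to. *)
Lemma is_derive_wder f z a :
  is_derive (z : R[i]^o) 1 (f : R[i]^o -> R[i]^o) a -> wder f z a 0.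
Proof.
move=> /is_derive_eps H e e0.
have ec0 : 0 < e%:C :> R[i] by rewrite ltcR.
have [rc /gt0_real[r r0 ->] {}H] := H _ ec0.
exists (r / 2) => [|h hr]; first by rewrite divr_gt0.
rewrite /= mul0r addr0 -ler_cmod; apply: H; rewrite ltr_cmod.
by apply: le_lt_trans hr _; rewrite ltr_pdivrMr// mulr2n mulrDr mulr1 ltrDl.
Qed.

Lemma holomorphic_wder f z : holomorphic_at f z -> wder f z (cderiv f z) 0.
Proof.
move=> fz; apply: is_derive_wder; rewrite /cderiv derive1E.
exact: (@DeriveDef _ _ _ (z : R[i]^o) 1 (f : R[i]^o -> R[i]^o)).
Qed.

Lemma wder_Re (phi : R -> R) z (d : R) : is_derive (complex.Re z) 1 phi d ->
  wder (fun x => (phi (complex.Re x))%:C) z (d / 2)%:C (d / 2)%:C.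
Proof.
move=> /is_derive_eps H e e0; have [r r0 {}H] := H _ e0.
exists (r / 2) => [|h hr]; first by rewrite divr_gt0.
have hr' : `|complex.Re h| < r.
  apply: le_lt_trans (normRe_le h) _; apply: le_lt_trans hr _.
  by rewrite ltr_pdivrMr// mulr2n mulrDr mulr1 ltrDl.
have -> : (phi (complex.Re (z + h)))%:C - (phi (complex.Re z))%:C -
   ((d / 2)%:C * h + (d / 2)%:C * conjc h) =
   (phi (complex.Re z + complex.Re h) - phi (complex.Re z) - d * complex.Re h)%:C.
  by apply: eqcP; rewrite !ReImE /=; field.
rewrite cmodC; apply: le_trans (H _ hr') _.
by rewrite ler_wpM2l ?normRe_le// ltW.
Qed.

Lemma wder_Im (phi : R -> R) z (d : R) : is_derive (complex.Im z) 1 phi d ->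
  wder (fun x => (phi (complex.Im x))%:C) z ((- d / 2)%:C * 'i) ((d / 2)%:C * 'i).
Proof.
move=> H; have imE (x : R[i]) : complex.Re (- 'i * x) = complex.Im x.
  by rewrite !ReImE /=; ring.
have H' : is_derive (complex.Re (- 'i * z)) 1 phi d by rewrite imE.
have := wder_comp (wder_Re H') (wderZ (- 'i) (wder_id z)).
move=> /(@wder_eq _ _ _ _ _ ((- d / 2)%:C * 'i) ((d / 2)%:C * 'i)) H1.
apply: wder_ext (H1 _ _) => [x| |]; first by rewrite imE.
- by apply: eqcP; rewrite !ReImE /=; field.
- by apply: eqcP; rewrite !ReImE /=; field.
Qed.

(** Restriction to a real line. *)
Lemma wder_line f z w (t : R) a b : wder f (z + t%:C * w) a b ->
  is_derive t 1 (fun s : R => complex.Re (f (z + s%:C * w)))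
    (complex.Re (a * w + b * conjc w)).
Proof.
move=> H; apply: eps_is_derive => e e0.
have w1 : 0 < cmod w + 1 by rewrite ltr_wpDl ?cmod_ge0.
have [d d0 {}H] := H _ (divr_gt0 e0 w1).
exists (d / (cmod w + 1)); first by rewrite divr_gt0.
move=> h hr; have e1 : cmod (h%:C * w) = `|h| * cmod w by rewrite cmodM cmodC.
have hd : cmod (h%:C * w) <= d.
  rewrite e1; apply: le_trans (_ : `|h| * (cmod w + 1) <= _).
    by rewrite ler_wpM2l// lerDl.
  by rewrite -ler_pdivlMr// ltW.
have := H _ hd; set X := (X in cmod X) => HX.
have -> : complex.Re (f (z + (t + h)%:C * w)) - complex.Re (f (z + t%:C * w)) -
     complex.Re (a * w + b * conjc w) * h = complex.Re X.
  have -> : z + (t + h)%:C * w = z + t%:C * w + h%:C * w by rewrite rmorphD /=; ring.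
  by rewrite /X !ReImE /=; ring.
apply: le_trans (normRe_le _) _; apply: le_trans HX _.
rewrite e1 mulrCA mulrC ler_wpM2r// mulrAC ler_pdivrMr// ler_wpM2l ?ltW//.
by rewrite ltrDl.
Qed.

(** The complex exponential. *)
Definition cexp z : R[i] :=
  (expR (complex.Re z))%:C * ((cos (complex.Im z))%:C + (sin (complex.Im z))%:C * 'i).

Lemma wder_cexp z : wder cexp z (cexp z) 0.
Proof.
have He := wder_Re (is_derive_expR (complex.Re z)).
have Hc := wder_Im (is_derive_cos (complex.Im z)).
have Hs := wder_Im (is_derive_sin (complex.Im z)).
have H := wderM He (wderD Hc (wderM Hs (wder_cst 'i z))).
apply: wder_ext (wder_eq H _ _) => //; rewrite /cexp.
- move: (expR _) (cos _) (sin _) => E C S.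
  by apply: eqcP; rewrite !ReImE /=; field.
- move: (expR _) (cos _) (sin _) => E C S.
  by apply: eqcP; rewrite !ReImE /=; field.
Qed.

Lemma cexpD z w : cexp (z + w) = cexp z * cexp w.
Proof.
rewrite /cexp !ReImE expRD cosD sinD.
move: (expR _) (expR _) (cos _) (sin _) (cos _) (sin _) => E1 E2 C1 S1 C2 S2.
by apply: eqcP; rewrite !ReImE /=; ring.
Qed.

Lemma cexp0 : cexp 0 = 1.
Proof. by rewrite /cexp /= expR0 cos0 sin0 mul0r addr0 mulr1. Qed.

Lemma cmod_cexp z : cmod (cexp z) = expR (complex.Re z).
Proof.
rewrite /cexp cmodM cmodC ger0_norm ?expR_ge0//.
have -> : cmod ((cos (complex.Im z))%:C + (sin (complex.Im z))%:C * 'i) = 1.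
  by rewrite cmodE !ReImE /= !(mulr0, mul0r, mulr1, subr0, addr0, add0r) cos2Dsin2 sqrtr1.
by rewrite mulr1.
Qed.

Lemma cexp_neq0 z : cexp z != 0.
Proof. by rewrite -cmod_gt0 cmod_cexp expR_gt0. Qed.

Lemma cexpN z : cexp (- z) = (cexp z)^-1.
Proof.
by apply: (mulfI (cexp_neq0 z)); rewrite divff ?cexp_neq0// -cexpD subrr cexp0.
Qed.

Lemma cexp2pi z : cexp (z + (2 * pi)%:C * 'i) = cexp z.
Proof.
have c2 : cos (2 * pi) = 1 :> R by rewrite mulr2n mulrDl !mul1r cosDpi cospi opprK.
have s2 : sin (2 * pi) = 0 :> R by rewrite mulr2n mulrDl !mul1r sinDpi sinpi oppr0.
rewrite cexpD; set u := cexp (_ * _).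
have -> : u = 1; last by rewrite mulr1.
rewrite /u /cexp !ReImE /= !(mulr0, mul0r, mulr1, subr0, addr0, add0r).
by rewrite oppr0 expR0 c2 s2 mul0r addr0 mulr1.
Qed.

Lemma wderX f z a k : wder f z a 0 ->
  wder (fun x => f x ^+ k) z (k%:R * f z ^+ k.-1 * a) 0.
Proof.
move=> H; elim: k => [|k ih].
  apply: wder_ext (wder_eq (wder_cst 1 z) _ _) => //.
  by rewrite mulr0n !mul0r.
apply: wder_ext (wder_eq (wderM H ih) _ _) => [x| |].
- by rewrite exprS.
- rewrite /=; case: k {ih} => [|k]; first by rewrite expr0; ring.
  by rewrite /= [X in _ = X * _ * _]mulrS exprS; ring.
- by rewrite mul0r mulr0 addr0.
Qed.

End Links.

(** * Integrals over intervals, and the method of quadrisection *)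

Section RealIntegral.
Variable R : realType.
Implicit Types (f g : R -> R) (a b c : R).

(** The integral of [f] over [a, b], for [a <= b]. *)
Definition rint f a b : R := \int[@lebesgue_measure R]_(t in `[a, b]) f t.

(** Two-sided continuity at each point of a closed interval. *)
Definition cok f a b := forall t, a <= t <= b -> {for t, continuous f}.

Lemma is_derive_continuous f (t d : R) : is_derive t 1 f d -> {for t, continuous f}.
Proof. by move=> [df _]; apply: differentiable_continuous; apply/derivable1_diffP. Qed.

Lemma cok_sub f a b a' b' : cok f a b -> a <= a' -> b' <= b -> cok f a' b'.
Proof.
move=> H h1 h2 t /andP[t1 t2]; apply: H.
by rewrite (le_trans h1 t1) (le_trans t2 h2).
Qed.

Lemma cok_within f a b : cok f a b -> {within `[a, b], continuous f}.
Proof.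
move=> H; apply: continuous_in_subspaceT => t.
by rewrite inE /= in_itv /=; apply: H.
Qed.

Lemma cok_integrable f a b : cok f a b ->
  (@lebesgue_measure R).-integrable `[a, b] (EFin \o f).
Proof.
move=> /cok_within H.
by apply: continuous_compact_integrable => //; exact: segment_compact.
Qed.

Lemma cokD f g a b : cok f a b -> cok g a b -> cok (fun t => f t + g t) a b.
Proof. by move=> hf hg t tab; apply: cvgD; [exact: hf|exact: hg]. Qed.

Lemma cokB f g a b : cok f a b -> cok g a b -> cok (fun t => f t - g t) a b.
Proof. by move=> hf hg t tab; apply: cvgB; [exact: hf|exact: hg]. Qed.

Lemma cokM f g a b : cok f a b -> cok g a b -> cok (fun t => f t * g t) a b.
Proof. by move=> hf hg t tab; apply: cvgM; [exact: hf|exact: hg]. Qed.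

Lemma cok_cst (k : R) a b : cok (fun=> k) a b.
Proof. by move=> t _; exact: cvg_cst. Qed.

Lemma cokZ f (k : R) a b : cok f a b -> cok (fun t => k * f t) a b.
Proof. by move=> hf; apply: cokM hf; exact: cok_cst. Qed.

Lemma rint_ext f g a b : (forall t, a <= t <= b -> f t = g t) ->
  rint f a b = rint g a b.
Proof.
move=> H; apply: eq_Rintegral => t; rewrite inE /= in_itv /=.
exact: H.
Qed.

Lemma rintD f g a b : cok f a b -> cok g a b ->
  rint (fun t => f t + g t) a b = rint f a b + rint g a b.
Proof. by move=> hf hg; apply: RintegralD => //; exact: cok_integrable. Qed.

Lemma rintB f g a b : cok f a b -> cok g a b ->
  rint (fun t => f t - g t) a b = rint f a b - rint g a b.
Proof. by move=> hf hg; apply: RintegralB => //; exact: cok_integrable. Qed.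

Lemma rintZ f (k : R) a b : cok f a b ->
  rint (fun t => k * f t) a b = k * rint f a b.
Proof. by move=> hf; apply: RintegralZl => //; exact: cok_integrable. Qed.

Lemma rint_cst (k : R) a b : a <= b -> rint (fun=> k) a b = k * (b - a).
Proof.
move=> ab; rewrite /rint Rintegral_cst//= lebesgue_measure_itv /= lte_fin.
move: ab; rewrite le_eqVlt => /orP[/eqP ->|ab]; last by rewrite ab.
by rewrite ltxx subrr.
Qed.

Lemma rint_le f g a b : cok f a b -> cok g a b ->
  (forall t, a <= t <= b -> f t <= g t) -> rint f a b <= rint g a b.
Proof.
move=> hf hg H; apply: le_Rintegral => //; exact: cok_integrable.
Qed.

Lemma rint_cat f a b c : a <= c -> c <= b -> cok f a b ->
  rint f a b = rint f a c + rint f c b.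
Proof.
move=> ac cb hf; have hcb := cok_sub hf ac (lexx b).
have := @Rintegral_itvB R f (BLeft a) (BRight b) c (cok_integrable hf).
rewrite !bnd_simp => /(_ ac cb) H.
rewrite /rint [X in _ = _ + X](_ : _ =
  \int[lebesgue_measure]_(x in `]c, b]) f x); last first.
  apply/esym/Rintegral_itv_obnd_cbnd.
  apply: integrableS (cok_integrable hcb) => //.
  by apply: subset_itvr; rewrite bnd_simp.
by rewrite -H addrC subrK.
Qed.

Lemma rint_bound f (k e : R) a b : a <= b -> cok f a b ->
  (forall t, a <= t <= b -> `|f t - k| <= e) ->
  `|rint f a b - k * (b - a)| <= e * (b - a).
Proof.
move=> ab hf H; rewrite ler_distl -mulrBl -mulrDl -!rint_cst//.
apply/andP; split.
- by apply: (rint_le (@cok_cst _ a b) hf) => t /H; rewrite ler_distl => /andP[].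
- by apply: (rint_le hf (@cok_cst _ a b)) => t /H; rewrite ler_distl => /andP[].
Qed.

Lemma rint_FTC (f F : R -> R) a b : a < b -> cok f a b ->
  (forall t, a <= t <= b -> is_derive t 1 F (f t)) ->
  rint f a b = F b - F a.
Proof.
move=> ab hf hF; rewrite /rint /Rintegral.
rewrite (@continuous_FTC2 R f F a b ab) //.
- exact: cok_within.
- have dF : cok F a b by move=> t /hF; exact: is_derive_continuous.
  have := cok_within dF => /(continuous_within_itvP _ ab)[_ h1 h2].
  split => // t; rewrite in_itv /= => /andP[t1 t2].
  by have [] := hF t (introT andP (conj (ltW t1) (ltW t2))).
- move=> t; rewrite in_itv /= => /andP[t1 t2]; rewrite derive1E.
  by have [_ ->] := hF t (introT andP (conj (ltW t1) (ltW t2))).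
Qed.

End RealIntegral.

Section Quadrisection.
Variable R : realType.
Implicit Types (a b c d : R) (Phi : R -> R -> R -> R -> R).

Local Notation rect := (R * R * (R * R))%type.

(** The quarters of a rectangle are examined in turn; the first whose value of
    [Phi] is at least a quarter of that of the rectangle is selected, and the
    last one by default. *)
Definition sub4 Phi (q : rect) : rect :=
  let: ((a, b), (c, d)) := q in
  let m := (a + b) / 2 in let n := (c + d) / 2 in
  let p := Phi a b c d / 4 in
  if p <= Phi a m c n then ((a, m), (c, n)) else
  if p <= Phi m b c n then ((m, b), (c, n)) else
  if p <= Phi a m n d then ((a, m), (n, d)) else ((m, b), (n, d)).

(** A function of rectangles that is subadditive under quadrisection, and
    [o(diameter ^ 2)] on the rectangles around each point, is nonpositive: this
    is the argument of Goursat. *)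
Lemma quadrisection Phi (a0 b0 c0 d0 : R) : a0 < b0 -> c0 < d0 ->
  (forall a b c d, a0 <= a -> a < b -> b <= b0 -> c0 <= c -> c < d -> d <= d0 ->
    Phi a b c d <= Phi a ((a + b) / 2) c ((c + d) / 2)
      + Phi ((a + b) / 2) b c ((c + d) / 2)
      + Phi a ((a + b) / 2) ((c + d) / 2) d
      + Phi ((a + b) / 2) b ((c + d) / 2) d) ->
  (forall x y, a0 <= x <= b0 -> c0 <= y <= d0 -> forall e, 0 < e ->
    exists2 r, 0 < r & forall a b c d,
      a0 <= a -> a < b -> b <= b0 -> c0 <= c -> c < d -> d <= d0 ->
      a <= x <= b -> c <= y <= d -> (b - a) + (d - c) <= r ->
      Phi a b c d <= e * ((b - a) + (d - c)) ^+ 2) ->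
  Phi a0 b0 c0 d0 <= 0.
Proof.
move=> ab0 cd0 Hsub Hloc; rewrite leNgt; apply/negP => P0.
(* nested rectangles [A k, B k] x [C k, D k], halved at each step *)
pose q k := iter k (sub4 Phi) ((a0, b0), (c0, d0)).
pose A k := (q k).1.1; pose B k := (q k).1.2.
pose C k := (q k).2.1; pose D k := (q k).2.2.
pose l k := (b0 - a0) / 2 ^+ k; pose m k := (d0 - c0) / 2 ^+ k.
have l0 k : 0 < l k by rewrite divr_gt0 ?subr_gt0 ?exprn_gt0.
have m0 k : 0 < m k by rewrite divr_gt0 ?subr_gt0 ?exprn_gt0.
have lS k : l k = 2 * l k.+1.
  by rewrite /l exprS; field; rewrite expf_neq0.
have mS k : m k = 2 * m k.+1.
  by rewrite /m exprS; field; rewrite expf_neq0.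
have step k : [/\ a0 <= A k, B k <= b0, c0 <= C k & D k <= d0] /\
    [/\ B k = A k + l k, D k = C k + m k &
      Phi a0 b0 c0 d0 / 4 ^+ k <= Phi (A k) (B k) (C k) (D k)].
  elim: k => [|k [[h1 h2 h3 h4] [h5 h6 h7]]].
    by rewrite /A /B /C /D /l /m /= !expr0 !divr1 !subrKC.
  rewrite /A /B /C /D [q k.+1]/(sub4 Phi (q k)).
  move: h1 h2 h3 h4 h5 h6 h7; rewrite /A /B /C /D.
  case: (q k) => [[a b] [c d]] /= h1 h2 h3 h4 h5 h6 h7.
  have hab : a < b by rewrite h5 ltrDl.
  have hcd : c < d by rewrite h6 ltrDl.
  have := Hsub a b c d h1 hab h2 h3 hcd h4.
  have e1 : (a + b) / 2 = a + l k.+1 by rewrite h5 lS; field.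
  have e2 : (c + d) / 2 = c + m k.+1 by rewrite h6 mS; field.
  have e3 : b = a + l k.+1 + l k.+1 by rewrite h5 lS; ring.
  have e4 : d = c + m k.+1 + m k.+1 by rewrite h6 mS; ring.
  have lp := l0 k.+1; have mp := m0 k.+1.
  have e5 : Phi a0 b0 c0 d0 / 4 ^+ k.+1 <= Phi a b c d / 4.
    by rewrite exprS invfM mulrCA mulrC ler_wpM2r.
  rewrite e1 e2 => Hs.
  case: ifPn => [p1|].
    by split; split => //=; lra.
  rewrite -ltNge => p1; case: ifPn => [p2|].
    by split; split => //=; lra.
  rewrite -ltNge => p2; case: ifPn => [p3|].
    by split; split => //=; lra.
  rewrite -ltNge => p3; split; split => //=; lra.
have mono k : A k <= A k.+1 /\ C k <= C k.+1.
  have [_ [h5 h6 _]] := step k.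
  move: h5 h6; rewrite /A /B /C /D [q k.+1]/(sub4 Phi (q k)).
  case: (q k) => [[a b] [c d]] /= h5 h6.
  have lp := l0 k; have mp := m0 k.
  by do ![case: ifP => _ /=]; split; lra.
have monoB k : B k.+1 <= B k /\ D k.+1 <= D k.
  have [_ [h5 h6 _]] := step k.
  move: h5 h6; rewrite /A /B /C /D [q k.+1]/(sub4 Phi (q k)).
  case: (q k) => [[a b] [c d]] /= h5 h6.
  have lp := l0 k; have mp := m0 k.
  by do ![case: ifP => _ /=]; split; lra.
have monoA j k : (j <= k)%N -> [/\ A j <= A k, C j <= C k, B k <= B j & D k <= D j].
  move=> /subnK <-; elim: (k - j)%N => [|i [h1 h2 h3 h4]]; first by [].
  rewrite addSn; have [u1 u2] := mono (i + j)%N.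
  have [v1 v2] := monoB (i + j)%N.
  by split; [apply: le_trans h1 u1|apply: le_trans h2 u2|
    apply: le_trans v1 h3|apply: le_trans v2 h4].
have AB j k : A j <= B k.
  have /monoA[h1 _ _ _] := leq_maxl j k; have /monoA[_ _ h2 _] := leq_maxr j k.
  apply: le_trans h1 (le_trans _ h2).
  by have [_ [-> _ _]] := step (maxn j k); rewrite lerDl ltW.
have CD j k : C j <= D k.
  have /monoA[_ h1 _ _] := leq_maxl j k; have /monoA[_ _ _ h2] := leq_maxr j k.
  apply: le_trans h1 (le_trans _ h2).
  by have [_ [_ -> _]] := step (maxn j k); rewrite lerDl ltW.
(* the common point of the nested rectangles *)
pose x := sup (range A); pose y := sup (range C).
have Ax k : A k <= x <= B k.
  apply/andP; split.
    by apply: ub_le_sup; [exists (B 0%N) => _ [j _ <-]|exists k].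
  by apply: ge_sup; [exists (A 0%N), 0%N|move=> _ [j _ <-]].
have Cy k : C k <= y <= D k.
  apply/andP; split.
    by apply: ub_le_sup; [exists (D 0%N) => _ [j _ <-]|exists k].
  by apply: ge_sup; [exists (C 0%N), 0%N|move=> _ [j _ <-]].
have L0 : 0 < (b0 - a0) + (d0 - c0) by rewrite addr_gt0 ?subr_gt0.
set L := (b0 - a0) + (d0 - c0) in L0.
have e0 : 0 < Phi a0 b0 c0 d0 / (2 * L ^+ 2).
  by rewrite divr_gt0// mulr_gt0// exprn_gt0.
have [r r0 Hr] := Hloc x y (Ax 0%N) (Cy 0%N) _ e0.
have [k Hk] : exists k, L / 2 ^+ k <= r.
  have := truncnS_gt (L / r) => Lr.
  exists (Num.truncn (L / r)).+1; rewrite ler_pdivrMr ?exprn_gt0// mulrC.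
  rewrite -ler_pdivrMr//; apply: le_trans (ltW Lr) _.
  by rewrite -natrX ler_nat ltnW// ltn_expl.
have [[h1 h2 h3 h4] [h5 h6 h7]] := step k.
have hl : B k - A k + (D k - C k) = L / 2 ^+ k.
  by rewrite h5 h6 /l /m /L mulrDl; ring.
have := Hr (A k) (B k) (C k) (D k) h1 _ h2 h3 _ h4 (Ax k) (Cy k).
rewrite hl h5 h6 !ltrDl -h5 -h6 => /(_ (l0 k) (m0 k) Hk) h8.
have := le_trans h7 h8; apply/negP; rewrite -ltNge.
have -> : Phi a0 b0 c0 d0 / (2 * L ^+ 2) * (L / 2 ^+ k) ^+ 2 =
    Phi a0 b0 c0 d0 / 4 ^+ k / 2.
  rewrite (_ : 4 = 2 ^+ 2); last by ring.
  by rewrite -exprM mulnC exprM; field; rewrite expf_neq0//= gt_eqF.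
by rewrite ltr_pdivrMr// mulr_natr mulr2n ltrDl divr_gt0// exprn_gt0.
Qed.

End Quadrisection.

(** * Gauss's theorem on rectangles *)

Section Gauss.
Variable R : realType.
Implicit Types (a b c d x y : R) (V : R[i] -> R[i]).

(** The flux of the vector field [(Re V, Im V)] out of [a, b] x [c, d]. *)
Definition flux V a b c d : R :=
  rint (fun y => complex.Re (V (b +i* y))) c d
  - rint (fun y => complex.Re (V (a +i* y))) c d
  + rint (fun x => complex.Im (V (x +i* d))) a b
  - rint (fun x => complex.Im (V (x +i* c))) a b.

Lemma wder_vert V x t al be : wder V (x +i* t) al be ->
  is_derive t 1 (fun s => complex.Re (V (x +i* s))) (- complex.Im (al - be)).
Proof.
have e s : x +i* s = x%:C + s%:C * 'i :> R[i] by apply: eqcP; rewrite !ReImE /=; ring.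
rewrite e => /wder_line H.
have -> : (fun s => complex.Re (V (x +i* s))) =
          (fun s => complex.Re (V (x%:C + s%:C * 'i))).
  by apply/funext => s; rewrite e.
by apply: (is_derive_eq H); rewrite !ReImE /=; ring.
Qed.

Lemma wder_hor V y t al be : wder V (t +i* y) al be ->
  is_derive t 1 (fun s => complex.Re (V (s +i* y))) (complex.Re (al + be)).
Proof.
have e s : s +i* y = y%:C * 'i + s%:C * 1 :> R[i].
  by apply: eqcP; rewrite !ReImE /=; ring.
rewrite e => /wder_line H.
have -> : (fun s => complex.Re (V (s +i* y))) =
          (fun s => complex.Re (V (y%:C * 'i + s%:C * 1))).
  by apply/funext => s; rewrite e.
by apply: (is_derive_eq H); rewrite !ReImE /=; ring.
Qed.

Lemma wder_hor_Im V y t al be : wder V (t +i* y) al be ->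
  is_derive t 1 (fun s => complex.Im (V (s +i* y))) (complex.Im (al + be)).
Proof.
move=> /(wderZ (- 'i))/wder_hor H.
have imE (x : R[i]) : complex.Re (- 'i * x) = complex.Im x.
  by rewrite !ReImE /=; ring.
have -> : (fun s => complex.Im (V (s +i* y))) =
          (fun s => complex.Re (- 'i * V (s +i* y))).
  by apply/funext => s; rewrite imE.
by apply: (is_derive_eq H); rewrite -mulrDr imE.
Qed.

Variables (V : R[i] -> R[i]) (al be : R[i] -> R[i]) (a0 b0 c0 d0 : R).
Hypothesis ab0 : a0 < b0.
Hypothesis cd0 : c0 < d0.
Hypothesis HV : forall x y, a0 <= x <= b0 -> c0 <= y <= d0 ->
  wder V (x +i* y) (al (x +i* y)) (be (x +i* y)).

Lemma cok_vert x c d : a0 <= x <= b0 -> c0 <= c -> d <= d0 ->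
  cok (fun y => complex.Re (V (x +i* y))) c d.
Proof.
move=> hx h1 h2 t /andP[h3 h4].
have ht : c0 <= t <= d0 by rewrite (le_trans h1) ?(le_trans h4).
exact: is_derive_continuous (wder_vert (HV hx ht)).
Qed.

Lemma cok_hor y a b : c0 <= y <= d0 -> a0 <= a -> b <= b0 ->
  cok (fun x => complex.Im (V (x +i* y))) a b.
Proof.
move=> hy h1 h2 t /andP[h3 h4].
have ht : a0 <= t <= b0 by rewrite (le_trans h1) ?(le_trans h4).
exact: is_derive_continuous (wder_hor_Im (HV ht hy)).
Qed.

Lemma flux_sub4 a b c d : a0 <= a -> a < b -> b <= b0 ->
    c0 <= c -> c < d -> d <= d0 ->
  flux V a b c d = flux V a ((a + b) / 2) c ((c + d) / 2)
      + flux V ((a + b) / 2) b c ((c + d) / 2)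
      + flux V a ((a + b) / 2) ((c + d) / 2) d
      + flux V ((a + b) / 2) b ((c + d) / 2) d.
Proof.
move=> h1 h2 h3 h4 h5 h6; set m := (a + b) / 2; set n := (c + d) / 2.
have am : a <= m by rewrite /m; lra.
have mb : m <= b by rewrite /m; lra.
have cn : c <= n by rewrite /n; lra.
have nd : n <= d by rewrite /n; lra.
have ha : a0 <= a <= b0 by rewrite h1; lra.
have hb : a0 <= b <= b0 by rewrite h3 andbT; lra.
have hc : c0 <= c <= d0 by rewrite h4; lra.
have hd : c0 <= d <= d0 by rewrite h6 andbT; lra.
rewrite /flux (rint_cat cn nd (cok_vert ha h4 h6)).
rewrite (rint_cat cn nd (cok_vert hb h4 h6)).
rewrite (rint_cat am mb (cok_hor hc h1 h3)).
rewrite (rint_cat am mb (cok_hor hd h1 h3)).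
by ring.
Qed.

(** The flux out of small rectangles around a point of differentiability. *)
Lemma flux_local x y : a0 <= x <= b0 -> c0 <= y <= d0 -> forall e, 0 < e ->
  exists2 r, 0 < r & forall a b c d,
    a0 <= a -> a < b -> b <= b0 -> c0 <= c -> c < d -> d <= d0 ->
    a <= x <= b -> c <= y <= d -> (b - a) + (d - c) <= r ->
    `|flux V a b c d - 2 * complex.Re (al (x +i* y)) * ((b - a) * (d - c))|
      <= e * ((b - a) + (d - c)) ^+ 2.
Proof.
move=> hx hy e e0; set A := al _; set B := be (x +i* y).
have e2 : 0 < e / 2 by rewrite divr_gt0.
have [r r0 Hr] := HV hx hy e2; exists r => //.
move=> a b c d h1 h2 h3 h4 h5 h6 /andP[h7 h8] /andP[h9 h10] hl.
set l := (b - a) + (d - c) in hl *.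
have l0 : 0 <= l by rewrite /l; lra.
pose E h := V ((x +i* y) + h) - V (x +i* y) - (A * h + B * conjc h).
have HE u v : a <= u <= b -> c <= v <= d -> cmod (E ((u - x) +i* (v - y))) <= e / 2 * l.
  move=> hu hv; set h := (_ +i* _).
  have hh : cmod h <= l.
    apply: le_trans (cmod_le_ReIm _) _; rewrite /h /= /l lerD// ler_norml; lra.
  by apply: le_trans (Hr _ (le_trans hh hl)) _; rewrite ler_wpM2l// ltW.
have VE u v : V (u +i* v) = V (x +i* y) + A * ((u - x) +i* (v - y)) +
    B * conjc ((u - x) +i* (v - y)) + E ((u - x) +i* (v - y)).
  rewrite /E; have -> : (x +i* y) + ((u - x) +i* (v - y)) = u +i* v.
    by apply: eqcP; rewrite !ReImE /= subrKC.
  by ring.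
have ha : a0 <= a <= b0 by rewrite h1; lra.
have hb : a0 <= b <= b0 by rewrite h3 andbT; lra.
have hc : c0 <= c <= d0 by rewrite h4; lra.
have hd : c0 <= d <= d0 by rewrite h6 andbT; lra.
have ra : a <= a <= b by rewrite lexx ltW.
have rb : a <= b <= b by rewrite lexx ltW.
have rc : c <= c <= d by rewrite lexx ltW.
have rd : c <= d <= d by rewrite lexx ltW.
have K1 := cokB (cok_vert hb h4 h6) (cok_vert ha h4 h6).
have K2 := cokB (cok_hor hd h1 h3) (cok_hor hc h1 h3).
have F1 t : c <= t <= d -> `|complex.Re (V (b +i* t)) - complex.Re (V (a +i* t))
     - complex.Re (A + B) * (b - a)| <= e * l.
  move=> ht; rewrite (VE b t) (VE a t); have := HE b t rb ht; have := HE a t ra ht.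
  set E1 := E _; set E2 := E _ => H1 H2.
  have -> : forall u v w : R[i], complex.Re (u + A * ((b - x) +i* (t - y)) +
     B * conjc ((b - x) +i* (t - y)) + v) - complex.Re (u + A * ((a - x) +i* (t - y)) +
     B * conjc ((a - x) +i* (t - y)) + w) - complex.Re (A + B) * (b - a) =
     complex.Re v - complex.Re w.
    by move=> u v w; rewrite !ReImE /=; ring.
  apply: le_trans (ler_normB _ _) _; rewrite [e]splitr mulrDl lerD//.
    exact: le_trans (normRe_le _) _.
  exact: le_trans (normRe_le _) _.
have F2 t : a <= t <= b -> `|complex.Im (V (t +i* d)) - complex.Im (V (t +i* c))
     - complex.Re (A - B) * (d - c)| <= e * l.
  move=> ht; rewrite (VE t d) (VE t c); have := HE t d ht rd; have := HE t c ht rc.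
  set E1 := E _; set E2 := E _ => H1 H2.
  have -> : forall u v w : R[i], complex.Im (u + A * ((t - x) +i* (d - y)) +
     B * conjc ((t - x) +i* (d - y)) + v) - complex.Im (u + A * ((t - x) +i* (c - y)) +
     B * conjc ((t - x) +i* (c - y)) + w) - complex.Re (A - B) * (d - c) =
     complex.Im v - complex.Im w.
    by move=> u v w; rewrite !ReImE /=; ring.
  apply: le_trans (ler_normB _ _) _; rewrite [e]splitr mulrDl lerD//.
    exact: le_trans (normIm_le _) _.
  exact: le_trans (normIm_le _) _.
have G1 := rint_bound (ltW h5) K1 F1; have G2 := rint_bound (ltW h2) K2 F2.
rewrite rintB in G1; [|exact: cok_vert|exact: cok_vert].
rewrite rintB in G2; [|exact: cok_hor|exact: cok_hor].
rewrite /flux; move: G1 G2; set X1 := rint _ _ _; set X2 := rint _ _ _.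
set X3 := rint _ _ _; set X4 := rint _ _ _ => G1 G2.
have -> : X1 - X2 + X3 - X4 - 2 * complex.Re A * ((b - a) * (d - c)) =
   (X1 - X2 - complex.Re (A + B) * (b - a) * (d - c)) +
   (X3 - X4 - complex.Re (A - B) * (d - c) * (b - a)).
  by rewrite !ReImE; ring.
apply: le_trans (ler_normD _ _) _; apply: le_trans (lerD G1 G2) _.
by rewrite -mulrDr -/l addrC -/l expr2 mulrA.
Qed.

(** The theorem of Gauss, as an inequality: a mass [M] that is subadditive on
    rectangles and of density at most [div V = 2 Re (dV/dz)] is at most the
    flux of [V].  Continuity of the divergence is not needed. *)
Theorem gauss_le (M : R -> R -> R -> R -> R) :
  (forall a b c d, a0 <= a -> a < b -> b <= b0 -> c0 <= c -> c < d -> d <= d0 ->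
    M a b c d <= M a ((a + b) / 2) c ((c + d) / 2)
      + M ((a + b) / 2) b c ((c + d) / 2)
      + M a ((a + b) / 2) ((c + d) / 2) d
      + M ((a + b) / 2) b ((c + d) / 2) d) ->
  (forall x y, a0 <= x <= b0 -> c0 <= y <= d0 -> forall e, 0 < e ->
    exists2 r, 0 < r & forall a b c d,
      a0 <= a -> a < b -> b <= b0 -> c0 <= c -> c < d -> d <= d0 ->
      a <= x <= b -> c <= y <= d -> (b - a) + (d - c) <= r ->
      M a b c d <= (2 * complex.Re (al (x +i* y)) + e) * ((b - a) * (d - c))) ->
  M a0 b0 c0 d0 <= flux V a0 b0 c0 d0.
Proof.
move=> Hsub Hloc; rewrite -subr_le0.
apply: (@quadrisection _ (fun a b c d => M a b c d - flux V a b c d)) => //.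
  move=> a b c d h1 h2 h3 h4 h5 h6.
  by rewrite flux_sub4//; have := Hsub a b c d h1 h2 h3 h4 h5 h6; lra.
move=> x y hx hy e e0; have e2 : 0 < e / 2 by rewrite divr_gt0.
have [r r0 H1] := Hloc x y hx hy _ e2; have [r' r'0 H2] := flux_local hx hy e2.
exists (Num.min r r'); first by rewrite lt_min r0.
move=> a b c d h1 h2 h3 h4 h5 h6 h7 h8; rewrite le_min => /andP[h9 h10].
have := H1 a b c d h1 h2 h3 h4 h5 h6 h7 h8 h9.
have := H2 a b c d h1 h2 h3 h4 h5 h6 h7 h8 h10.
rewrite ler_norml => /andP[+ _].
set A := complex.Re _; set F := flux _ _ _ _ _; set N := M _ _ _ _.
set p := b - a; set q := d - c.
have p0 : 0 < p by rewrite subr_gt0.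
have q0 : 0 < q by rewrite subr_gt0.
have pq : e / 2 * (p * q) <= e / 2 * (p + q) ^+ 2.
  by rewrite ler_wpM2l ?ltW//; nra.
by rewrite [(2 * A + _) * _]mulrDl => F1 F2; lra.
Qed.

Corollary gauss_ge0 :
  (forall x y, a0 <= x <= b0 -> c0 <= y <= d0 -> 0 <= complex.Re (al (x +i* y))) ->
  0 <= flux V a0 b0 c0 d0.
Proof.
move=> H; apply: (@gauss_le (fun _ _ _ _ => 0)).
  by move=> *; rewrite !addr0.
move=> x y hx hy e e0; exists 1 => // a b c d _ h2 _ _ h5 _ _ _ _.
by rewrite mulr_ge0 ?mulr_ge0 ?subr_ge0 ?(ltW h2) ?(ltW h5)// addr_ge0 ?(ltW e0)// mulr_ge0// H.
Qed.

End Gauss.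

(** The case of a divergence-free field. *)
Corollary gauss_eq0 (R : realType) (V al be : R[i] -> R[i]) (a0 b0 c0 d0 : R) :
  a0 < b0 -> c0 < d0 ->
  (forall x y, a0 <= x <= b0 -> c0 <= y <= d0 ->
     wder V (x +i* y) (al (x +i* y)) (be (x +i* y))) ->
  (forall x y, a0 <= x <= b0 -> c0 <= y <= d0 -> complex.Re (al (x +i* y)) = 0) ->
  flux V a0 b0 c0 d0 = 0.
Proof.
move=> ab cd HV H; apply/eqP; rewrite eq_le; apply/andP; split; last first.
  by apply: (gauss_ge0 ab cd HV) => x y hx hy; rewrite H.
have HV' x y (hx : a0 <= x <= b0) (hy : c0 <= y <= d0) := wderN (HV x y hx hy).
have H' : 0 <= flux (fun z => - V z) a0 b0 c0 d0.
  apply: (@gauss_ge0 R _ (fun z => - al z) (fun z => - be z)) => //.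
  by move=> x y hx hy; rewrite ReN H// oppr0.
have ha : a0 <= a0 <= b0 by rewrite lexx ltW.
have hb : a0 <= b0 <= b0 by rewrite lexx ltW.
have hc : c0 <= c0 <= d0 by rewrite lexx ltW.
have hd : c0 <= d0 <= d0 by rewrite lexx ltW.
have rN (f : R -> R) a b : cok f a b -> rint (fun t => - f t) a b = - rint f a b.
  by move=> hf; rewrite -mulN1r -rintZ//; apply: rint_ext => t _; rewrite mulN1r.
have e1 x : (fun y => complex.Re (- V (x +i* y))) = (fun y => - complex.Re (V (x +i* y))).
  by apply/funext => y; rewrite ReN.
have e2 y : (fun x => complex.Im (- V (x +i* y))) = (fun x => - complex.Im (V (x +i* y))).
  by apply/funext => x; rewrite ImN.
move: H'; rewrite /flux !e1 !e2.
rewrite !rN; [lra|..].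
- exact: (cok_hor HV hc).
- exact: (cok_hor HV hd).
- exact: (cok_vert HV ha).
- exact: (cok_vert HV hb).
Qed.

(** * Circle means *)

Section Strip.
Variable R : realType.
Implicit Types (s t : R) (z w zeta : R[i]) (f V : R[i] -> R[i]).

Local Notation T := (2 * pi : R).

Lemma T_gt0 : 0 < T. Proof. by rewrite mulr_gt0// pi_gt0. Qed.

(** The integral of [Re f] over a period of the vertical line [Re zeta = s].
    With [f = g \o cexp] this is an integral over the circle [|z| = e^s]. *)
Definition cm f s : R := rint (fun t => complex.Re (f (s +i* t))) 0 T.

(** Invariance under the translation by [2 pi i]. *)
Definition periodic f := forall zeta, f (zeta + T%:C * 'i) = f zeta.

Lemma cm_ext f g s : (forall t, f (s +i* t) = g (s +i* t)) -> cm f s = cm g s.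
Proof. by move=> H; apply: rint_ext => t _; rewrite H. Qed.

Lemma periodicE f s : periodic f -> f (s +i* T) = f (s +i* 0).
Proof.
by move=> pf; rewrite -[RHS]pf; congr f; apply: eqcP; rewrite !ReImE /=; ring.
Qed.

Lemma strip_flux V s1 s2 : periodic V -> flux V s1 s2 0 T = cm V s2 - cm V s1.
Proof.
move=> pV; rewrite /flux -/(cm V s2) -/(cm V s1) -[RHS]addr0 -addrA.
congr (_ + _); apply/eqP; rewrite subr_eq0; apply/eqP.
by apply: rint_ext => t _; rewrite periodicE.
Qed.

(** Circle means of the real part of a divergence-free field agree. *)
Lemma cm_const V al be s1 s2 : s1 < s2 -> periodic V ->
  (forall z, s1 <= complex.Re z <= s2 -> wder V z (al z) (be z)) ->
  (forall z, s1 <= complex.Re z <= s2 -> complex.Re (al z) = 0) ->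
  cm V s1 = cm V s2.
Proof.
move=> s12 pV HV Hal; apply/esym/eqP; rewrite -subr_eq0 -strip_flux//.
apply/eqP; apply: (@gauss_eq0 _ V al be) => //.
- exact: T_gt0.
- by move=> x y hx _; apply: HV.
- by move=> x y hx _; apply: Hal.
Qed.

(** If the circle means have a limit as the radius tends to 0, they equal it. *)
Lemma cm_limit V al be s l : periodic V ->
  (forall z, complex.Re z <= s -> wder V z (al z) (be z)) ->
  (forall z, complex.Re z <= s -> complex.Re (al z) = 0) ->
  (forall e : R, 0 < e -> exists2 s1, s1 < s & `|cm V s1 - l| <= e) ->
  cm V s = l.
Proof.
move=> pV HV Hal H; apply/eqP; rewrite -subr_eq0 -normr_le0; apply/ler_addgt0Pr.
move=> e /H[s1 s1s]; rewrite add0r (@cm_const V al be s1 s)//.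
  by move=> z /andP[_ zs]; exact: HV.
by move=> z /andP[_ zs]; exact: Hal.
Qed.

Lemma exists_radius s (d : R) : 0 < d -> exists2 s1, s1 < s & expR s1 <= d.
Proof.
move=> d0; exists (Num.min (s - 1) (ln d)).
  by rewrite gt_min ltrBlDr ltrDl ltr01.
by rewrite -[leRHS](lnK d0) ler_expR ge_min lexx orbT.
Qed.

Lemma periodic_cexp : periodic (@cexp R).
Proof. by move=> z; rewrite cexp2pi. Qed.

Lemma periodic_cexpN : periodic (fun z => @cexp R (- z)).
Proof.
have c1 : cexp (T%:C * 'i) = 1 by rewrite -[_ * _]add0r cexp2pi cexp0.
by move=> z; rewrite opprD cexpD [cexp (- (_ * _))]cexpN c1 invr1 mulr1.
Qed.

Lemma periodic_comp f : periodic (fun z => f (cexp z)).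
Proof. by move=> z; rewrite periodic_cexp. Qed.

Lemma cmod_cexp_line s t : cmod (cexp (s +i* t)) = expR s.
Proof. by rewrite cmod_cexp. Qed.

Lemma wder_holo_comp f g z a b : wder f (g z) a 0 -> wder g z b 0 ->
  wder (fun x => f (g x)) z (a * b) 0.
Proof.
move=> hf hg; apply: (wder_eq (wder_comp hf hg)).
  by rewrite mul0r addr0.
by rewrite mulr0 mul0r addr0.
Qed.

Lemma wder_holoM f g z a b : wder f z a 0 -> wder g z b 0 ->
  wder (fun x => f x * g x) z (a * g z + f z * b) 0.
Proof.
by move=> hf hg; apply: (wder_eq (wderM hf hg)); rewrite ?mul0r ?mulr0 ?addr0.
Qed.

Lemma wder_cexpN z : wder (fun x => @cexp R (- x)) z (- cexp (- z)) 0.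
Proof.
have := wder_holo_comp (wder_cexp (- z)) (wder_eq (wderN (wder_id z)) (erefl _) (oppr0 _)).
by rewrite mulrN1.
Qed.

Lemma wder_antiholo f z a : wder f z a 0 ->
  wder (fun x => conjc (f x)) z 0 (conjc a).
Proof. by move=> /wderJ; rewrite conjc0. Qed.

Lemma cm_conj f s : cm (fun z => conjc (f z)) s = cm f s.
Proof. by apply: rint_ext => t _; rewrite ReJ. Qed.

Lemma periodic_conj f : periodic f -> periodic (fun z => conjc (f z)).
Proof. by move=> pf z; rewrite pf. Qed.

Lemma cok_line f s : (forall t, exists a b, wder f (s +i* t) a b) ->
  cok (fun t => complex.Re (f (s +i* t))) 0 T.
Proof.
by move=> H t _; have [a [b /wder_vert]] := H t; exact: is_derive_continuous.
Qed.

(** For a holomorphic function, the mean of the real part over a circle is its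
    limit [l] at the centre, because the conjugate field is divergence-free. *)
Lemma cm_holo f f1 s l : periodic f ->
  (forall z, complex.Re z <= s -> wder f z (f1 z) 0) ->
  (forall e : R, 0 < e -> exists2 s1, s1 < s & forall t, `|complex.Re (f (s1 +i* t)) - l| <= e) ->
  cm f s = l * T.
Proof.
move=> pf Hf Hl; rewrite -cm_conj.
apply: (@cm_limit _ (fun=> 0) (fun z => conjc (f1 z)) s (l * T)).
- exact: periodic_conj.
- by move=> z zs; apply: wder_antiholo; exact: Hf.
- by [].
- move=> e e0; have [s1 s1s H1] := Hl _ (divr_gt0 e0 T_gt0); exists s1 => //.
  rewrite cm_conj; have -> : l * T = l * (T - 0) by rewrite subr0.
  have -> : e = e / T * (T - 0) by rewrite subr0 divfK// gt_eqF// T_gt0.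
  apply: rint_bound => [|| t _]; [exact/ltW/T_gt0| |exact: H1].
  by apply: cok_line => t; exists (f1 (s1 +i* t)), 0; apply: Hf; exact: ltW.
Qed.

(** The mean value theorem for holomorphic functions. *)
Lemma mean_value f f1 s :
  (forall z, cmod z <= expR s -> wder f z (f1 z) 0) ->
  cm (fun z => f (cexp z)) s = complex.Re (f 0) * T.
Proof.
move=> Hf; apply: (@cm_holo _ (fun z => f1 (cexp z) * cexp z)).
- exact: periodic_comp.
- move=> z zs; apply: wder_holo_comp (wder_cexp z).
  by apply: Hf; rewrite cmod_cexp ler_expR.
- have H0 : wder f 0 (f1 0) 0 by apply: Hf; rewrite cmod0 expR_ge0.
  move=> e /(wder_continuous H0)[d d0 Hd].
  have [s1 s1s hs1] := exists_radius s d0; exists s1 => // t.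
  rewrite -ReN -ReD; apply: le_trans (normRe_le _) _.
  by rewrite -[cexp _]add0r; apply: Hd; rewrite cmod_cexp_line.
Qed.

Lemma cm_mono_zero (c : R[i]) s : cm (fun z => c * cexp (- z)) s = 0.
Proof.
pose F (z : R[i]) := c * 'i * cexp (- z).
have HF z : wder F z (c * 'i * - cexp (- z)) (c * 'i * 0).
  exact: wderZ (wder_cexpN z).
have HG z : wder (fun z => c * cexp (- z)) z (c * - cexp (- z)) (c * 0).
  exact: wderZ (wder_cexpN z).
transitivity (complex.Re (F (s +i* T)) - complex.Re (F (s +i* 0))); last first.
  rewrite periodicE ?subrr// /F => z; by rewrite periodic_cexpN.
apply: (@rint_FTC _ _ (fun t => complex.Re (F (s +i* t)))).
- exact: T_gt0.
- by apply: (@cok_line (fun z => c * cexp (- z))) => t; eexists; eexists; exact: HG.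
- move=> t _; apply: (is_derive_eq (wder_vert (HF (s +i* t)))).
  by rewrite mulr0 subr0 !ReImE /=; ring.
Qed.

(** Cauchy's formula for the derivative at the centre. *)
Lemma cauchy_deriv f f1 s :
  (forall z, cmod z <= expR s -> wder f z (f1 z) 0) ->
  cm (fun z => f (cexp z) * cexp (- z)) s = complex.Re (f1 0) * T.
Proof.
move=> Hf.
have H0 : wder f 0 (f1 0) 0 by apply: Hf; rewrite cmod0 expR_ge0.
pose g z := f (cexp z) * cexp (- z) - f 0 * cexp (- z).
have Hfz z : complex.Re z <= s -> wder (fun x => f (cexp x) * cexp (- x)) z
  (f1 (cexp z) * cexp z * cexp (- z) + f (cexp z) * - cexp (- z)) 0.
  move=> zs; apply: wder_holoM (wder_cexpN z); apply: wder_holo_comp (wder_cexp z).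
  by apply: Hf; rewrite cmod_cexp ler_expR.
have H0z z : wder (fun x => f 0 * cexp (- x)) z (f 0 * - cexp (- z)) 0.
  by apply: (wder_eq (wderZ (f 0) (wder_cexpN z))); rewrite ?mulr0.
have -> : cm (fun z => f (cexp z) * cexp (- z)) s = cm g s.
  rewrite /cm; transitivity (rint (fun t => complex.Re (f (cexp (s +i* t)) * cexp (- (s +i* t)))
     - complex.Re (f 0 * cexp (- (s +i* t)))) 0 T).
    rewrite rintB.
    - by rewrite -[X in _ = _ - X]/(cm (fun z => f 0 * cexp (- z)) s) cm_mono_zero subr0.
    - apply: (@cok_line (fun z => f (cexp z) * cexp (- z))) => t.
      by eexists; eexists; apply: Hfz.
    - apply: (@cok_line (fun z => f 0 * cexp (- z))) => t.
      by eexists; eexists; apply: H0z.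
  by apply: rint_ext => t _; rewrite -ReN -ReD.
apply: (@cm_holo g (fun z => f1 (cexp z) * cexp z * cexp (- z) +
    f (cexp z) * - cexp (- z) - f 0 * - cexp (- z))).
- by move=> z; rewrite /g periodic_cexp periodic_cexpN.
- by move=> z /Hfz H1; apply: (wder_eq (wderB H1 (H0z z))); rewrite ?subr0.
- move=> e /H0[d d0 Hd].
  have [s1 s1s hs1] := exists_radius s d0; exists s1 => // t.
  rewrite -ReN -ReD; apply: le_trans (normRe_le _) _.
  set x := s1 +i* t; have := Hd (cexp x); rewrite cmod_cexp => /(_ hs1).
  rewrite add0r mul0r addr0 => H1.
  have -> : g x - f1 0 = (f (cexp x) - f 0 - f1 0 * cexp x) * cexp (- x).
    by rewrite /g cexpN; field; rewrite cexp_neq0.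
  by rewrite cmodM cmod_cexp /= expRN ler_pdivrMr ?expR_gt0.
Qed.

End Strip.

(** * Cauchy's estimate and the regularity of entire functions *)

Section Regularity.
Variable R : realType.
Implicit Types (s t : R) (z w h : R[i]) (f V : R[i] -> R[i]).

Local Notation T := (2 * pi : R).

(** Compactness of an interval: a local uniformity is global. *)
Lemma unif_compact (P : R -> R -> Prop) (a b : R) :
  (forall d d' t, 0 < d' -> d' <= d -> P d t -> P d' t) ->
  (forall t, a <= t <= b -> exists2 d, 0 < d & exists2 e, 0 < e &
     forall u, `|u - t| < e -> P d u) ->
  exists2 d, 0 < d & forall t, a <= t <= b -> P d t.
Proof.
move=> mP HP.
have /compact_near_coveringP/(_ _ (0^'+ : set_system R) P) := @segment_compact R a b.
case.
  move=> t; rewrite /= in_itv /= => /HP[d d0 [e e0 H]].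
  exists (ball t e, [set d' | 0 < d' <= d]) => /=.
    split; first exact: nbhsx_ballx.
    near=> d'; apply/andP; split; near: d'; first exact: nbhs_right_gt.
    exact: nbhs_right_le.
  move=> [u d'] /= [hu /andP[h1 h2]]; apply: mP h1 h2 _; apply: H.
  by move: hu; rewrite /ball /= distrC.
move=> d /= d0 H; exists (d / 2); first by rewrite divr_gt0.
move=> t ht; apply: (H (d / 2)) => /=; rewrite ?divr_gt0//.
by rewrite sub0r normrN gtr0_norm ?divr_gt0// ltr_pdivrMr// mulr_natr mulr2n ltrDl.
Unshelve. all: by end_near.
Qed.

Lemma circle_unif (Q : R -> R[i] -> Prop) :
  (forall d d' z, 0 < d' -> d' <= d -> Q d z -> Q d' z) ->
  (forall z, exists2 d, 0 < d & exists2 e, 0 < e &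
     forall h, cmod h <= e -> Q d (z + h)) ->
  exists2 d, 0 < d & forall t, 0 <= t <= T -> Q d (cexp (0 +i* t)).
Proof.
move=> mQ HQ; apply: (@unif_compact (fun d t => Q d (cexp (0 +i* t)))).
  by move=> d d' t; exact: mQ.
move=> t _; have [d d0 [e e0 H]] := HQ (cexp (0 +i* t)).
exists d => //; have [r r0 Hr] := wder_continuous (wder_cexp (0 +i* t)) e0.
exists r => // u ut; have -> : cexp (0 +i* u) = cexp (0 +i* t) +
    (cexp ((0 +i* t) + (0 +i* (u - t))) - cexp (0 +i* t)).
  rewrite subrKC; congr cexp; apply: eqcP; rewrite !ReImE /= ?addr0//.
  by rewrite subrKC.
apply: H; apply: Hr; apply: le_trans (cmod_le_ReIm _) _.
by rewrite /= normr0 add0r ltW.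
Qed.

Lemma Im_Re z : complex.Im z = complex.Re (- 'i * z).
Proof. by rewrite !ReImE /=; ring. Qed.

Lemma cm_bound f f1 s B : (forall z, complex.Re z <= s -> wder f z (f1 z) 0) ->
  (forall t, 0 <= t <= T -> cmod (f (s +i* t)) <= B) -> `|cm f s| <= B * T.
Proof.
move=> Hf HB; have := @rint_bound R (fun t => complex.Re (f (s +i* t))) 0 B 0 T.
rewrite mul0r !subr0; apply.
- exact/ltW/T_gt0.
- by apply: cok_line => t; eexists; eexists; apply: Hf.
- by move=> t ht; rewrite subr0; apply: le_trans (normRe_le _) (HB t ht).
Qed.

(** Cauchy's estimate; the factor 2 comes from estimating real and imaginary
    parts separately. *)
Lemma cauchy_estimate f f1 s B :
  (forall z, cmod z <= expR s -> wder f z (f1 z) 0) ->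
  (forall t, 0 <= t <= T -> cmod (f (cexp (s +i* t))) <= B) ->
  cmod (f1 0) <= 2 * B * expR (- s).
Proof.
move=> Hf HB.
have key g g1 : (forall z, cmod z <= expR s -> wder g z (g1 z) 0) ->
    (forall t, 0 <= t <= T -> cmod (g (cexp (s +i* t))) <= B) ->
    `|complex.Re (g1 0)| <= B * expR (- s).
  move=> Hg HgB; have := cauchy_deriv Hg => /(congr1 (fun x => `|x|)).
  rewrite normrM (gtr0_norm (T_gt0 R)) => e1.
  rewrite -(ler_pM2r (T_gt0 R)) -e1.
  apply: (@cm_bound _ (fun z => g1 (cexp z) * cexp z * cexp (- z) +
      g (cexp z) * - cexp (- z))).
    move=> z zs; apply: wder_holoM (wder_cexpN z).
    apply: wder_holo_comp (wder_cexp z).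
    by apply: Hg; rewrite cmod_cexp ler_expR.
  move=> t ht; rewrite cmodM cmod_cexp /= ler_wpM2r ?expR_ge0//; exact: HgB.
apply: le_trans (cmod_le_ReIm _) _; rewrite mulr2n !mulrDl !mul1r.
apply: lerD; first exact: (key f).
rewrite Im_Re; apply: (key (fun z => - 'i * f z) (fun z => - 'i * f1 z)).
  by move=> z /Hf Hz; apply: (wder_eq (wderZ (- 'i) Hz)); rewrite ?mulr0.
by move=> t ht; rewrite cmodM cmodN cmodi mul1r; exact: HB.
Qed.

(** Continuity at a point, in terms of the modulus. *)
Definition ccont f z := forall e : R, 0 < e ->
  exists2 d : R, 0 < d & forall h, cmod h <= d -> cmod (f (z + h) - f z) <= e.

Lemma wder_ccont f z a b : wder f z a b -> ccont f z.
Proof. exact: wder_continuous. Qed.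

Lemma ccont_big1 f z : ccont f z -> exists2 K, 0 < K & exists2 d : R, 0 < d &
  forall h, cmod h <= d -> cmod (f (z + h)) <= K.
Proof.
move=> /(_ 1 ltr01)[d d0 H]; exists (cmod (f z) + 1).
  by rewrite ltr_wpDl ?cmod_ge0.
exists d => // h /H H1; rewrite -[f (z + h)](subrK (f z)) addrC.
by apply: le_trans (cmodD _ _) _; rewrite lerD2l.
Qed.

Lemma ccontM f g z : ccont f z -> ccont g z -> ccont (fun x => f x * g x) z.
Proof.
move=> Hf Hg e e0; have [K K0 [d d0 H]] := ccont_big1 Hg.
have A0 : 0 < cmod (f z) + 1 by rewrite ltr_wpDl ?cmod_ge0.
have [d1 d10 H1] := Hf (e / 2 / K) (divr_gt0 (divr_gt0 e0 (ltr0Sn _ 1)) K0).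
have [d2 d20 H2] := Hg (e / 2 / (cmod (f z) + 1)) (divr_gt0 (divr_gt0 e0 (ltr0Sn _ 1)) A0).
exists (Num.min d (Num.min d1 d2)); first by rewrite !lt_min d0 d10.
move=> h; rewrite !le_min => /and3P[h0 h1 h2].
have -> : f (z + h) * g (z + h) - f z * g z = (f (z + h) - f z) * g (z + h) +
   f z * (g (z + h) - g z) by ring.
apply: le_trans (cmodD _ _) _; rewrite !cmodM [e]splitr lerD//.
  apply: le_trans (ler_pM (cmod_ge0 _) (cmod_ge0 _) (H1 _ h1) (H _ h0)) _.
  by rewrite divfK// gt_eqF.
apply: le_trans (ler_wpM2l (cmod_ge0 _) (H2 _ h2)) _.
rewrite mulrCA -[leRHS]mulr1 ler_wpM2l//; first by rewrite divr_ge0// ltW.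
by rewrite ler_pdivrMr// mul1r lerDl.
Qed.

Lemma ccont_comp f g z : ccont f (g z) -> ccont g z -> ccont (fun x => f (g x)) z.
Proof.
move=> Hf Hg e /Hf[d d0 H]; have [d' d'0 H'] := Hg _ d0.
exists d' => // h /H'/H; by rewrite subrKC.
Qed.

Lemma ccont_cst (c : R[i]) z : ccont (fun=> c) z.
Proof. exact: wder_ccont (wder_cst c z). Qed.

Lemma cok_line_ccont f s : (forall t, ccont f (s +i* t)) ->
  cok (fun t => complex.Re (f (s +i* t))) 0 T.
Proof.
move=> H t _; apply/cvgrPdist_le => e /(H t)[d d0 Hd].
near=> u; have -> : s +i* u = (s +i* t) + (0 +i* (u - t)).
  by apply: eqcP; rewrite !ReImE /= ?addr0// subrKC.
rewrite distrC -ReN -ReD; apply: le_trans (normRe_le _) _; apply: Hd.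
apply: le_trans (cmod_le_ReIm _) _; rewrite /= normr0 add0r distrC.
near: u; exact: (@cvgr_dist_le _ _ R _ _ id t).
Unshelve. all: by end_near.
Qed.

Lemma ccontB f g z : ccont f z -> ccont g z -> ccont (fun x => f x - g x) z.
Proof.
move=> Hf Hg e e0; have e20 : 0 < e / 2 by rewrite divr_gt0.
have [d1 d10 H1] := Hf _ e20; have [d2 d20 H2] := Hg _ e20.
exists (Num.min d1 d2); first by rewrite lt_min d10.
move=> h; rewrite le_min => /andP[h1 h2].
have -> : f (z + h) - g (z + h) - (f z - g z) = f (z + h) - f z - (g (z + h) - g z) by ring.
by apply: le_trans (cmodB _ _) _; rewrite [e]splitr lerD ?H1 ?H2.
Qed.

Lemma ccontZ f (c : R[i]) z : ccont f z -> ccont (fun x => c * f x) z.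
Proof. by apply: ccontM; exact: ccont_cst. Qed.

Lemma cmB f g s : (forall t, ccont f (s +i* t)) -> (forall t, ccont g (s +i* t)) ->
  cm (fun z => f z - g z) s = cm f s - cm g s.
Proof.
move=> /cok_line_ccont Hf /cok_line_ccont Hg; rewrite /cm -rintB//.
by apply: rint_ext => t _; rewrite -ReN -ReD.
Qed.

Lemma cmZ f (c : R[i]) s : (forall t, ccont f (s +i* t)) ->
  cm (fun z => c * f z) s =
  complex.Re c * cm f s - complex.Im c * cm (fun z => - 'i * f z) s.
Proof.
move=> Hf; have h1 := cok_line_ccont Hf.
have h2 : cok (fun t => complex.Re (- 'i * f (s +i* t))) 0 T.
  by apply: (@cok_line_ccont (fun z => - 'i * f z)) => t; exact: ccontZ.
rewrite /cm -!rintZ// -rintB; [|exact: cokZ|exact: cokZ].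
by apply: rint_ext => t _; rewrite -Im_Re ReM.
Qed.

(** The factor 2 comes from estimating real and imaginary parts separately. *)
Lemma mean_value_ineq f f1 z h B :
  (forall t, 0 <= t <= 1 -> wder f (z + t%:C * h) (f1 (z + t%:C * h)) 0) ->
  (forall t, 0 <= t <= 1 -> cmod (f1 (z + t%:C * h)) <= B) ->
  cmod (f (z + h) - f z) <= 2 * B * cmod h.
Proof.
move=> Hf HB.
have key g g1 : (forall t, 0 <= t <= 1 -> wder g (z + t%:C * h) (g1 (z + t%:C * h)) 0) ->
    (forall t, 0 <= t <= 1 -> cmod (g1 (z + t%:C * h)) <= B) ->
    `|complex.Re (g (z + h) - g z)| <= B * cmod h.
  move=> Hg HgB; pose G (t : R) := complex.Re (g (z + t%:C * h)).
  have dG t : 0 <= t <= 1 -> is_derive t 1 G (complex.Re (g1 (z + t%:C * h) * h)).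
    move=> /Hg/wder_line H; apply: (is_derive_eq H).
    by rewrite mul0r addr0.
  have [t| |t t01] := @MVT R G (fun t => complex.Re (g1 (z + t%:C * h) * h)) 0 1 ltr01.
  - by rewrite in_itv /= => /andP[t0 t1]; apply: dG; rewrite !ltW.
  - by apply: cok_within => t /dG; exact: is_derive_continuous.
  move: t01; rewrite in_itv /= => /andP[t0 t1].
  rewrite /G subr0 mulr1 rmorph1 rmorph0 mul1r mul0r addr0 -ReN -ReD => ->.
  apply: le_trans (normRe_le _) _; rewrite cmodM ler_wpM2r ?cmod_ge0//.
  by apply: HgB; rewrite !ltW.
apply: le_trans (cmod_le_ReIm _) _; rewrite mulr2n !mulrDl !mul1r.
apply: lerD; first exact: (key f f1 Hf HB).
rewrite Im_Re mulrBr; apply: (key (fun z => - 'i * f z) (fun z => - 'i * f1 z)).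
  by move=> t /Hf Hz; apply: (wder_eq (wderZ (- 'i) Hz)); rewrite ?mulr0.
by move=> t ht; rewrite cmodM cmodN cmodi mul1r; exact: HB.
Qed.

Section EntireFunction.
Variables (f f1 : R[i] -> R[i]).
Hypothesis Hf : forall z, wder f z (f1 z) 0.

(** The derivative is continuous, by Cauchy's estimate for the difference of two
    translates of [f] on the unit circle. *)
Lemma deriv_ccont z : ccont f1 z.
Proof.
move=> e e0; have e20 : 0 < e / 2 by rewrite divr_gt0.
have [|w|d d0 Hd] := @circle_unif (fun d w => forall h, cmod h <= d ->
    cmod (f (z + h + w) - f (z + w)) <= e / 2).
- by move=> d d' w _ dd H h hd; apply: H; exact: le_trans dd.
- have e40 : 0 < e / 2 / 2 by rewrite divr_gt0.
  have [d d0 H] := wder_ccont (Hf (z + w)) e40.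
  have d20 : 0 < d / 2 by rewrite divr_gt0.
  exists (d / 2) => //; exists (d / 2) => // k hk h hh.
  have -> : f (z + h + (w + k)) - f (z + (w + k)) =
     (f (z + w + (h + k)) - f (z + w)) - (f (z + w + k) - f (z + w)).
    have -> : z + h + (w + k) = z + w + (h + k) by ring.
    have -> : z + (w + k) = z + w + k by ring.
    by ring.
  apply: le_trans (cmodB _ _) _; rewrite [e / 2]splitr lerD// H//.
    by apply: le_trans (cmodD _ _) _; rewrite [d]splitr lerD.
  by apply: le_trans hk _; rewrite ler_pdivrMr// mulr_natr mulr2n lerDl ltW.
exists d => // h hh.
have := @cauchy_estimate (fun w => f (z + h + w) - f (z + w))
   (fun w => f1 (z + h + w) - f1 (z + w)) 0 (e / 2).
have -> : 2 * (e / 2) = e by field.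
rewrite !addr0 oppr0 expR0 mulr1; apply.
- move=> w _; apply: (wder_eq (wderB (wder_shift (Hf _)) (wder_shift (Hf _)))) => //.
  by rewrite subr0.
- by move=> t ht; exact: Hd.
Qed.

(** Strict differentiability. *)
Lemma strict_diff z (e : R) : 0 < e -> exists2 d, 0 < d & forall w h,
  cmod w <= d -> cmod h <= d ->
  cmod (f (z + w + h) - f (z + w) - f1 (z + w) * h) <= e * cmod h.
Proof.
move=> e0; have e40 : 0 < e / 4 by rewrite divr_gt0.
have [d d0 H] := deriv_ccont z e40.
exists (d / 2); first by rewrite divr_gt0.
move=> w h hw hh; pose g x := f x - f1 z * x.
have Hg x : wder g x (f1 x - f1 z) 0.
  by apply: (wder_eq (wderB (Hf x) (wderZ (f1 z) (wder_id x)))); rewrite ?mulr1 ?mulr0 ?subr0.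
have H1 t : 0 <= t <= 1 -> cmod (f1 (z + w + t%:C * h) - f1 z) <= e / 4.
  move=> /andP[t0 t1]; rewrite -addrA; apply: H; apply: le_trans (cmodD _ _) _.
  rewrite [d]splitr lerD//; apply: le_trans hh.
  by rewrite cmodM cmodC ger0_norm// ler_piMl ?cmod_ge0.
have := @mean_value_ineq g (fun x => f1 x - f1 z) (z + w) h (e / 4) (fun t _ => Hg _) H1.
have H2 : cmod (f1 (z + w) - f1 z) <= e / 4.
  apply: H; apply: le_trans hw _; rewrite ler_pdivrMr// mulr_natr mulr2n lerDl ltW//.
have -> : f (z + w + h) - f (z + w) - f1 (z + w) * h =
  (g (z + w + h) - g (z + w)) - (f1 (z + w) - f1 z) * h by rewrite /g; ring.
move=> H3; apply: le_trans (cmodB _ _) _; rewrite cmodM.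
have H4 := ler_wpM2r (cmod_ge0 h) H2.
apply: le_trans (lerD H3 H4) _.
by have := mulr_ge0 (ltW e0) (cmod_ge0 h); lra.
Qed.

(** The derivative of an entire function is entire: its derivative at [w] is the
    integral of [f1 (w + x) / x] over the unit circle, by Cauchy's formula for
    the difference quotients and uniform strict differentiability. *)
Theorem deriv_holo : exists f2 : R[i] -> R[i], forall z, wder f1 z (f2 z) 0.
Proof.
pose I w := cm (fun z => f1 (w + cexp z) * cexp (- z)) 0.
pose J w := cm (fun z => - 'i * (f1 (w + cexp z) * cexp (- z))) 0.
exists (fun w => (I w / T) +i* (J w / T)) => w e e0.
have e20 : 0 < e / 2 by rewrite divr_gt0.
have [|z|d d0 Hd] := @circle_unif (fun d z => forall h, cmod h <= d ->
    cmod (f (w + z + h) - f (w + z) - f1 (w + z) * h) <= e / 2 * cmod h).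
- by move=> d d' z _ dd H h hd; apply: H; exact: le_trans dd.
- have [d d0 H] := strict_diff (w + z) e20.
  by exists d => //; exists d => // k hk h hh; rewrite addrA; exact: H.
exists d => // h hh /=; rewrite mul0r addr0.
have T0 := T_gt0 R.
pose A v z := f (v + cexp z) * cexp (- z).
pose C z := f1 (w + cexp z) * cexp (- z).
have cA v z : ccont (A v) z.
  apply: ccontM (wder_ccont (wder_cexpN _)).
  exact: wder_ccont (wder_holo_comp (wder_shift (Hf _)) (wder_cexp _)).
have cC z : ccont C z.
  apply: ccontM (wder_ccont (wder_cexpN _)).
  apply: (@ccont_comp f1 (fun z => w + cexp z)); first exact: deriv_ccont.
  by apply: wder_ccont; apply: wderD (wder_cst w _) (wder_cexp _).
have EA v c : cm (fun z => c * A v z) 0 = complex.Re (c * f1 v) * T.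
  have := @cauchy_deriv R (fun x => c * f (v + x)) (fun x => c * f1 (v + x)) 0.
  rewrite addr0 => <-.
    by apply: cm_ext => t; rewrite mulrA.
  move=> z _; apply: (wder_eq (wderZ c (wder_shift (Hf (v + z))))) => //.
  by rewrite mulr0.
have EC c : cm (fun z => c * C z) 0 = complex.Re (c * ((I w / T) +i* (J w / T))) * T.
  have TN : T != 0 by rewrite gt_eqF.
  by rewrite (cmZ c (fun t => cC _)) ReM /= mulrBl -!mulrA !mulVf// !mulr1.
set D := f1 (w + h) - f1 w - _ * h.
have ED c : cm (fun z => c * (A (w + h) z - A w z - h * C z)) 0 = complex.Re (c * D) * T.
  transitivity (cm (fun z => c * A (w + h) z - c * A w z - (c * h) * C z) 0).
    by apply: cm_ext => t; ring.
  rewrite cmB; last 2 first.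
  - by move=> t; apply: ccontB; apply: ccontZ.
  - by move=> t; apply: ccontZ.
  rewrite cmB; last 2 first.
  - by move=> t; apply: ccontZ.
  - by move=> t; apply: ccontZ.
  rewrite !EA EC -!mulrBl; congr (_ * _); rewrite /D.
  move: (f1 _) (f1 _) (Complex _ _) => u v x; rewrite !ReImE; ring.
have bound c : cmod c = 1 -> `|complex.Re (c * D)| <= e / 2 * cmod h.
  move=> c1; rewrite -(ler_pM2r T0) -[T in leLHS](gtr0_norm T0) -normrM -ED.
  have := @rint_bound R (fun t => complex.Re (c * (A (w + h) (0 +i* t) - A w (0 +i* t)
    - h * C (0 +i* t)))) 0 (e / 2 * cmod h) 0 T.
  rewrite mul0r !subr0; apply; first exact: ltW.
    apply: (@cok_line_ccont (fun z => c * (A (w + h) z - A w z - h * C z))) => t.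
    by apply: ccontZ; apply: ccontB; [apply: ccontB|apply: ccontZ].
  move=> t ht; rewrite subr0; apply: le_trans (normRe_le _) _.
  set x := 0 +i* t; rewrite cmodM c1 mul1r.
  have -> : A (w + h) x - A w x - h * C x =
     (f (w + cexp x + h) - f (w + cexp x) - f1 (w + cexp x) * h) * cexp (- x).
    by rewrite /A /C [w + h + _]addrAC; ring.
  by rewrite cmodM cmod_cexp /= oppr0 expR0 mulr1; exact: Hd.
apply: le_trans (cmod_le_ReIm _) _; rewrite [e]splitr mulrDl lerD//.
  by rewrite -[D]mul1r; apply: bound; exact: cmod1.
by rewrite Im_Re; apply: bound; rewrite cmodN cmodi.
Qed.

End EntireFunction.
End Regularity.

(** * Harmonic functions on discs *)

Section Harmonic.
Variable R : realType.
Implicit Types (s t : R) (z w : R[i]) (f g L : R[i] -> R[i]) (h : R[i] -> R).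

Local Notation T := (2 * pi : R).

(** Complex differentiability at a point. *)
Definition holo f z := exists d, wder f z d 0.

Lemma holoM f g z : holo f z -> holo g z -> holo (fun x => f x * g x) z.
Proof. by move=> [a fa] [b gb]; eexists; exact: wder_holoM fa gb. Qed.

Lemma holo_comp f g z : holo f (g z) -> holo g z -> holo (fun x => f (g x)) z.
Proof. by move=> [a fa] [b gb]; eexists; exact: wder_holo_comp fa gb. Qed.

Lemma holo_cst (c : R[i]) z : holo (fun=> c) z.
Proof. by exists 0; exact: wder_cst. Qed.

Lemma holo_cexp z : holo (@cexp R) z.
Proof. by exists (cexp z); exact: wder_cexp. Qed.

Lemma holo_id z : holo id z. Proof. by exists 1; exact: wder_id. Qed.

Lemma holoX z k : holo (fun x => x ^+ k) z.
Proof.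
elim: k => [|k ih]; first exact: holo_cst.
have := holoM (holo_id z) ih; congr holo.
by apply/funext => x; rewrite exprS.
Qed.

(** At [z], the function [L] is complex differentiable and is twice the
    [z]-derivative of the real function [h].  When this holds on an open set, [h]
    is harmonic there, with gradient [conjc L]. *)
Definition hpt h L z := wder (fun x => (h x)%:C) z (L z / 2) (conjc (L z) / 2) /\
  holo L z.

Lemma conjc2 z : conjc z / 2 = conjc (z / 2).
Proof. by apply: eqcP; rewrite !ReImE /=; ring. Qed.

Lemma hpt_comp h L g z g1 : hpt h L (g z) -> wder g z (g1 z) 0 -> holo g1 z ->
  hpt (fun x => h (g x)) (fun x => L (g x) * g1 x) z.
Proof.
move=> [H1 H2] H3 H4; split.
  apply: (wder_eq (wder_comp H1 H3)); rewrite !conjc2.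
    by rewrite conjc0 mulr0 addr0 mulrAC.
  by rewrite mulr0 add0r -rmorphM mulrAC.
by apply: holoM H4; apply: holo_comp H2 _; exists (g1 z).
Qed.

Lemma holo_choice f (P : R[i] -> Prop) : (forall z, P z -> holo f z) ->
  exists f1, forall z, P z -> wder f z (f1 z) 0.
Proof.
move=> H; exists (fun z => xget 0 [set d | wder f z d 0]) => z /H[d Hd].
exact: (@xgetI _ 0 [set d | wder f z d 0] d Hd).
Qed.

Lemma holo_mean f s : (forall z, cmod z <= expR s -> holo f z) ->
  cm (fun z => f (cexp z)) s = complex.Re (f 0) * T.
Proof. by move=> /holo_choice[f1 Hf]; exact: mean_value Hf. Qed.

Lemma cexpX k z : cexp ((k%:R)%:C * z) = cexp z ^+ k.
Proof.
elim: k => [|k ih]; first by rewrite mulr0n rmorph0 mul0r cexp0.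
by rewrite exprS -ih -cexpD mulrS rmorphD rmorph1 mulrDl mul1r.
Qed.

Lemma cok_cos k : cok (fun t => cos (k%:R * t) : R) 0 T.
Proof.
by move=> t _; apply: (is_derive_continuous (d := sin (k%:R * t) *- k)); apply: is_derive_eq;
  rewrite -[_ *: 1]/(k%:R * 1) mulr1 mulNr mulr_natr.
Qed.

Section Circle.
Variables (h : R[i] -> R) (L : R[i] -> R[i]) (s : R).
Hypothesis Hh : forall z, cmod z <= expR s -> hpt h L z.

Let H (z : R[i]) : R[i] := (h (cexp z))%:C.
Let La (z : R[i]) : R[i] := L (cexp z) * cexp z.

Let inside z : complex.Re z <= s -> cmod (cexp z) <= expR s.
Proof. by rewrite cmod_cexp ler_expR. Qed.

Let wderH z : complex.Re z <= s -> wder H z (La z / 2) (conjc (La z) / 2).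
Proof.
move=> /inside /Hh H1.
by case: (hpt_comp H1 (wder_cexp z) (holo_cexp z)).
Qed.

Let holoLa z : complex.Re z <= s -> holo La z.
Proof.
move=> /inside /Hh H1.
by case: (hpt_comp H1 (wder_cexp z) (holo_cexp z)).
Qed.

Let ccLa z : complex.Re z <= s -> ccont La z.
Proof. by move=> /holoLa[d /wder_ccont]. Qed.

Let ccH z : complex.Re z <= s -> ccont H z.
Proof. by move=> /wderH/wder_ccont. Qed.

Lemma holo_sub f s' : s' <= s -> (forall z, cmod z <= expR s -> holo f z) ->
  forall z, cmod z <= expR s' -> holo f z.
Proof. by move=> ss Hf z zs; apply: Hf; apply: le_trans zs _; rewrite ler_expR. Qed.

(* For [k = 0]: the mean over a circle of the radial derivative of [h] vanishes. *)
Let cmLa s' k : s' <= s -> cm (fun z => La z * cexp z ^+ k) s' = 0.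
Proof.
move=> ss; have := @holo_mean (fun x => L x * x * x ^+ k) s'.
rewrite mulr0 mul0r /= mul0r; apply; apply: (holo_sub ss) => z /Hh[_ HL].
by apply: holoM (holoX _ _); apply: holoM (holo_id _).
Qed.

(** Gauss's mean value theorem for harmonic functions. *)
Lemma harmonic_mean : cm H s = h 0 * T.
Proof.
have h0 : hpt h L 0 by apply: Hh; rewrite cmod0 expR_ge0.
have [La1 HLa1] := holo_choice holoLa.
(* a divergence-free field, with the circle means of [H] *)
pose V z := H z + (s - complex.Re z)%:C * conjc (La z).
have dlin z : wder (fun x => (s - complex.Re x)%:C : R[i]) z (- 1 / 2)%:C (- 1 / 2)%:C.
  by apply: (@wder_Re _ (fun x => s - x)); apply: is_derive_eq; rewrite add0r mul1r.
have cmV s' : s' <= s -> cm V s' = cm H s'.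
  move=> ss; have HRe t : complex.Re (s' +i* t) <= s by [].
  have cJ t : ccont (fun z => conjc (La z)) (s' +i* t).
    by have [d Hd] := holoLa (HRe t); exact: wder_ccont (wderJ Hd).
  have -> : cm V s' = cm (fun z => H z - (s' - s)%:C * conjc (La z)) s'.
    apply: cm_ext => t; rewrite /V /=; congr (_ + _).
    by rewrite -mulNr -rmorphN opprB.
  rewrite cmB; last 2 first.
  - by move=> t; exact: ccH (HRe t).
  - by move=> t; exact: ccontZ.
  rewrite cmZ//= mul0r subr0 cm_conj.
  have := @cmLa s' 0 ss; under [X in cm X]eq_fun do rewrite expr0 mulr1.
  by move=> ->; rewrite mulr0 subr0.
rewrite -cmV//; apply: (@cm_limit _ V (fun z => La z / 2 + (- 1 / 2)%:C * conjc (La z))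
    (fun z => conjc (La z) / 2 + ((- 1 / 2)%:C * conjc (La z)
       + (s - complex.Re z)%:C * conjc (La1 z)))).
- move=> z; rewrite /V /H /La periodic_cexp; congr (_ + _ * _).
  by rewrite !ReImE /=; congr (_%:C); ring.
- move=> z zs; apply: wder_eq (wderD (wderH zs)
    (wderM (dlin z) (wderJ (HLa1 z zs)))) _ _ => //.
  by rewrite conjc0 mulr0 addr0.
- move=> z _; move: (La z) (La1 z) (s - complex.Re z) => [x y] [u v] q.
  by rewrite !ReImE /=; field.
move=> e e0; have [d d0 Hd] := wder_continuous h0.1 (divr_gt0 e0 (T_gt0 R)).
have [s1 s1s hs1] := exists_radius s d0; exists s1 => //.
have T0 := T_gt0 R; rewrite (cmV _ (ltW s1s)).
have := @rint_bound R (fun t => complex.Re (H (s1 +i* t))) (h 0) (e / T) 0 T.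
rewrite !subr0 divfK ?gt_eqF//; apply => [|| t _]; first exact: ltW.
  by apply: cok_line_ccont => t; apply: ccH; exact: ltW.
have := Hd (cexp (s1 +i* t)); rewrite cmod_cexp_line add0r => /(_ hs1).
by rewrite -rmorphB cmodC.
Qed.

(** The Fourier coefficients of a harmonic function on a circle. *)
Lemma harmonic_moment k : (0 < k)%N ->
  2 * k%:R * rint (fun t => h (cexp (s +i* t)) * cos (k%:R * t)) 0 T =
  expR (k%:R * s) * cm (fun z => La z * cexp (- ((k%:R)%:C * z))) s.
Proof.
move=> k0; pose A t := complex.Re (La (s +i* t)); pose B t := complex.Im (La (s +i* t)).
have Rs t : complex.Re (s +i* t) <= s by [].
have cA : cok A 0 T by apply: cok_line_ccont => t; exact: ccLa.
have cB : cok B 0 T.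
  have -> : B = fun t => complex.Re (- 'i * La (s +i* t)).
    by apply/funext => t; rewrite /B Im_Re.
  by apply: (@cok_line_ccont _ (fun z => - 'i * La z)) => t; apply: ccontZ; exact: ccLa.
have ch : cok (fun t => h (cexp (s +i* t))) 0 T.
  by apply: (@cok_line_ccont _ H) => t; exact: ccH.
have dsin t : is_derive t 1 (fun x => sin (k%:R * x) : R) (k%:R * cos (k%:R * t)).
  by apply: is_derive_eq; rewrite -[_ *: 1]/(k%:R * 1) mulr1 mulrC.
have csin : cok (fun t => sin (k%:R * t) : R) 0 T.
  by move=> t _; exact: is_derive_continuous (dsin t).
have ccos := @cok_cos k.
have cBs := cokM cB csin; have cAc := cokM cA ccos.
(* integration by parts *)
have IBP : k%:R * rint (fun t => h (cexp (s +i* t)) * cos (k%:R * t)) 0 T =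
    rint (fun t => B t * sin (k%:R * t)) 0 T.
  have chc := cokM ch ccos.
  apply/eqP; rewrite -subr_eq0 -(rintZ _ chc) -(rintB (cokZ chc) cBs); apply/eqP.
  transitivity (h (cexp (s +i* T)) * sin (k%:R * T) - h (cexp (s +i* 0)) * sin (k%:R * 0)); last first.
    rewrite mulr0 sin0 mulr0 subr0 (_ : sin _ = 0) ?mulr0//.
    rewrite mulrA -[k%:R * 2]natrM.
    elim: (k * 2)%N => [|j ih]; first by rewrite mul0r sin0.
    by rewrite mulrS mulrDl mul1r addrC sinDpi ih oppr0.
  apply: (@rint_FTC _ _ (fun t => h (cexp (s +i* t)) * sin (k%:R * t))).
  - exact: T_gt0.
  - exact: cokB (cokZ chc) cBs.
  - move=> t _; have dh := wder_vert (wderH (Rs t)).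
    apply: (is_derive_eq (is_deriveM dh (dsin t))).
    rewrite -[_ *: _]/(_ * _) -[X in _ + X]/(_ * _) /B /=.
    by move: (La _) (sin _) (cos _) => [x y] S C; rewrite /H /=; field.
have m1 : expR (k%:R * s) * cm (fun z => La z * cexp (- ((k%:R)%:C * z))) s =
    rint (fun t => A t * cos (k%:R * t)) 0 T + rint (fun t => B t * sin (k%:R * t)) 0 T.
  have cc : cok (fun t => complex.Re (La (s +i* t) * cexp (- ((k%:R)%:C * (s +i* t))))) 0 T.
    apply: (@cok_line_ccont _ (fun z => La z * cexp (- ((k%:R)%:C * z)))) => t.
    apply: ccontM; first exact: ccLa.
    apply: wder_ccont; apply: (wder_holo_comp (wder_cexp _)).
    by apply: (wder_eq (wderN (wderZ _ (wder_id _)))); rewrite // mulr0 oppr0.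
  rewrite -rintD// /cm -rintZ//; apply: rint_ext => t _.
  rewrite /A /B; move: (La _) => [x y]; rewrite /cexp !ReImE /= !(mulr0, mul0r, mulr1, subr0, addr0, add0r).
  rewrite expRN cosN sinN; move: (cos _) (sin _) => C S.
  by field; rewrite gt_eqF ?expR_gt0.
have m2 : expR (k%:R * s) * (rint (fun t => A t * cos (k%:R * t)) 0 T -
    rint (fun t => B t * sin (k%:R * t)) 0 T) = 0.
  rewrite -[RHS](@cmLa s k (lexx _)) -(rintB cAc cBs) -(rintZ _ (cokB cAc cBs)).
  apply: rint_ext => t _; rewrite -cexpX.
  rewrite /A /B; move: (La _) => [x y]; rewrite /cexp !ReImE /= !(mulr0, mul0r, mulr1, subr0, addr0, add0r).
  by move: (expR _) (cos _) (sin _) => E C S; ring.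
move/eqP: m2; rewrite mulf_eq0 gt_eqF ?expR_gt0//= subr_eq0 => /eqP m2.
by rewrite m1 m2 -mulrA IBP; ring.
Qed.

(** The gradient of a nonnegative harmonic function at the centre of a disc. *)
Lemma harmonic_gradient : (forall z, cmod z <= expR s -> 0 <= h z) ->
  `|complex.Re (L 0)| * expR s <= 2 * h 0.
Proof.
move=> hpos; have := @harmonic_moment 1 isT; rewrite mul1r mulr1.
have -> : cm (fun z => La z * cexp (- (1%:C * z))) s = complex.Re (L 0) * T.
  rewrite -(@holo_mean L s) => [|z /Hh[]//].
  by apply: cm_ext => t; rewrite /La mul1r cexpN mulfK// cexp_neq0.
move=> e1; have ch : cok (fun t => h (cexp (s +i* t))) 0 T.
  by apply: (@cok_line_ccont _ H) => t; apply: ccH.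
have ccos : cok (fun t => cos (1%:R * t) : R) 0 T.
  exact: cok_cos.
have hcos t : `|h (cexp (s +i* t)) * cos (1%:R * t)| <= h (cexp (s +i* t)).
  have h0 : 0 <= h (cexp (s +i* t)) by apply: hpos; rewrite cmod_cexp_line.
  rewrite normrM ger0_norm// ler_piMr// ler_norml; apply/andP; split.
    exact: cos_geN1.
  exact: cos_le1.
have b1 : `|rint (fun t => h (cexp (s +i* t)) * cos (1%:R * t)) 0 T| <= h 0 * T.
  rewrite -harmonic_mean ler_norml; apply/andP; split.
    rewrite -[leLHS]mulN1r -rintZ//; apply: rint_le.
    - exact: cokZ.
    - exact: cokM.
    - by move=> t _; have := hcos t; rewrite ler_norml mulN1r => /andP[].
  apply: rint_le => //; first exact: cokM.
  by move=> t _; have := hcos t; rewrite ler_norml => /andP[].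
have T0 := T_gt0 R; rewrite -(ler_pM2r T0).
have <- : `|expR s * (complex.Re (L 0) * T)| = `|complex.Re (L 0)| * expR s * T.
  by rewrite normrM [X in _ * X]normrM (gtr0_norm T0) (gtr0_norm (expR_gt0 s)); ring.
by rewrite -e1 normrM (gtr0_norm (ltr0Sn _ 1)) -mulrA ler_pM2l.
Qed.

End Circle.
End Harmonic.

(** * Harnack's inequality and Hopf's lemma *)

Section Harnack.
Variable R : realType.
Implicit Types (s t : R) (z w : R[i]) (f g L : R[i] -> R[i]) (h : R[i] -> R).

Local Notation T := (2 * pi : R).

Section UnitDisc.
Variables (h : R[i] -> R) (L : R[i] -> R[i]).
Hypothesis Hh : forall z, cmod z < 1 -> hpt h L z.
Hypothesis hpos : forall z, cmod z < 1 -> 0 <= h z.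

(** The estimate on the closed discs of radius less than 1 passes to the limit. *)
Lemma gradient_unit_disc : `|complex.Re (L 0)| <= 2 * h 0.
Proof.
apply/ler_addgt0Pr => e e0; set x := `|_|.
have x0 : 0 <= x by exact: normr_ge0.
pose d := Num.min (1 / 2) (e / (x + 1)).
have x1 : 0 < x + 1 by rewrite ltr_wpDl.
have d0 : 0 < d by rewrite lt_min !divr_gt0.
have ed : expR (- d) < 1 by rewrite expR_lt1 oppr_lt0.
have := @harmonic_gradient R h L (- d) (fun z hz => Hh (le_lt_trans hz ed))
  (fun z hz => hpos (le_lt_trans hz ed)).
rewrite -/x => H1.
have H2 : x * (1 - d) <= 2 * h 0.
  by apply: le_trans H1; rewrite ler_wpM2l// expR_ge1Dx.
have H3 : x * d <= e.
  apply: (@le_trans _ _ (x * (e / (x + 1)))); first by rewrite ler_wpM2l// ge_min lexx orbT.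
  rewrite mulrCA ler_piMr ?(ltW e0)// ler_pdivrMr// mul1r; lra.
lra.
Qed.

End UnitDisc.

(** The automorphism of the unit disc that maps 0 to [a]. *)
Definition moebius (a : R) z : R[i] := (z + a%:C) / (1 + a%:C * z).

Section Moebius.
Variable a : R.
Hypotheses (a0 : 0 <= a) (a1 : a < 1).

Lemma moebius_den z : cmod z < 1 -> 1 + a%:C * z != 0.
Proof.
move=> z1; apply/eqP => H; have := cmod1 R.
have -> : 1 = - (a%:C * z) :> R[i] by apply/eqP; rewrite -subr_eq0 opprK H.
rewrite cmodN cmodM cmodC ger0_norm// => H1.
have : a * cmod z < 1 by apply: le_lt_trans z1; rewrite ler_piMl ?cmod_ge0// ltW.
by rewrite H1 ltxx.
Qed.

Lemma moebius_disc z : cmod z < 1 -> cmod (moebius a z) < 1.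
Proof.
move=> z1; rewrite /moebius cmodM cmodV ltr_pdivrMr ?cmod_gt0 ?moebius_den// mul1r.
rewrite -(ltr_pXn2r (n := 2))// ?nnegrE ?cmod_ge0//.
have zz : cmod z ^+ 2 < 1 by rewrite expr_lt1// cmod_ge0.
move: zz; rewrite !cmod_sqr; case: z {z1} => x y /=.
rewrite !(mul0r, mulr0, addr0, add0r, subr0) => H.
have : 0 < (1 - a ^+ 2) * (1 - (x ^+ 2 + y ^+ 2)).
  by apply: mulr_gt0; rewrite subr_gt0// expr_lt1.
by move=> H2; rewrite -subr_gt0; move: H2; congr (0 < _); ring.
Qed.

Let m1 z : R[i] := (1 - a%:C ^+ 2) * (1 + a%:C * z)^-1 ^+ 2.

Lemma wder_moebius z : cmod z < 1 -> wder (moebius a) z (m1 z) 0.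
Proof.
move=> z1; have dn := moebius_den z1.
have Hn : wder (fun x => x + a%:C) z (1 + 0) (0 + 0) := wderD (wder_id z) (wder_cst _ z).
have Hd : wder (fun x => 1 + a%:C * x) z (0 + a%:C * 1) (0 + a%:C * 0).
  exact: wderD (wder_cst _ z) (wderZ _ (wder_id z)).
rewrite -[moebius a]/(fun x : R[i] => (x + a%:C) * (1 + a%:C * x)^-1).
apply: (wder_eq (wderM Hn (@wderV _ (fun x : R[i] => 1 + a%:C * x) z _ _ dn Hd))).
  by rewrite /m1; field.
by rewrite mulr0 !addr0 mul0r !mulr0 addr0.
Qed.

Lemma holo_moebius1 z : cmod z < 1 -> holo m1 z.
Proof.
move=> z1; have dn := moebius_den z1.
apply: holoM; first exact: holo_cst.
apply: (@holo_comp _ (fun x => x ^+ 2) (fun x => (1 + a%:C * x)^-1)).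
  exact: holoX.
have Hd : wder (fun x => 1 + a%:C * x) z (0 + a%:C * 1) (0 + a%:C * 0).
  exact: wderD (wder_cst _ z) (wderZ _ (wder_id z)).
by eexists; apply: (wder_eq (@wderV _ (fun x : R[i] => 1 + a%:C * x) z _ _ dn Hd)) (erefl _) _; rewrite mulr0 addr0 mulr0.
Qed.

End Moebius.

Section Hopf.
Variables (h : R[i] -> R) (L : R[i] -> R[i]).
Hypothesis Hh : forall z, cmod z < 1 -> hpt h L z.
Hypothesis hpos : forall z, cmod z < 1 -> 0 <= h z.

(** The sharp gradient estimate at a point of the radius, obtained by moving
    that point to the centre. *)
Lemma gradient_radius (a : R) : 0 <= a -> a < 1 ->
  `|complex.Re (L a%:C)| * (1 - a ^+ 2) <= 2 * h a%:C.
Proof.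
move=> a0 a1.
have Hm z (z1 : cmod z < 1) := hpt_comp (Hh (moebius_disc a0 a1 z1))
   (wder_moebius a0 a1 z1) (holo_moebius1 a0 a1 z1).
have hm z (z1 : cmod z < 1) : 0 <= h (moebius a z) by apply: hpos; exact: moebius_disc.
have := gradient_unit_disc Hm hm.
rewrite /moebius mulr0 addr0 invr1 mulr1 add0r expr1n mulr1.
have -> : (1 - a%:C ^+ 2 : R[i]) = (1 - a ^+ 2)%:C by rewrite rmorphB rmorph1 rmorphXn.
rewrite ReM /= mulr0 subr0 normrM [`|1 - _|]ger0_norm//.
by rewrite subr_ge0 expr_le1// ltW.
Qed.

(** Harnack's inequality on a radius. *)
Lemma harnack_radius (a : R) : 0 <= a -> a < 1 -> h 0 * (1 - a) <= h a%:C * (1 + a).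
Proof.
rewrite le_eqVlt => /orP[/eqP <- _|a0 a1]; first by rewrite subr0 addr0.
(* this function of t is nondecreasing, by the gradient estimate *)
pose G t := h t%:C * ((1 + t) / (1 - t)).
pose dG t := complex.Re (L t%:C) * ((1 + t) / (1 - t)) + h t%:C * (2 / (1 - t) ^+ 2).
have HG t : 0 <= t <= a -> is_derive t 1 G (dG t).
  move=> /andP[t0 ta]; have t1 : t < 1 by exact: le_lt_trans a1.
  have ht : cmod (t%:C : R[i]) < 1 by rewrite cmodC ger0_norm.
  have dh : is_derive t 1 (fun u : R => h u%:C) (complex.Re (L t%:C)).
    have [Ht _] := Hh ht; have e1 (u : R) : u%:C = 0 + u%:C * 1 :> R[i] by rewrite add0r mulr1.
    move: Ht; rewrite {1}e1 => /wder_line Ht.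
    have -> : (fun u : R => h u%:C) = (fun s : R => complex.Re (h (0 + s%:C * 1))%:C).
      by apply/funext => u; rewrite -e1.
    apply: (is_derive_eq Ht); rewrite conjc1 !mulr1.
    by move: (L _) => [x y]; rewrite !ReImE /=; field.
  have u0 : 1 - t != 0 by rewrite gt_eqF// subr_gt0.
  have dq : is_derive t 1 (fun u : R => (1 + u) / (1 - u)) (2 / (1 - t) ^+ 2).
    have d1 : is_derive t 1 (fun u : R => 1 + u) 1.
      exact: (is_derive_eq (is_deriveD (is_derive_cst (1 : R) t 1) (is_derive_id t 1)) (add0r _)).
    have d2 : is_derive t 1 (fun u : R => 1 - u) (- 1).
      exact: (is_derive_eq (is_deriveB (is_derive_cst (1 : R) t 1) (is_derive_id t 1)) (sub0r _)).
    have d3 := is_deriveV (f := fun u : R => 1 - u) u0 d2.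
    apply: (is_derive_eq (is_deriveM d1 d3)).
    rewrite -[_ *: _ in X in X + _]/(_ * _) -[X in _ + X]/(_ * _) -[_ *: _]/(_ * _).
    by field.
  apply: (is_derive_eq (is_deriveM dh dq)).
  by rewrite -[X in X + _]/(_ * _) -[X in _ + X]/(_ * _) /dG addrC [X in X + _]mulrC.
have [t| |t t01] := @MVT R G dG 0 a a0.
- by rewrite in_itv /= => /andP[t0 t1]; apply: HG; rewrite !ltW.
- by apply: cok_within => t /HG; exact: is_derive_continuous.
move: t01; rewrite in_itv /= => /andP[t0 ta].
have t1 := lt_trans ta a1; have v0 : 0 < 1 - t by rewrite subr_gt0.
rewrite /G !subr0 addr0 divr1 mulr1 rmorph0 => E.
have dG0 : 0 <= dG t.
  have := gradient_radius (ltW t0) t1; set x := complex.Re _ => H1.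
  have H2 : - x <= `|x| by rewrite -normrN ler_norm.
  have t2 : 0 < 1 - t ^+ 2 by rewrite subr_gt0 expr_lt1// ltW.
  have -> : dG t = (x * (1 - t ^+ 2) + 2 * h t%:C) / (1 - t) ^+ 2.
    by rewrite /dG -/x; field; rewrite gt_eqF.
  by rewrite divr_ge0 ?exprn_ge0 ?(ltW v0)//; nra.
have v1 : 0 < 1 - a by rewrite subr_gt0.
have : 0 <= h a%:C * ((1 + a) / (1 - a)) - h 0 by rewrite E mulr_ge0// ltW.
by rewrite subr_ge0 mulrA ler_pdivlMr.
Qed.

(** Hopf's boundary lemma: the gradient at a boundary zero of a positive
    harmonic function bounds its value at the centre. *)
Lemma hopf_unit_disc : hpt h L 1 -> h 1 = 0 -> h 0 <= 2 * cmod (L 1).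
Proof.
move=> [H1 _] h1; apply/ler_addgt0Pr => e e0.
have [d d0 Hd] := H1 _ (divr_gt0 e0 (ltr0Sn _ 1)).
(* Harnack's inequality at [1 - t], where [h] is at most about [t * cmod (L 1)] *)
pose t := Num.min d (1 / 2).
have t0 : 0 < t by rewrite lt_min d0 divr_gt0.
have td : t <= d by rewrite ge_min lexx.
have t1 : t <= 1 / 2 by rewrite ge_min lexx orbT.
have := Hd (- t%:C); rewrite cmodN cmodC gtr0_norm// => /(_ td).
have -> : 1 + - t%:C = (1 - t)%:C :> R[i] by rewrite rmorphB rmorph1.
set X := (X in cmod X) => HX.
have H2 : h (1 - t)%:C <= (cmod (L 1) + e / 2) * t.
  have -> : h (1 - t)%:C = complex.Re X - complex.Re (L 1) * t.
    by rewrite /X h1 rmorph0 subr0; move: (L 1) => [x y]; rewrite !ReImE /=; field.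
  have q1 := le_trans (Re_le_cmod X) HX.
  have q2 : 0 <= (cmod (L 1) + complex.Re (L 1)) * t.
    rewrite mulr_ge0 ?(ltW t0)//; have := normRe_le (L 1); rewrite ler_norml => /andP[+ _]; lra.
  by clear HX; lra.
have := @harnack_radius (1 - t); rewrite gtrBl t0 subr_ge0 => /(_ _ isT).
have t2 : t <= 1 by lra.
rewrite t2 => /(_ isT) H3.
have H4 : h 0 * t <= (2 * cmod (L 1) + e) * t.
  have L0 := cmod_ge0 (L 1); have p0 : 0 <= h (1 - t)%:C.
    by apply: hpos; rewrite cmodC ger0_norm; lra.
  have -> : h 0 * t = h 0 * (1 - (1 - t)) by ring.
  have w0 : 0 <= 1 + (1 - t) by lra.
  have H5 := ler_wpM2r w0 H2.
  have Le : 0 <= cmod (L 1) + e / 2 by lra.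
  by have := mulr_ge0 Le (mulr_ge0 (ltW t0) (ltW t0)); lra.
by rewrite ler_pM2r in H4.
Qed.

End Hopf.

Lemma wder_affine z0 w z : wder (fun x => z0 + w * x) z w 0.
Proof.
apply: (wder_eq (wderD (wder_cst z0 z) (wderZ w (wder_id z)))).
  by rewrite add0r mulr1.
by rewrite add0r mulr0.
Qed.

Lemma hpt_affine h L z0 w z : hpt h L (z0 + w * z) ->
  hpt (fun x => h (z0 + w * x)) (fun x => L (z0 + w * x) * w) z.
Proof.
move=> H; apply: (@hpt_comp _ h L (fun x => z0 + w * x) z (fun=> w)) => //.
  exact: wder_affine.
exact: holo_cst.
Qed.

Lemma hopf_disc h L z0 z1 : z0 != z1 ->
  (forall z, cmod (z - z0) < cmod (z1 - z0) -> hpt h L z /\ 0 <= h z) ->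
  hpt h L z1 -> h z1 = 0 -> h z0 <= 2 * cmod (z1 - z0) * cmod (L z1).
Proof.
move=> z01 H H1 h1; set w := z1 - z0.
have w0 : 0 < cmod w by rewrite cmod_gt0 subr_eq0 eq_sym.
have Hin z : cmod z < 1 -> cmod (z0 + w * z - z0) < cmod w.
  by move=> zz; rewrite addrAC subrr add0r cmodM gtr_pMr.
have e1 : z0 + w * 1 = z1 by rewrite mulr1 subrKC.
have := @hopf_unit_disc (fun x => h (z0 + w * x)) (fun x => L (z0 + w * x) * w).
rewrite e1 mulr0 addr0 cmodM mulrA mulrAC; apply => //.
- by move=> z /Hin/H[hz _]; exact: hpt_affine.
- by move=> z /Hin/H[].
- by apply: hpt_affine; rewrite e1.
Qed.

Lemma gradient_disc h L z0 r : 0 < r ->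
  (forall z, cmod (z - z0) < r -> hpt h L z /\ 0 <= h z) ->
  cmod (L z0) * r <= 4 * h z0.
Proof.
move=> r0 H.
have key u : cmod u = 1 -> `|complex.Re (L z0 * u)| * r <= 2 * h z0.
  move=> u1; have Hin z : cmod z < 1 -> cmod (z0 + (r%:C * u) * z - z0) < r.
    by move=> zz; rewrite addrAC subrr add0r !cmodM cmodC gtr0_norm// u1 mulr1 gtr_pMr.
  have := @gradient_unit_disc (fun x => h (z0 + (r%:C * u) * x))
     (fun x => L (z0 + (r%:C * u) * x) * (r%:C * u)).
  have -> : complex.Re (L (z0 + (r%:C * u) * 0) * (r%:C * u)) = r * complex.Re (L z0 * u).
    by rewrite mulr0 addr0 mulrCA [LHS]ReM /= mul0r subr0.
  rewrite mulr0 addr0 normrM (gtr0_norm r0) [X in X <= _]mulrC; apply.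
  - by move=> z /Hin/H[hz _]; exact: hpt_affine.
  - by move=> z /Hin/H[].
have K1 : `|complex.Re (L z0)| * r <= 2 * h z0.
  by have := key 1 (cmod1 R); rewrite mulr1.
have Ki : `|complex.Im (L z0)| * r <= 2 * h z0.
  by rewrite Im_Re [- 'i * _]mulrC; apply: key; rewrite cmodN cmodi.
have := ler_wpM2r (ltW r0) (cmod_le_ReIm (L z0)); rewrite mulrDl; lra.
Qed.

(** The logarithm of the modulus is harmonic where [g] has no zero. *)
Lemma hpt_ln_cmod g g1 z : wder g z (g1 z) 0 -> holo g1 z -> g z != 0 ->
  hpt (fun x => ln (cmod (g x))) (fun x => g1 x / g x) z.
Proof.
move=> Hg Hg1 g0; have cg : 0 < cmod (g z) by rewrite cmod_gt0.
split; last first.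
  apply: holoM Hg1 _; eexists.
  by apply: (wder_eq (wderV g0 Hg)) (erefl _) _; rewrite mulr0.
have G := wderM Hg (wderJ Hg); rewrite conjc0 in G.
have EG x : complex.Re (g x * conjc (g x)) = cmod (g x) ^+ 2 by rewrite mulcJ.
have P : 0 < complex.Re (g z * conjc (g z)) by rewrite EG exprn_gt0.
have dl : is_derive (complex.Re (g z * conjc (g z))) 1 (fun y : R => ln (Num.sqrt y))
   ((2 * cmod (g z) ^+ 2)^-1).
  have d1 := is_derive1_sqrt P.
  have sp : 0 < Num.sqrt (complex.Re (g z * conjc (g z))) by rewrite sqrtr_gt0.
  have d2 := is_derive1_ln sp.
  apply: (is_derive_eq (is_derive1_comp d2 d1)).
  rewrite EG sqrtr_sqr ger0_norm ?cmod_ge0//; field.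
  by rewrite gt_eqF.
have F := @wder_comp _ (fun w => (ln (Num.sqrt (complex.Re w)))%:C)
  (fun x => g x * conjc (g x)) z _ _ _ _ (wder_Re dl) G.
apply: wder_ext (wder_eq F _ _) => [x| |].
- by rewrite EG sqrtr_sqr ger0_norm// cmod_ge0.
- set c := ((_ / 2)%:C); have -> : c = (2 * (g z * conjc (g z)))^-1 / 2.
    by rewrite mulcJ /c !(rmorphM, fmorphV, rmorph_nat).
  rewrite mulr0 addr0 mul0r add0r rmorphM /= conjcK.
  have cg0 : conjc (g z) != 0 by rewrite conjc_eq0.
  by field; rewrite g0 cg0.
- set c := ((_ / 2)%:C); have -> : c = (2 * (g z * conjc (g z)))^-1 / 2.
    by rewrite mulcJ /c !(rmorphM, fmorphV, rmorph_nat).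
  rewrite mulr0 addr0 mul0r add0r !rmorphM fmorphV /= conjcK.
  have cg0 : conjc (g z) != 0 by rewrite conjc_eq0.
  by field; rewrite g0 cg0.
Qed.

(** The integral of a derivative over a circle vanishes. *)
Lemma cm_deriv G G1 s : periodic G ->
  (forall z, complex.Re z <= s -> wder G z (G1 z) 0) ->
  (forall z, complex.Re z <= s -> ccont G1 z) -> cm G1 s = 0.
Proof.
move=> pG HG cG; have Rs t : complex.Re (s +i* t) <= s by [].
transitivity (complex.Re (- 'i * G (s +i* T)) - complex.Re (- 'i * G (s +i* 0))); last first.
  by rewrite periodicE ?subrr.
apply: (@rint_FTC _ _ (fun t => complex.Re (- 'i * G (s +i* t)))).
- exact: T_gt0.
- by apply: cok_line_ccont => t; exact: cG.
- move=> t _; apply: (is_derive_eq (wder_vert (wderZ (- 'i) (HG _ (Rs t))))).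
  by rewrite mulr0 subr0 !ReImE /=; ring.
Qed.

(** The third Fourier coefficient of a harmonic function on circles around 0 is
    determined by the third derivative at 0. *)
Lemma third_coef h L L1 L2 s : (forall z, hpt h L z) ->
  (forall z, wder L z (L1 z) 0) -> (forall z, wder L1 z (L2 z) 0) ->
  12 * rint (fun t => h (cexp (s +i* t)) * cos (3%:R * t)) 0 T =
  expR (3%:R * s) * (complex.Re (L2 0) * T).
Proof.
move=> Hh HL HL1; have := @harmonic_moment R h L s (fun z _ => Hh z) 3 isT.
have <- := @cauchy_deriv R L1 L2 s (fun z _ => HL1 z).
pose G z := L (cexp z) * cexp (- z) ^+ 2.
pose F z := L1 (cexp z) * cexp (- z).
pose F2 z := L (cexp z) * cexp z * cexp (- ((3%:R)%:C * z)).
have HG z : wder G z (F z - 2%:C * F2 z) 0.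
  have d1 := wder_holo_comp (HL (cexp z)) (wder_cexp z).
  have d2 := wderX 2 (wder_cexpN z).
  apply: (wder_eq (wder_holoM d1 d2)) => //.
  rewrite /F /F2 !cexpN cexpX -[2%:C]/(2%:R%:C) rmorph_nat.
  by field; rewrite cexp_neq0.
have cF z : ccont F z.
  apply: wder_ccont; apply: wder_holoM (wder_cexpN z).
  exact: wder_holo_comp (HL1 _) (wder_cexp z).
have cF2 z : ccont F2 z.
  apply: ccontM; first exact: wder_ccont (wder_holoM (wder_holo_comp (HL _) (wder_cexp z)) (wder_cexp z)).
  apply: wder_ccont; apply: (wder_holo_comp (wder_cexp _)).
  by apply: (wder_eq (wderN (wderZ _ (wder_id _)))); rewrite // mulr0 oppr0.
have pG : periodic G by move=> z; rewrite /G periodic_cexp periodic_cexpN.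
have := @cm_deriv G _ s pG (fun z _ => HG z).
rewrite cmB => [||t]; [|by move=> t; exact: cF|by apply: ccontZ; exact: cF2].
rewrite cmZ //= mul0r subr0 => E E2.
have {}E : cm F s = 2 * cm F2 s.
  by apply/eqP; rewrite -subr_eq0 E// => z _; apply: ccontB (cF z) (ccontZ _ (cF2 z)).
rewrite -/F E [RHS]mulrCA -E2; ring.
Qed.

End Harnack.

(** * The logarithm of the norm of a curve *)

Section LogNorm.
Variables (R : realType) (n : nat).
Implicit Types (s t : R) (z w : R[i]).

Local Notation T := (2 * pi : R).

Lemma sum_sym (f : 'I_n.+1 -> 'I_n.+1 -> R) :
  (forall i j, f i j = f j i) -> (forall i, f i i = 0) ->
  \sum_i \sum_j f i j = 2 * \sum_(i < n.+1) \sum_(j < n.+1 | (i < j)%N) f i j.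
Proof.
move=> fC f0.
have e1 : \sum_i \sum_j f i j = \sum_(i < n.+1) \sum_(j < n.+1 | (i < j)%N) f i j +
    \sum_(i < n.+1) \sum_(j < n.+1 | (j < i)%N) f i j.
  rewrite -big_split /=; apply: eq_bigr => i _.
  rewrite (bigID (fun j : 'I_n.+1 => (i < j)%N)) /=; congr (_ + _).
  rewrite [RHS]big_mkcond [LHS]big_mkcond /=; apply: eq_bigr => j _.
  rewrite -leqNgt leq_eqVlt; case: ltngtP => //= ij.
  by rewrite (val_inj ij) f0.
rewrite e1 mulr2n mulrDl mul1r; congr (_ + _).
rewrite (exchange_big_dep xpredT) //=; apply: eq_bigr => i _.
by apply: eq_bigr => j _.
Qed.

Variables (F F1 F2 : 'I_n.+1 -> R[i] -> R[i]).
Hypothesis HF : forall j z, wder (F j) z (F1 j z) 0.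
Hypothesis HF1 : forall j z, wder (F1 j) z (F2 j z) 0.
Hypothesis HF0 : forall z, exists j, F j z != 0.

(** The square of the norm of the vector of coordinates. *)
Definition norm2 z : R := \sum_j cmod (F j z) ^+ 2.

(** The square of the spherical derivative, for coordinates with derivatives [F1]. *)
Definition sph2 z : R := norm2 z ^- 2 *
  \sum_(i < n.+1) \sum_(j < n.+1 | (i < j)%N)
     cmod (F1 i z * F j z - F i z * F1 j z) ^+ 2.

Lemma norm2_gt0 z : 0 < norm2 z.
Proof.
have [j Fj] := HF0 z; rewrite /norm2 (bigD1 j)//= ltr_pwDl//.
  by rewrite exprn_gt0// cmod_gt0.
by apply: sumr_ge0 => i _; rewrite exprn_ge0// cmod_ge0.
Qed.

Lemma sph2_ge0 z : 0 <= sph2 z.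
Proof.
rewrite mulr_ge0// ?invr_ge0 ?exprn_ge0 ?(ltW (norm2_gt0 z))//.
by apply: sumr_ge0 => i _; apply: sumr_ge0 => j _; rewrite exprn_ge0// cmod_ge0.
Qed.

Lemma norm2E z : (norm2 z)%:C = \sum_j F j z * conjc (F j z).
Proof. by rewrite rmorph_sum; apply: eq_bigr => j _; rewrite mulcJ. Qed.

(** The [z]-derivative of the logarithm of [norm2]. *)
Definition dlog z : R[i] := (\sum_j F1 j z * conjc (F j z)) / (norm2 z)%:C.

Let wderS z : wder (fun x => (norm2 x)%:C) z (\sum_j F1 j z * conjc (F j z))
    (\sum_j F j z * conjc (F1 j z)).
Proof.
have H := @wder_sum R _ (index_enum 'I_n.+1) xpredT (fun j x => F j x * conjc (F j x)) z
  (fun j => F1 j z * conjc (F j z)) (fun j => F j z * conjc (F1 j z)).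
apply: wder_ext (H _) => [x|j _]; first by rewrite norm2E.
by apply: (wder_eq (wderM (HF j z) (wderJ (HF j z)))); rewrite ?conjc0 ?mulr0 ?mul0r ?addr0 ?add0r.
Qed.

Let sumJ z : conjc (\sum_j F1 j z * conjc (F j z)) = \sum_j F j z * conjc (F1 j z).
Proof.
rewrite rmorph_sum; apply: eq_bigr => j _ /=.
by rewrite rmorphM /= conjcK mulrC.
Qed.

Lemma wder_log_norm2 z : wder (fun x => (ln (norm2 x))%:C) z (dlog z) (conjc (dlog z)).
Proof.
have dl : is_derive (complex.Re (norm2 z)%:C) 1 (@ln R) (norm2 z)^-1.
  exact: is_derive1_ln (norm2_gt0 z).
have H := @wder_comp _ (fun w => (ln (complex.Re w))%:C) (fun x => (norm2 x)%:C) z _ _ _ _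
  (wder_Re dl) (wderS z).
rewrite -sumJ conjcK in H; apply: (wder_eq H); rewrite /dlog.
  by rewrite -mulrDl -rmorphD -splitr fmorphV mulrC.
rewrite -mulrDl -rmorphD -splitr fmorphV mulrC rmorphM fmorphV /=.
by rewrite oppr0.
Qed.

(** Lagrange's identity. *)
Lemma lagrange z : (\sum_j F1 j z * conjc (F1 j z)) * (\sum_j F j z * conjc (F j z)) -
  (\sum_j F1 j z * conjc (F j z)) * (\sum_j F j z * conjc (F1 j z)) =
  (\sum_(i < n.+1) \sum_(j < n.+1 | (i < j)%N)
     cmod (F1 i z * F j z - F i z * F1 j z) ^+ 2)%:C.
Proof.
apply: (@mulfI _ 2) => //.
transitivity ((2 * \sum_(i < n.+1) \sum_(j < n.+1 | (i < j)%N)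
     cmod (F1 i z * F j z - F i z * F1 j z) ^+ 2)%:C : R[i]); last by rewrite rmorphM rmorph_nat.
rewrite -(@sum_sym (fun i j => cmod (F1 i z * F j z - F i z * F1 j z) ^+ 2)); last 2 first.
- by move=> i j; rewrite -cmodN; congr (cmod _ ^+ 2); ring.
- by move=> i; rewrite [F i z * _]mulrC subrr cmod0 expr0n.
have dbl (A B X Y : R[i]) : 2 * (A * B - X * Y) = (A * B - X * Y) + (B * A - Y * X) by ring.
rewrite rmorph_sum dbl !big_distrlr /= -!sumrB -big_split /=.
apply: eq_bigr => i _; rewrite rmorph_sum -!sumrB -big_split /=.
apply: eq_bigr => j _; rewrite -mulcJ rmorphB !rmorphM /=.
ring.
Qed.

(** The Laplacian of the logarithm of [norm2] is [4 * sph2]. *)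
Lemma wder_dlog z : exists a, wder dlog z a (sph2 z)%:C.
Proof.
have S0 : (norm2 z)%:C != 0 :> R[i] by rewrite (inj_eq (@complexI R)) gt_eqF ?norm2_gt0.
have H := @wder_sum R _ (index_enum 'I_n.+1) xpredT (fun j x => F1 j x * conjc (F j x)) z
  (fun j => F2 j z * conjc (F j z)) (fun j => F1 j z * conjc (F1 j z)).
have {}H := wderM (H _) (@wderV _ (fun x => (norm2 x)%:C) z _ _ S0 (wderS z)).
eexists; apply: (wder_eq (H _) (erefl _)).
  move=> j _; apply: (wder_eq (wderM (HF1 j z) (wderJ (HF j z)))).
    by rewrite conjc0 mulr0 addr0.
  by rewrite mul0r add0r.
rewrite /sph2 rmorphM fmorphV rmorphXn /= -lagrange norm2E.
rewrite norm2E in S0; move: S0; set A := \sum_(j < _) _.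
set B := \sum_(j < _) _; set C := \sum_(j < _) _; set D := \sum_(j < _) _ => S0.
by field.
Qed.

End LogNorm.

(** * Zero-free functions dominated by a curve *)

Lemma conjcM (R : realType) (x y : R[i]) : conjc (x * y) = conjc x * conjc y.
Proof. by rewrite rmorphM. Qed.

Lemma conjcB (R : realType) (x y : R[i]) : conjc (x - y) = conjc x - conjc y.
Proof. by rewrite rmorphB. Qed.

Lemma flux_rearrange (R : realFieldType) (a b c d s : R) :
  0 <= - (a - d) - - (b + s * c) -> a <= b + c * s + d.
Proof. by lra. Qed.

Section Growth.
Variables (R : realType) (n : nat).
Implicit Types (s t : R) (z w : R[i]).

Local Notation T := (2 * pi : R).

Variables (F F1 F2 : 'I_n.+1 -> R[i] -> R[i]) (M : R).
Hypothesis HF : forall j z, wder (F j) z (F1 j z) 0.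
Hypothesis HF1 : forall j z, wder (F1 j) z (F2 j z) 0.
Hypothesis HF0 : forall z, exists j, F j z != 0.
Hypothesis HM : forall z, sph2 F F1 z <= M ^+ 2.

Section Centre.
Variables w u : R[i].
Hypothesis u1 : cmod u = 1.

Let E_ z := u * cexp z.

Let wderE z : wder E_ z (E_ z) 0.
Proof. by apply: (wder_eq (wderZ u (wder_cexp z))); rewrite ?mulr0. Qed.

Let perE : periodic E_.
Proof. by move=> z; rewrite /E_ cexp2pi. Qed.

Let cmodE s t : cmod (E_ (s +i* t)) = expR s.
Proof. by rewrite /E_ cmodM u1 mul1r cmod_cexp. Qed.

Let N z : R[i] := (ln (norm2 F (w + E_ z)))%:C - (M ^+ 2)%:C * (E_ z * conjc (E_ z)).
Let La z : R[i] := dlog F F1 (w + E_ z) * E_ z - (M ^+ 2)%:C * (E_ z * conjc (E_ z)).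

Let wder_sq z : wder (fun x => (M ^+ 2)%:C * (E_ x * conjc (E_ x))) z
   ((M ^+ 2)%:C * (E_ z * conjc (E_ z))) ((M ^+ 2)%:C * (E_ z * conjc (E_ z))).
Proof.
have He := wderE z; apply: (wder_eq (wderZ _ (wderM He (wderJ He)))).
  by rewrite conjc0 mulr0 addr0.
by rewrite mul0r add0r.
Qed.

Let wder_N z : wder N z (La z) (conjc (La z)).
Proof.
have He : wder (fun x => w + E_ x) z (0 + E_ z) (0 + 0).
  exact: wderD (wder_cst w z) (wderE z).
have H := wder_comp (f := fun x => (ln (norm2 F x))%:C) (wder_log_norm2 HF HF0 _) He.
apply: (wder_eq (wderB H (wder_sq z))); rewrite /La.
  by rewrite !add0r conjc0 mulr0 addr0.
rewrite !add0r !mulr0 add0r conjcB; congr (_ - _); first by rewrite [RHS]conjcM.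
by rewrite [RHS]conjcM conjc_real [X in _ = _ * X]conjcM conjcK [X in _ * X]mulrC.
Qed.

Let wderLa z : exists a, wder La z a ((sph2 F F1 (w + E_ z) - M ^+ 2)%:C * (E_ z * conjc (E_ z))).
Proof.
have He : wder (fun x => w + E_ x) z (0 + E_ z) (0 + 0).
  exact: wderD (wder_cst w z) (wderE z).
have [a Ha] := wder_dlog HF HF1 HF0 (w + E_ z).
have H := wderM (wder_comp (f := dlog F F1) (g := fun x => w + E_ x) Ha He) (wderE z).
eexists; apply: (wder_eq (wderB H (wder_sq z)) (erefl _)).
by rewrite rmorphB !add0r !mulr0 add0r addr0 mulrBl; congr (_ - _); ring.
Qed.

(** The circle means of the logarithm of [norm2] grow at most quadratically in the
    radius [expR s], because its Laplacian is bounded. *)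
Lemma mean_log_norm2_le : exists A B : R, forall s, 0 < s ->
  rint (fun t => ln (norm2 F (w + u * cexp (s +i* t)))) 0 T <= A + B * s + M ^+ 2 * T * expR s ^+ 2.
Proof.
exists (cm N 0), (cm (fun z => 2%:C * conjc (La z)) 0) => s s0.
have [La1 HLa1] : exists La1, forall z, wder La z (La1 z)
    ((sph2 F F1 (w + E_ z) - M ^+ 2)%:C * (E_ z * conjc (E_ z))).
  exists (fun z => xget 0 [set a | wder La z a
    ((sph2 F F1 (w + E_ z) - M ^+ 2)%:C * (E_ z * conjc (E_ z)))]) => z.
  have [a Ha] := wderLa z.
  exact: (@xgetI _ 0 [set a | wder La z a
    ((sph2 F F1 (w + E_ z) - M ^+ 2)%:C * (E_ z * conjc (E_ z)))] a Ha).
(* the divergence of this field is nonpositive, and its circle means are those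
   of [N] on the last circle *)
pose V z := N z + (s - complex.Re z)%:C * (2%:C * conjc (La z)).
have dlin z : wder (fun x => (s - complex.Re x)%:C : R[i]) z (- 1 / 2)%:C (- 1 / 2)%:C.
  by apply: (@wder_Re _ (fun x => s - x)); apply: is_derive_eq; rewrite add0r mul1r.
have HV z := wderD (wder_N z) (wderM (dlin z) (wderZ 2%:C (wderJ (HLa1 z)))).
have pV : periodic V.
  move=> z; rewrite /V /N /La perE; congr (_ + _ * _).
  by rewrite !ReImE /=; congr (_%:C); ring.
have Rs t : complex.Re (0 +i* t) = 0 by [].
have cN s' t : ccont N (s' +i* t) by exact: wder_ccont (wder_N _).
have cJ t : ccont (fun z => 2%:C * conjc (La z)) (0 +i* t).
  exact: wder_ccont (wderZ _ (wderJ (HLa1 _))).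
have V0 : cm V 0 = cm N 0 + s * cm (fun z => 2%:C * conjc (La z)) 0.
  transitivity (cm (fun z => N z - (- s)%:C * (2%:C * conjc (La z))) 0).
    by apply: cm_ext => t; rewrite /V /= subr0 rmorphN mulNr opprK.
  rewrite cmB; [|exact: cN|by move=> t; exact: ccontZ].
  by rewrite cmZ//= mul0r subr0 mulNr opprK.
have Vs : cm V s = cm N s.
  by apply: cm_ext => t; rewrite /V /= subrr mul0r addr0.
have Ns : cm N s = rint (fun t => ln (norm2 F (w + E_ (s +i* t)))) 0 T - M ^+ 2 * T * expR s ^+ 2.
  rewrite /cm; have -> : M ^+ 2 * T * expR s ^+ 2 = rint (fun=> M ^+ 2 * expR s ^+ 2) 0 T.
    by rewrite rint_cst ?(ltW (T_gt0 R))// subr0; ring.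
  rewrite -rintB; last exact: cok_cst.
    by apply: rint_ext => t _; rewrite /N mulcJ cmodE -rmorphM -rmorphB.
  apply: (@cok_line_ccont _ (fun z => (ln (norm2 F (w + E_ z)))%:C)) => t.
  apply: (@ccont_comp _ (fun x => (ln (norm2 F x))%:C) (fun z => w + E_ z)).
    exact: wder_ccont (wder_log_norm2 HF HF0 _).
  exact: wder_ccont (wderD (wder_cst w _) (wderE _)).
have Hdiv z : 0 <= complex.Re z <= s -> complex.Re (La z + ((- 1 / 2)%:C * (2%:C * conjc (La z)) +
   (s - complex.Re z)%:C * (2%:C * conjc ((sph2 F F1 (w + E_ z) - M ^+ 2)%:C *
       (E_ z * conjc (E_ z)))))) <= 0.
  move=> /andP[z0 zs]; rewrite mulcJ -rmorphM conjc_real -!rmorphM ReD.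
  set q := (_ - _) * (2 * _); have -> : complex.Re (La z) + complex.Re
     ((- 1 / 2)%:C * (2%:C * conjc (La z)) + q%:C) = q.
    by move: (La z) => [x y]; rewrite !ReImE /=; field.
  rewrite /q mulr_ge0_le0 ?subr_ge0// mulr_ge0_le0// mulr_le0_ge0//.
    by rewrite subr_le0.
  by rewrite exprn_ge0// cmod_ge0.
have := @gauss_ge0 R (fun z => - V z) (fun z => - (La z + ((- 1 / 2)%:C * (2%:C * conjc (La z)) +
   (s - complex.Re z)%:C * (2%:C * conjc ((sph2 F F1 (w + E_ z) - M ^+ 2)%:C *
       (E_ z * conjc (E_ z)))))))
  (fun z => - (conjc (La z) + ((- 1 / 2)%:C * (2%:C * conjc (La z)) +
   (s - complex.Re z)%:C * (2%:C * conjc (La1 z))))) 0 s 0 T s0 (T_gt0 R) (fun x y _ _ => wderN (HV (x +i* y))).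
rewrite strip_flux; last by move=> z; rewrite pV.
have cV s' : cm (fun z => - V z) s' = - cm V s'.
  rewrite -mulN1r -rintZ; last first.
    apply: (@cok_line_ccont _ V) => t; exact: wder_ccont (HV _).
  by apply: rint_ext => t _; rewrite ReN mulN1r.
rewrite !cV Vs V0 Ns => H.
have : 0 <= - (rint (fun t => ln (norm2 F (w + E_ (s +i* t)))) 0 T - M ^+ 2 * T * expR s ^+ 2) -
   - (cm N 0 + s * cm (fun z => 2%:C * conjc (La z)) 0).
  by apply: H => x y hx _; rewrite ReN oppr_ge0; apply: Hdiv.
exact: flux_rearrange.
Qed.

End Centre.

Section Dominated.
Variables (g g1 L1 L2 : R[i] -> R[i]) (K c0 : R).
Hypothesis Hg : forall z, wder g z (g1 z) 0.
Hypothesis Hg1 : forall z, holo g1 z.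
Hypothesis g0 : forall z, g z != 0.
Hypothesis HL : forall z, wder (fun x => g1 x / g x) z (L1 z) 0.
Hypothesis HL1 : forall z, wder L1 z (L2 z) 0.
Hypothesis gK : forall z, 2 * ln (cmod (g z)) <= ln (norm2 F z) + K.
Hypothesis Fc : forall z, - c0 <= ln (norm2 F z).

(** On the circles [w + u * cexp (s +i* t)], the third Fourier coefficient of the
    harmonic function [h = ln |g|] is, up to a constant factor, [expR (3 * s)] times
    the quantity at issue, by [third_coef]; but [|h|] is at most the logarithm of [norm2] minus [h], up to a
    constant, the mean of which is [O (expR (2 * s))].  Hence it vanishes. *)
Lemma dominated_Re (w u : R[i]) : cmod u = 1 -> complex.Re (L2 w * u ^+ 3) = 0.
Proof.
move=> u1; have [A [B HAB]] := mean_log_norm2_le w u1.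
pose h z := ln (cmod (g (w + u * z))).
pose L z := g1 (w + u * z) / g (w + u * z) * u.
have Hh z : hpt h L z.
  apply: (@hpt_affine _ (fun x => ln (cmod (g x))) (fun x => g1 x / g x)).
  exact: hpt_ln_cmod.
have HuL z : wder L z (L1 (w + u * z) * u * u) 0.
  have H := wder_holo_comp (HL _) (wder_affine w u z).
  apply: (wder_eq (wder_holoM H (wder_cst u z))) => //.
  by rewrite mulr0 addr0.
have HuL1 z : wder (fun x => L1 (w + u * x) * u * u) z (L2 (w + u * z) * u * u * u) 0.
  have H := wder_holo_comp (HL1 _) (wder_affine w u z).
  apply: (wder_eq (wder_holoM (wder_holoM H (wder_cst u z)) (wder_cst u z))) => //.
  by rewrite !mulr0 !addr0.
have third s := third_coef s Hh HuL HuL1.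
pose K' := Num.max K c0.
have ccU s t : ccont (fun z => (ln (norm2 F (w + u * cexp z)))%:C) (s +i* t).
  apply: (@ccont_comp _ (fun x => (ln (norm2 F x))%:C) (fun z => w + u * cexp z)).
    exact: wder_ccont (wder_log_norm2 HF HF0 _).
  exact: wder_ccont (wder_holo_comp (wder_affine w u _) (wder_cexp _)).
have cU s : cok (fun t => ln (norm2 F (w + u * cexp (s +i* t)))) 0 T.
  exact: (@cok_line_ccont _ (fun z => (ln (norm2 F (w + u * cexp z)))%:C)).
have ch s : cok (fun t => h (cexp (s +i* t))) 0 T.
  apply: (@cok_line_ccont _ (fun z => (h (cexp z))%:C)) => t.
  apply: (@ccont_comp _ (fun x => (h x)%:C) (@cexp R)).
    exact: wder_ccont (Hh _).1.
  exact: wder_ccont (wder_cexp _).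
have T0 := T_gt0 R.
have mh s : rint (fun t => h (cexp (s +i* t))) 0 T = h 0 * T.
  exact: (@harmonic_mean _ h L s (fun z _ => Hh z)).
have hb x : `|h x| <= ln (norm2 F (w + u * x)) + K' - h x.
  have k1 : 2 * h x <= ln (norm2 F (w + u * x)) + K'.
    by apply: le_trans (gK _) _; rewrite lerD2l le_max lexx.
  have k2 : 0 <= ln (norm2 F (w + u * x)) + K'.
    have := Fc (w + u * x); have : c0 <= K' by rewrite le_max lexx orbT.
    lra.
  by rewrite ler_norml; apply/andP; split; lra.
pose C := `|A| + `|B| + M ^+ 2 * T + `|K' * T| + `|h 0 * T|.
have bound s : 0 < s -> `|complex.Re (L2 w * u ^+ 3)| * T * expR s <= 12 * C.
  move=> s0; have e1 : 1 <= expR s by rewrite -expR0 ler_expR ltW.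
  have e0 := expR_gt0 s.
  have := third s; rewrite mulr0 addr0 (_ : L2 w * u * u * u = L2 w * u ^+ 3); last by ring.
  move=> E.
  have E3 : expR (3%:R * s) = expR s ^+ 3 by rewrite mulrC expRM_natr.
  rewrite {}E3 in E.
  have b1 : `|rint (fun t => h (cexp (s +i* t)) * cos (3%:R * t)) 0 T| <=
      A + B * s + M ^+ 2 * T * expR s ^+ 2 + K' * T - h 0 * T.
    have ck : cok (fun _ : R => K') 0 T := @cok_cst R K' 0 T.
    have cUk := cokB (cokD (cU s) ck) (ch s).
    have cc := cokM (ch s) (@cok_cos R 3).
    have hcos t : `|h (cexp (s +i* t)) * cos (3%:R * t)| <=
       ln (norm2 F (w + u * cexp (s +i* t))) + K' - h (cexp (s +i* t)).
      apply: le_trans (hb _); rewrite normrM ler_piMr// ler_norml.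
      by rewrite cos_geN1 cos_le1.
    have : `|rint (fun t => h (cexp (s +i* t)) * cos (3%:R * t)) 0 T| <=
      rint (fun t => ln (norm2 F (w + u * cexp (s +i* t))) + K' - h (cexp (s +i* t))) 0 T.
      rewrite ler_norml; apply/andP; split.
        rewrite -[leLHS]mulN1r -rintZ//; apply: rint_le => //; first exact: cokZ.
        by move=> t _; have := hcos t; rewrite ler_norml mulN1r => /andP[].
      apply: rint_le => // t _; have := hcos t; by rewrite ler_norml => /andP[].
    rewrite rintB//; last exact: cokD.
    rewrite rintD// rint_cst ?(ltW T0)// subr0 mh => H.
    by apply: le_trans H _; have := HAB s s0; lra.
  have s2 : s <= expR s ^+ 2.
    have q1 := expR_ge1Dx s; have q2 : expR s <= expR s ^+ 2.
      by rewrite expr2 ler_peMr// ltW.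
    lra.
  have b2 : A + B * s + M ^+ 2 * T * expR s ^+ 2 + K' * T - h 0 * T <= C * expR s ^+ 2.
    have f1 : 1 <= expR s ^+ 2 by rewrite exprn_ege1.
    have g1' : A <= `|A| * expR s ^+ 2.
      by apply: le_trans (ler_norm _) _; rewrite ler_peMr.
    have g2 : B * s <= `|B| * expR s ^+ 2.
      by apply: le_trans (ler_wpM2r (ltW s0) (ler_norm B)) _; rewrite ler_wpM2l.
    have g3 : K' * T <= `|K' * T| * expR s ^+ 2.
      by apply: le_trans (ler_norm _) _; rewrite ler_peMr.
    have g4 : - (h 0 * T) <= `|h 0 * T| * expR s ^+ 2.
      by rewrite -normrN; apply: le_trans (ler_norm _) _; rewrite ler_peMr.
    have eC (a b c d k e : R) : (a + b + c + d + k) * e = a * e + b * e + c * e + d * e + k * e.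
      by ring.
    by rewrite /C eC; apply: lerD g4; apply: lerD g3; rewrite lerD2r; exact: lerD g1' g2.
  have e3 : 0 < expR s ^+ 2 by rewrite exprn_gt0.
  rewrite -(ler_pM2r e3).
  have -> : `|complex.Re (L2 w * u ^+ 3)| * T * expR s * expR s ^+ 2 =
     `|expR s ^+ 3 * (complex.Re (L2 w * u ^+ 3) * T)|.
    have e30 : 0 < expR s ^+ 3 by rewrite exprn_gt0.
    by rewrite normrM (gtr0_norm e30) normrM (gtr0_norm T0); ring.
  rewrite -E normrM ger0_norm// -[leRHS]mulrA ler_pM2l//.
  exact: le_trans b1 b2.
apply/eqP; rewrite -normr_le0 leNgt; apply/negP => r0.
set r := `|_| in r0 bound.
have rT : 0 < r * T by rewrite mulr_gt0.
have C0 : 0 <= C by rewrite /C !addr_ge0// mulr_ge0 ?sqr_ge0 ?(ltW T0).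
have s0 : 0 < 12 * C / (r * T) + 1 by rewrite ltr_wpDl// divr_ge0 ?(ltW rT)// mulr_ge0.
have := bound _ s0; apply/negP; rewrite -ltNge [X in _ < X]mulrC -ltr_pdivrMr//.
by apply: lt_le_trans (expR_ge1Dx _); rewrite addrC -addrA ltrDl.
Qed.

(** A zero-free entire function dominated by the curve has a logarithmic
    derivative that is a polynomial of degree at most one. *)
Lemma dominated_L2 w : L2 w = 0.
Proof.
have := @dominated_Re w 1 (cmod1 R); have := @dominated_Re w 'i (cmodi R).
rewrite expr1n mulr1 !exprS expr0 mulr1.
by case: (L2 w) => x y; rewrite !ReImE /= => h1 h2; apply: eqcP => /=; lra.
Qed.

End Dominated.
End Growth.

(** * Normalized representations, and linear forms in general position *)

Section Representation.
Variable R : realType.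
Implicit Types (z w : R[i]).

Lemma wder_holomorphic (g : R[i] -> R[i]) z d : wder g z d 0 ->
  holomorphic_at g z /\ cderiv g z = d.
Proof.
move=> H; have D : is_derive (z : R[i]^o) 1 (g : R[i]^o -> R[i]^o) d.
  apply: eps_is_derive => e /gt0_real[r r0 ->].
  have [s s0 Hs] := H _ r0; exists s%:C; first by rewrite ltcR.
  move=> h; rewrite normcR ltcR => hs.
  have := Hs h (ltW hs); rewrite mul0r addr0 => H1.
  by rewrite ler_cmod.
split; first by case: D.
by rewrite /cderiv derive1E; case: D.
Qed.

Lemma near_radius (P : R[i] -> Prop) (a : R[i]^o) : (\forall z \near a, P z) ->
  exists2 r : R, 0 < r & forall h, cmod h <= r -> P (a + h).
Proof.
move=> /nbhs_ballP[e /gt0_real[r r0 ->] H]; exists (r / 2); first by rewrite divr_gt0.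
move=> h hr; apply: H; rewrite /ball /= opprD addrA subrr sub0r normrN ltr_cmod.
by apply: le_lt_trans hr _; rewrite ltr_pdivrMr// mulr_natr mulr2n ltrDl.
Qed.

Variable n : nat.
Implicit Types (a b : 'rV[R[i]]_n.+1) (F : 'I_n.+1 -> R[i] -> R[i]).

(** The value of the linear form with coefficients [a]. *)
Definition lform a (v : 'I_n.+1 -> R[i]) : R[i] := \sum_j a 0 j * v j.

Lemma wder_lform (E E1 : 'I_n.+1 -> R[i] -> R[i]) a z :
  (forall j, wder (E j) z (E1 j z) 0) ->
  wder (fun x => lform a (E^~ x)) z (lform a (E1^~ z)) 0.
Proof.
move=> HE; have := @wder_sum R _ (index_enum 'I_n.+1) xpredT (fun j x => a 0 j * E j x) z
  (fun j => a 0 j * E1 j z) (fun=> 0).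
rewrite big1_eq; apply => k _; apply: (wder_eq (wderZ _ (HE k))) => //.
by rewrite mulr0.
Qed.

Lemma omits_lform_neq0 (f : R[i] -> projective_space R n) a z (v : 'rV[R[i]]_n.+1) :
  val (f z) = <[v]>%VS -> omits_hyperplane f a -> lform a (fun j => v 0 j) != 0.
Proof.
move=> E oma; apply/eqP => l0; apply: (oma z) => x; rewrite E => /vlineP[k ->].
transitivity (k * lform a (fun j => v 0 j)); last by rewrite l0 mulr0.
by rewrite /lform mulr_sumr; apply: eq_bigr => j _; rewrite mxE mulrCA.
Qed.

Variable f : R[i] -> projective_space R n.
Hypothesis holf : holomorphic_curve f.

(** A curve that omits a hyperplane has a global representation on which the
    linear form of that hyperplane equals 1. *)
Lemma normalized_representation a : omits_hyperplane f a ->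
  exists2 F, homogeneous_representation f F & forall z, lform a (fun j => F j z) = 1.
Proof.
move=> oma.
have rep z : exists v : 'rV[R[i]]_n.+1, v != 0 /\ val (f z) = <[v]>%VS.
  have [F /near_radius[r r0 /(_ 0)]] := holf z.
  rewrite cmod0 addr0 => /(_ (ltW r0))[_ [F0 E]].
  by exists (\row_j F j z).
have nz z v (E : val (f z) = <[v]>%VS) := omits_lform_neq0 E oma.
pose v z := sval (cid (rep z)).
have vP z : v z != 0 /\ val (f z) = <[v z]>%VS := svalP (cid (rep z)).
pose G j z := v z 0 j / lform a (fun j => v z 0 j).
have GE z (w : 'rV[R[i]]_n.+1) : val (f z) = <[w]>%VS -> forall j, G j z = w 0 j / lform a (fun j => w 0 j).
  move=> E j; have : v z \in <[w]>%VS by rewrite -E (vP z).2 memv_line.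
  move=> /vlineP[k vk]; have := nz z _ (vP z).2; have := nz z _ E; rewrite /G vk.
  have -> : lform a (fun j => (k *: w) 0 j) = k * lform a (fun j => w 0 j).
    by rewrite /lform mulr_sumr; apply: eq_bigr => i _; rewrite mxE mulrCA.
  rewrite mxE => w0; rewrite mulf_eq0 negb_or => /andP[k0 _].
  by field; rewrite k0 w0.
have Gl z : lform a (fun j => G j z) = 1.
  rewrite /G /lform; under eq_bigr do rewrite mulrA.
  by rewrite -mulr_suml divff//; exact: nz (vP z).2.
exists G => //; split; last first.
  move=> z; have l0 := nz z _ (vP z).2.
  have e : \row_j G j z = (lform a (fun j => v z 0 j))^-1 *: v z.
    by apply/rowP => j; rewrite !mxE /G mulrC.
  split.
    by rewrite e scaler_eq0 invr_eq0 negb_or l0 (vP z).1.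
  rewrite (vP z).2 e; apply/eqP; rewrite eqEsubv -!memvE; apply/andP; split; last first.
    by apply/vlineP; exists (lform a (fun j => v z 0 j))^-1.
  by apply/vlineP; exists (lform a (fun j => v z 0 j)); rewrite scalerA divff// scale1r.
move=> j z; have [F /near_radius[r r0 HF]] := holf z.
have HF0 k : wder (F k) z (cderiv (F k) z) 0.
  have := HF 0; rewrite cmod0 addr0 => /(_ (ltW r0))[H _].
  exact: holomorphic_wder (H k).
have lF : lform a (fun j => F j z) != 0.
  have := HF 0; rewrite cmod0 addr0 => /(_ (ltW r0))[_ [_ E]].
  have := nz _ _ E; rewrite /lform; under eq_bigr do rewrite mxE; by [].
have Hl : wder (fun x => lform a (fun j => F j x)) z (\sum_j a 0 j * cderiv (F j) z) 0.
  exact: (wder_lform (E := F) (E1 := fun j => cderiv (F j)) a HF0).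
have HV := wder_eq (wderV lF Hl) (erefl _) (mulr0 _).
have HG := wder_holoM (HF0 j) HV.
have : wder (G j) z (cderiv (F j) z * (lform a (fun j => F j z))^-1 + F j z *
    (- lform a (fun j0 : 'I_n.+1 => F j0 z) ^- 2 * (\sum_j0 a 0 j0 * cderiv (F j0) z))) 0.
  apply: wder_near r0 _ HG => h /HF[_ [_ E]].
  rewrite (GE _ _ E) mxE; congr (_ / _).
  by apply: eq_bigr => k _; rewrite mxE.
by move=> /wder_holomorphic[].
Qed.

End Representation.

Section LinearAlgebra.
Variables (R : realType) (n : nat).
Implicit Types (v : 'I_n.+1 -> R[i]).

Lemma cmod_sum (I : finType) (F : I -> R[i]) :
  cmod (\sum_i F i) <= \sum_i cmod (F i).
Proof.
elim/big_ind2: _ => //; first by rewrite cmod0.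
by move=> x1 x2 y1 y2 h1 h2; apply: le_trans (cmodD _ _) (lerD h1 h2).
Qed.

(** Independent linear forms [H] in [n] of the [n + 1] variables, completed by a
    coordinate, control all coordinates. *)
Lemma row_free_control (H : 'M[R[i]]_(n, n.+1)) : row_free H ->
  exists i0 : 'I_n.+1, exists2 c : R, 0 < c & forall v (B : R),
    cmod (v i0) <= B -> (forall k, cmod (lform (row k H) v) <= B) ->
    forall j, cmod (v j) <= c * B.
Proof.
move=> fH; have rH : \rank H = n by apply/eqP.
have [i0 Hi0] : exists i0, ~~ (row i0 1%:M <= H)%MS.
  apply/row_subPn; rewrite sub1mx /row_full rH; apply/negP => /eqP E.
  by have := ltnSn n; rewrite {1}E ltnn.
pose A : 'M[R[i]]_(1 + n, n.+1) := col_mx (row i0 1%:M) H.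
have uA : (A : 'M[R[i]]_(n.+1)) \in unitmx.
  rewrite -row_full_unit /row_full eqn_leq rank_leq_col /=.
  rewrite ltnNge; apply/negP => rA.
  have HA : (H <= A)%MS by rewrite -addsmxE addsmxSr.
  have HAe : (A <= H)%MS.
    by have := mxrank_leqif_sup HA; rewrite rH => -[rA' <-]; rewrite eqn_leq rA' rA.
  move: Hi0; apply/negP; rewrite negbK.
  apply: submx_trans HAe; by rewrite -addsmxE addsmxSl.
exists i0; exists (1 + \sum_(j < n.+1) \sum_(l < n.+1) cmod (invmx A j l)).
  rewrite ltr_pwDl//; apply: sumr_ge0 => j _; apply: sumr_ge0 => l _; exact: cmod_ge0.
move=> v B B0 BH j; have B_ge0 : 0 <= B := le_trans (cmod_ge0 _) B0.
pose x : 'cV[R[i]]_n.+1 := \col_i v i.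
have Ax l : cmod ((A *m x) l 0) <= B.
  case: (split_ordP (l : 'I_(1 + n))) => k ->.
    rewrite mul_col_mx col_mxEu ord1 -row_mul mul1mx !mxE; exact: B0.
  rewrite mul_col_mx col_mxEd mxE; apply: le_trans (BH k).
  by rewrite /lform le_eqVlt; apply/orP; left; apply/eqP; congr cmod;
    apply: eq_bigr => i _; rewrite !mxE.
have -> : v j = (invmx A *m (A *m x)) j 0 by rewrite mulKmx// mxE.
rewrite mxE; apply: le_trans (cmod_sum _) _.
apply: (@le_trans _ _ (\sum_l cmod (invmx A j l) * B)).
  by apply: ler_sum => l _; rewrite cmodM ler_wpM2l ?cmod_ge0.
rewrite -mulr_suml ler_wpM2r// ler_wpDl// [leRHS](bigD1 j)//= lerDl.
by apply: sumr_ge0 => i _; apply: sumr_ge0 => l _; exact: cmod_ge0.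
Qed.

End LinearAlgebra.

(** * Compactness of rectangles *)

Section Helpers.
Variable R : realType.
Implicit Types (z w : R[i]).

Lemma finite_radius (I : finType) (P : I -> R -> Prop) :
  (forall i r r', 0 < r' -> r' <= r -> P i r -> P i r') ->
  (forall i, exists2 r, 0 < r & P i r) -> exists2 r, 0 < r & forall i, P i r.
Proof.
move=> mP H; have [r Hr] := choice (fun i => (fun h : exists2 r, 0 < r & P i r =>
  let: ex_intro2 r h1 h2 := h in ex_intro (fun r => 0 < r /\ P i r) r (conj h1 h2)) (H i)).
exists (\big[Num.min/1]_i r i).
  by apply: (big_ind (fun x => 0 < x)) => // [x y x0 y0|i _]; rewrite ?lt_min ?x0// (Hr i).1.
move=> i; apply: mP (Hr i).2.
  by apply: (big_ind (fun x => 0 < x)) => // [x y x0 y0|j _]; rewrite ?lt_min ?x0// (Hr j).1.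
exact: bigmin_le_cond.
Qed.

(** A property of rectangles that is inherited from subdivisions and holds locally
    holds globally. *)
Lemma rectangle_compact (P : R -> R -> R -> R -> Prop) a b c d : a < b -> c < d ->
  (forall a b c d m n, P a m c n -> P m b c n -> P a m n d -> P m b n d -> P a b c d) ->
  (forall x y, exists2 r, 0 < r & forall a b c d, a <= x <= b -> c <= y <= d ->
     (b - a) + (d - c) <= r -> P a b c d) -> P a b c d.
Proof.
move=> ab cd HU Hloc; pose Phi a b c d : R := if `[< P a b c d >] then 0 else 1.
have Phi_ge0 a' b' c' d' : 0 <= Phi a' b' c' d' by rewrite /Phi; case: ifP.
have : Phi a b c d <= 0.
  apply: quadrisection => //.
    move=> a' b' c' d' _ _ _ _ _ _; set m := _ / 2; set n := (_ + _) / 2.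
    have [P1|N1] := pselect (P a' m c' n); last first.
      rewrite {2}/Phi asboolF// -!addrA; apply: (@le_trans _ _ 1).
        by rewrite /Phi; case: ifP.
      by rewrite lerDl !addr_ge0.
    have [P2|N2] := pselect (P m b' c' n); last first.
      rewrite {3}/Phi asboolF//; apply: (@le_trans _ _ 1).
        by rewrite /Phi; case: ifP.
      by rewrite -!addrA addrCA lerDl !addr_ge0.
    have [P3|N3] := pselect (P a' m n d'); last first.
      rewrite {4}/Phi asboolF//; apply: (@le_trans _ _ 1).
        by rewrite /Phi; case: ifP.
      by rewrite -addrA addrCA lerDl !addr_ge0.
    have [P4|N4] := pselect (P m b' n d'); last first.
      rewrite {5}/Phi asboolF//; apply: (@le_trans _ _ 1).
        by rewrite /Phi; case: ifP.
      by rewrite lerDr !addr_ge0.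
    rewrite {1}/Phi asboolT ?addr_ge0//; exact: HU P1 P2 P3 P4.
  move=> x y _ _ e e0; have [r r0 Hr] := Hloc x y; exists r => //.
  move=> a' b' c' d' _ h1 _ _ h2 _ hx hy hl; rewrite /Phi asboolT; last exact: Hr.
  by rewrite mulr_ge0 ?sqr_ge0// ltW.
by rewrite /Phi; case: asboolP => //; rewrite ler10.
Qed.

(** A nonempty closed set contains a point nearest to a given one. *)
Lemma nearest_point (E : R[i] -> Prop) z e :
  (forall w, ~ E w -> exists2 r, 0 < r & forall h, cmod h <= r -> ~ E (w + h)) ->
  E e -> exists2 z1, E z1 & forall w, cmod (w - z) < cmod (z1 - z) -> ~ E w.
Proof.
move=> oE Ee; pose S := [set cmod (w - z) | w in [set w | E w]].
have S0 : S !=set0 by exists (cmod (e - z)), e.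
have Sl : has_lbound S by exists 0 => _ [w _ <-]; exact: cmod_ge0.
pose d := inf S; have dle w : E w -> d <= cmod (w - z).
  by move=> Ew; apply: ge_inf => //; exists w.
have [[z1 [E1 h1]]|no] := pselect (exists z1, E z1 /\ cmod (z1 - z) <= d).
  by exists z1 => // w hw Ew; have := dle w Ew; rewrite leNgt (lt_le_trans hw).
(* otherwise the distance to [E] is bounded below by more than its infimum *)
exfalso; pose P a b c d' := exists2 eps, 0 < eps & forall x y, a <= x <= b -> c <= y <= d' ->
   E (x +i* y) -> d + eps <= cmod ((x +i* y) - z).
pose a := complex.Re z - (d + 1); pose b := complex.Re z + (d + 1).
pose c := complex.Im z - (d + 1); pose d' := complex.Im z + (d + 1).
have d0 : 0 <= d by apply: lb_le_inf => // _ [w _ <-]; exact: cmod_ge0.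
have [eps eps0 Heps] : P a b c d'.
  apply: rectangle_compact.
  - by rewrite /a /b; lra.
  - by rewrite /c /d'; lra.
  - move=> a1 b1 c1 d1 m n [e1 e10 H1] [e2 e20 H2] [e3 e30 H3] [e4 e40 H4].
    exists (Num.min (Num.min e1 e2) (Num.min e3 e4)); first by rewrite !lt_min e10 e20 e30.
    move=> x y /andP[x1 x2] /andP[y1 y2] Exy.
    have mm (u : R) : Num.min (Num.min e1 e2) (Num.min e3 e4) <= u ->
       d + u <= cmod ((x +i* y) - z) ->
       d + Num.min (Num.min e1 e2) (Num.min e3 e4) <= cmod ((x +i* y) - z).
      by move=> h; apply: le_trans; rewrite lerD2l.
    have [xm|/ltW xm] := leP x m; have [yn|/ltW yn] := leP y n.
    + by apply: (mm e1); [rewrite !ge_min lexx|apply: H1; rewrite ?x1 ?y1].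
    + by apply: (mm e3); [rewrite !ge_min lexx !orbT|apply: H3; rewrite ?x1 ?yn].
    + by apply: (mm e2); [rewrite !ge_min lexx !orbT|apply: H2; rewrite ?xm ?y1].
    + by apply: (mm e4); [rewrite !ge_min lexx !orbT|apply: H4; rewrite ?xm ?yn].
  - move=> x y; have [Exy|nE] := pselect (E (x +i* y)); last first.
      have [r r0 Hr] := oE _ nE; exists r => // a1 b1 c1 d1 hx hy hl.
      exists 1 => // x' y' hx' hy' E'; exfalso.
      have := Hr ((x' - x) +i* (y' - y)); have -> : (x +i* y) + ((x' - x) +i* (y' - y)) = x' +i* y'.
        by apply: eqcP; rewrite !ReImE /= subrKC.
      apply=> //; apply: le_trans (cmod_le_ReIm _) _ => /=; apply: le_trans hl.
      by apply: lerD; rewrite ler_norml; move: hx hy hx' hy' => /andP[? ?] /andP[? ?] /andP[? ?] /andP[? ?]; apply/andP; split; lra.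
    have hd : d < cmod ((x +i* y) - z).
      by rewrite ltNge; apply/negP => hd; apply: no; exists (x +i* y).
    pose r := (cmod ((x +i* y) - z) - d) / 2.
    have r0 : 0 < r by rewrite divr_gt0// subr_gt0.
    exists r => // a1 b1 c1 d1 hx hy hl; exists r => // x' y' hx' hy' _.
    have h1 : cmod ((x +i* y) - (x' +i* y')) <= r.
      apply: le_trans (cmod_le_ReIm _) _ => /=; apply: le_trans hl.
      by apply: lerD; rewrite ler_norml; move: hx hy hx' hy' => /andP[? ?] /andP[? ?] /andP[? ?] /andP[? ?]; apply/andP; split; lra.
    have := cmodD ((x +i* y) - (x' +i* y')) ((x' +i* y') - z); rewrite addrA subrK => h2.
    have := le_trans h2 (lerD h1 (lexx _)); rewrite /r; lra.
pose ep := Num.min eps 1.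
have ep0 : 0 < ep by rewrite lt_min eps0 ltr01.
have [_ [[x y] Ew <-] hw] := inf_adherent ep0 (conj S0 Sl).
have hw1 : cmod ((x +i* y) - z) < d + 1 by apply: lt_le_trans hw _; rewrite lerD2l ge_min lexx orbT.
have hw2 : cmod ((x +i* y) - z) < d + eps by apply: lt_le_trans hw _; rewrite lerD2l ge_min lexx.
have := normRe_le ((x +i* y) - z); have := normIm_le ((x +i* y) - z).
rewrite !ReImE /= => hy hx; have := le_lt_trans hx hw1; have := le_lt_trans hy hw1.
rewrite !ltr_norml => /andP[y1 y2] /andP[x1 x2].
have : d + eps <= cmod ((x +i* y) - z).
  by apply: Heps => //; rewrite /a /b /c /d'; apply/andP; split; lra.
by rewrite leNgt hw2.
Qed.

Lemma deriv0_cst (f : R[i] -> R[i]) : (forall z, wder f z 0 0) -> forall z, f z = f 0.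
Proof.
move=> H z; have := @mean_value_ineq R f (fun=> 0) 0 z 0 (fun t _ => H _).
rewrite mulr0 mul0r add0r cmod0 => /(_ (fun _ _ => lexx _)) H1.
by apply/eqP; rewrite -subr_eq0 -cmod_eq0 eq_le H1 cmod_ge0.
Qed.

(** A harmonic function whose gradient is affine is a real quadratic polynomial. *)
Lemma hpt_affine_value (h : R[i] -> R) (L : R[i] -> R[i]) (a b : R[i]) :
  (forall z, hpt h L z) -> (forall z, L z = a * z + b) ->
  forall z, h z = h 0 + complex.Re (a * z ^+ 2 / 2 + b * z).
Proof.
move=> Hh HL z.
pose phi (t : R) := complex.Re ((h (0 + t%:C * z))%:C - (a * (0 + t%:C * z) ^+ 2 / 2 + b * (0 + t%:C * z))).
have dphi (t : R) : is_derive t 1 phi (0 : R).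
  set x := 0 + t%:C * z.
  have H1 := (Hh x).1.
  have H2 : wder (fun x => a * x ^+ 2 / 2 + b * x) x (a * x + b) 0.
    have q := wderZ (a / 2) (wderX 2 (wder_id x)).
    apply: wder_ext (wder_eq (wderD q (wderZ b (wder_id x))) _ _) => [y| |].
    - by field.
    - by rewrite /= expr1; field.
    - by rewrite !mulr0 addr0.
  have H := wder_line (f := fun x => (h x)%:C - (a * x ^+ 2 / 2 + b * x)) (wderB H1 H2).
  apply: (is_derive_eq H); rewrite HL.
  by clear; move: (a * x + b) => y; rewrite !ReImE /=; field.
have [|t _] := @MVT R phi (fun=> 0) 0 1 ltr01 (fun t _ => dphi t).
  by apply: cok_within => t _; exact: is_derive_continuous (dphi t).
rewrite mul0r /phi => /eqP; rewrite subr_eq0 => /eqP.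
rewrite rmorph1 rmorph0 !add0r mul1r mul0r expr0n !mulr0 !mul0r addr0 subr0 ReD ReN /=.
by move=> H; rewrite -[h 0]/(complex.Re (h 0)%:C) -H /= subrK.
Qed.

End Helpers.

(** * Dominance among the components *)

Section Ties.
Variable R : realType.
Implicit Types (z w e : R[i]).

Lemma hptB (h h' : R[i] -> R) (L L' : R[i] -> R[i]) z : hpt h L z -> hpt h' L' z ->
  hpt (fun x => h x - h' x) (fun x => L x - L' x) z.
Proof.
move=> [H1 [d1 D1]] [H2 [d2 D2]]; split.
  apply: wder_ext (wder_eq (wderB H1 H2) _ _) => [x| |].
  - by rewrite rmorphB.
  - by rewrite mulrBl.
  - by rewrite rmorphB mulrBl.
by exists (d1 - d2); apply: (wder_eq (wderB D1 D2)); rewrite ?subr0.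
Qed.

Variables (m : nat) (G G1 : 'I_m -> R[i] -> R[i]) (k0 : 'I_m) (g g1 : R[i] -> R[i]) (K : R).
Hypothesis HG : forall k z, wder (G k) z (G1 k z) 0.
Hypothesis HG1 : forall k z, holo (G1 k) z.
Hypothesis G0 : forall k z, G k z != 0.
Hypothesis Gk0 : forall z, G k0 z = 1.
Hypothesis Hg : forall z, wder g z (g1 z) 0.
Hypothesis Hg1 : forall z, holo g1 z.
Hypothesis K0 : 0 < K.
Hypothesis BW : forall z B k, cmod (g z) <= B -> (forall l, cmod (G l z) <= B) ->
  cmod (g1 z * G k z - g z * G1 k z) <= K * B ^+ 2.
Hypothesis BG : forall z B j k, cmod (g z) <= B -> (forall l, cmod (G l z) <= B) ->
  cmod (G1 j z * G k z - G j z * G1 k z) <= K * B ^+ 2.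

(** The logarithmic derivative of a component. *)
Definition ldG k z := G1 k z / G k z.
(** The logarithm of its modulus. *)
Definition logG k z : R := ln (cmod (G k z)).

(** The component [k] has the largest modulus among the zero-free ones at [z]. *)
Definition top k z := forall l, cmod (G l z) <= cmod (G k z).

(** The set where the remaining function [g] does not strictly dominate all the
    zero-free components. *)
Definition low z := exists k, cmod (g z) <= cmod (G k z).

Lemma cG_gt0 k z : 0 < cmod (G k z). Proof. by rewrite cmod_gt0. Qed.

Lemma top_log k z : top k z -> forall l, logG l z <= logG k z.
Proof. by move=> H l; rewrite ler_ln ?posrE ?cG_gt0. Qed.

Lemma log_top k z : (forall l, logG l z <= logG k z) -> top k z.
Proof. by move=> H l; rewrite -ler_ln ?posrE ?cG_gt0//; exact: H. Qed.

Lemma logG0 z : logG k0 z = 0.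
Proof. by rewrite /logG Gk0 cmod1 ln1. Qed.

Lemma hpt_logG k z : hpt (logG k) (ldG k) z.
Proof. exact: hpt_ln_cmod. Qed.

Lemma topP z : exists k, top k z.
Proof.
have [k _ H] : exists2 k, true & forall l, cmod (G l z) <= cmod (G k z).
  case: (@Order.TotalTheory.arg_maxP _ _ _ k0 xpredT (fun k => cmod (G k z)) isT) => k _ H.
  by exists k => // l; exact: H.
by exists k.
Qed.

Lemma nlowP z : ~ low z -> forall k, cmod (G k z) < cmod (g z).
Proof.
by move=> H k; rewrite ltNge; apply/negP => h; apply: H; exists k.
Qed.

Lemma nlow_g z : ~ low z -> g z != 0.
Proof.
by move=> /nlowP/(_ k0); rewrite -cmod_gt0; apply: lt_trans; exact: cG_gt0.
Qed.

Lemma nlow_open w : ~ low w -> exists2 r, 0 < r & forall h, cmod h <= r -> ~ low (w + h).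
Proof.
move=> /nlowP nl.
have [|k|r r0 Hr] := @finite_radius R 'I_m (fun k r => forall h, cmod h <= r ->
   cmod (G k (w + h)) < cmod (g (w + h))).
- by move=> k r r' _ rr H h hr; apply: H; exact: le_trans rr.
- pose d := (cmod (g w) - cmod (G k w)) / 3.
  have d0 : 0 < d by rewrite divr_gt0// subr_gt0.
  have [r1 r10 H1] := wder_continuous (HG k w) d0.
  have [r2 r20 H2] := wder_continuous (Hg w) d0.
  exists (Num.min r1 r2); first by rewrite lt_min r10.
  move=> h; rewrite le_min => /andP[/H1 h1 /H2 h2].
  have := cmodD (G k (w + h) - G k w) (G k w); rewrite subrK => h3.
  have := cmodD (g w - g (w + h)) (g (w + h)); rewrite subrK cmod_distC => h4.
  have dE : 3 * d = cmod (g w) - cmod (G k w) by rewrite /d; field.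
  by move: d0 dE h1 h2 h3 h4; lra.
by exists r => // h hr [k]; rewrite leNgt (Hr k h hr).
Qed.

(** The logarithm of the ratio of [g] to a zero-free component. *)
Lemma hpt_ratio k z : g z != 0 ->
  hpt (fun x => ln (cmod (g x)) - logG k x) (fun x => g1 x / g x - ldG k x) z.
Proof. by move=> g0; apply: hptB; [exact: hpt_ln_cmod|exact: hpt_logG]. Qed.

Lemma ratio_ge0 k z : ~ low z -> 0 <= ln (cmod (g z)) - logG k z.
Proof.
move=> nl; rewrite subr_ge0 ler_ln ?posrE ?cG_gt0 ?cmod_gt0 ?nlow_g//.
exact/ltW/nlowP.
Qed.

Lemma quot_bound (a b c d : R[i]) (B : R) : 0 < B -> cmod b = B -> cmod d = B ->
  cmod (a * d - b * c) <= K * B ^+ 2 -> cmod (a / b - c / d) <= K.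
Proof.
move=> B0 bB dB; have b0 : b != 0 by rewrite -cmod_gt0 bB.
have d0 : d != 0 by rewrite -cmod_gt0 dB.
have -> : a / b - c / d = (a * d - b * c) / (b * d) by field; rewrite b0 d0.
by rewrite cmodM cmodV cmodM bB dB -expr2 ler_pdivrMr// exprn_gt0.
Qed.

(** At the first point of [low] met by a growing disc around [z], the ratio of [g]
    to a dominant component has modulus 1 and a bounded logarithmic gradient;
    Hopf's lemma then bounds its logarithm at [z]. *)
Lemma outside_low z e : ~ low z -> low e -> exists r l, [/\ 0 < r, r <= cmod (e - z),
  (forall w, cmod (w - z) < r -> ~ low w) &
  ln (cmod (g z)) - logG l z <= 2 * r * K].
Proof.
move=> nz le; have [z1 [k Ek] Hz1] := nearest_point z nlow_open le.
have zz : z != z1 by apply/eqP => E; apply: nz; exists k; rewrite E.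
have r0 : 0 < cmod (z1 - z) by rewrite cmod_gt0 subr_eq0 eq_sym.
have [l tl] := topP z1; exists (cmod (z1 - z)), l; split => //.
  by rewrite leNgt; apply/negP => /Hz1.
have gl : cmod (g z1) <= cmod (G l z1) := le_trans Ek (tl k).
(* by continuity along the segment from [z], on which [g] dominates *)
have lg : cmod (G l z1) <= cmod (g z1).
  apply/ler_addgt0Pr => eps eps0; have e20 : 0 < eps / 2 by rewrite divr_gt0.
  have [r1 r10 H1] := wder_continuous (HG l z1) e20.
  have [r2 r20 H2] := wder_continuous (Hg z1) e20.
  pose t := Num.min (1 / 2) (Num.min r1 r2 / cmod (z1 - z)).
  have t0 : 0 < t by rewrite lt_min divr_gt0//= divr_gt0// lt_min r10.
  have t1 : t <= 1 / 2 by rewrite ge_min lexx.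
  pose h := - (t%:C * (z1 - z)).
  have ch : cmod h = t * cmod (z1 - z) by rewrite cmodN cmodM cmodC gtr0_norm.
  have hr : cmod h <= Num.min r1 r2.
    by rewrite ch -ler_pdivlMr// ge_min lexx orbT.
  move: hr; rewrite le_min => /andP[/H1 h1 /H2 h2].
  have nl : ~ low (z1 + h).
    apply: Hz1; have -> : z1 + h - z = (1 - t)%:C * (z1 - z).
      by rewrite /h rmorphB rmorph1; ring.
    rewrite cmodM cmodC ger0_norm; last by lra.
    by rewrite gtr_pMl//; lra.
  have h5 := nlowP nl l.
  have := cmodD (g (z1 + h) - g z1) (g z1); rewrite subrK => h3.
  have := cmodD (G l z1 - G l (z1 + h)) (G l (z1 + h)); rewrite subrK cmod_distC => h4.
  by move: h1 h2 h3 h4 h5; lra.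
have ge : cmod (g z1) = cmod (G l z1) by apply: le_anti; rewrite gl.
have g0 : g z1 != 0 by rewrite -cmod_gt0 ge cG_gt0.
have Kb : cmod (g1 z1 / g z1 - ldG l z1) <= K.
  apply: (quot_bound (cG_gt0 l z1)) => //; apply: BW => //.
have := @hopf_disc R (fun x => ln (cmod (g x)) - logG l x) (fun x => g1 x / g x - ldG l x) z z1 zz.
move=> H; apply: (@le_trans _ _ (2 * cmod (z1 - z) * cmod (g1 z1 / g z1 - ldG l z1))).
  apply: H; last by rewrite /logG ge subrr.
    move=> w /Hz1 nw; split; last exact: ratio_ge0.
    exact: hpt_ratio (nlow_g nw).
  exact: hpt_ratio.
by rewrite ler_wpM2l// mulr_ge0// ltW.
Qed.

(** Where two zero-free components tie for dominance, their logarithmic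
    derivatives differ by a bounded amount: on [low] by the bound on Wronskians,
    and off [low] by comparing each with that of [g] through the gradient estimate
    on the disc of [outside_low]. *)
Lemma tie_bound z j k : top j z -> top k z -> cmod (ldG j z - ldG k z) <= 16 * K.
Proof.
move=> tj tk; have K16 : K <= 16 * K by have := K0; lra.
have [lz|nz] := pselect (low z).
  apply: le_trans K16; have jk : cmod (G j z) = cmod (G k z).
    by apply: le_anti; rewrite tj tk.
  have gk : cmod (g z) <= cmod (G k z) by have [l /le_trans] := lz; apply.
  by apply: (quot_bound (cG_gt0 k z)) => //; apply: BG.
suff H i : top i z -> cmod (g1 z / g z - ldG i z) <= 8 * K.
  have -> : ldG j z - ldG k z = (g1 z / g z - ldG k z) - (g1 z / g z - ldG j z) by ring.
  by apply: le_trans (cmodB _ _) _; have := H _ tj; have := H _ tk; lra.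
move=> ti; have gi r : 0 < r -> (forall w, cmod (w - z) < r -> ~ low w) ->
    cmod (g1 z / g z - ldG i z) * r <= 4 * (ln (cmod (g z)) - logG i z).
  move=> r0 Hr; apply: (@gradient_disc R (fun x => ln (cmod (g x)) - logG i x)
    (fun x => g1 x / g x - ldG i x)) => // w /Hr nw; split; last exact: ratio_ge0.
  exact: hpt_ratio (nlow_g nw).
have [[e le]|no] := pselect (exists e, low e).
  have [r [l [r0 _ Hr hl]]] := outside_low nz le.
  rewrite -(ler_pM2r r0); apply: le_trans (gi r r0 Hr) _.
  by have := top_log ti l; move: hl; lra.
(* if [low] is empty, the gradient estimate holds on arbitrarily large discs *)
have no' w : ~ low w by move=> lw; apply: no; exists w.
rewrite leNgt; apply/negP => H8; have := ratio_ge0 i nz.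
set q := (_ - _) => q0.
have c0 : 0 < cmod (g1 z / g z - ldG i z) by apply: lt_trans H8; rewrite mulr_gt0.
have r0 : 0 < (4 * q + 1) / cmod (g1 z / g z - ldG i z) by rewrite divr_gt0// ltr_wpDl// mulr_ge0.
have := gi _ r0 (fun w _ => no' w).
by rewrite [X in X <= _]mulrC divfK ?gt_eqF// -/q; lra.
Qed.

(** If [g] dominates everywhere, its ratios to the zero-free components are
    constant, by Liouville's theorem for positive harmonic functions. *)
Lemma no_low_ld : (forall z, ~ low z) -> forall k z, g1 z / g z = ldG k z.
Proof.
move=> no k z; apply/eqP; rewrite -subr_eq0 -cmod_eq0 eq_le cmod_ge0 andbT leNgt.
apply/negP => c0; have := ratio_ge0 k (no z); set q := (_ - _) => q0.
have r0 : 0 < (4 * q + 1) / cmod (g1 z / g z - ldG k z) by rewrite divr_gt0// ltr_wpDl// mulr_ge0.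
have := @gradient_disc R (fun x => ln (cmod (g x)) - logG k x)
    (fun x => g1 x / g x - ldG k x) z _ r0.
have -> : cmod (g1 z / g z - ldG k z) * ((4 * q + 1) / cmod (g1 z / g z - ldG k z)) = 4 * q + 1.
  by rewrite mulrC divfK ?gt_eqF.
rewrite -/q => H.
suff : 4 * q + 1 <= 4 * q by lra.
apply: H => w _; split; last exact: ratio_ge0.
exact: hpt_ratio (nlow_g (no w)).
Qed.

End Ties.

(** * Quadratic harmonic functions that tie *)

Section NoQuadratic.
Variable R : realType.
Implicit Types (z w : R[i]).

Lemma finite_large (I : finType) (P : I -> R -> Prop) :
  (forall i r r', r <= r' -> P i r -> P i r') ->
  (forall i, exists r, P i r) -> exists r, forall i, P i r.
Proof.
move=> mP /choice[r Hr]; exists (\big[Num.max/0]_i r i) => i.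
by apply: mP (Hr i); exact: le_bigmax_cond.
Qed.

Lemma quadratic_large (c0 c1 c2 : R) : 0 < c2 ->
  exists r, forall t, r <= t -> 0 < c0 + c1 * t + c2 * t ^+ 2.
Proof.
move=> c20; exists (1 + (`|c0| + `|c1|) / c2) => t ht.
have n0 : 0 <= `|c0| by []; have n1 : 0 <= `|c1| by [].
have t1 : 1 <= t by apply: le_trans ht; rewrite lerDl divr_ge0 ?addr_ge0// ltW.
have h1 : c2 + `|c0| + `|c1| <= c2 * t.
  have := ler_wpM2l (ltW c20) ht; rewrite mulrDr mulr1 mulrCA divff ?gt_eqF// mulr1.
  by rewrite addrA.
have t0 : 0 <= t by lra.
have h2 := ler_wpM2r t0 h1.
have h3 : - `|c0| <= c0 by rewrite lerNnormlW.
have h4 : - `|c1| * t <= c1 * t by rewrite ler_wpM2r// lerNnormlW.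
have h5 : `|c0| <= `|c0| * t by rewrite ler_peMr.
have h6 : 0 < c2 * t by rewrite mulr_gt0//; lra.
by move: h2; rewrite !mulrDl -mulrA -expr2 => h2; lra.
Qed.

Lemma linear_large (a b : R[i]) (c : R) : a != 0 ->
  exists r, forall z, r <= cmod z -> c < cmod (a * z + b).
Proof.
rewrite -cmod_gt0 => a0; exists ((`|c| + cmod b + 1) / cmod a) => z.
rewrite ler_pdivrMr// mulrC => hz.
have := cmodB (a * z + b) b; rewrite addrK cmodM => h.
by have := ler_norm c; lra.
Qed.

Lemma cok_max (f g : R -> R) a b : cok f a b -> cok g a b ->
  cok (fun t => Num.max (f t) (g t)) a b.
Proof. by move=> Hf Hg t ht; apply: continuous_max; [exact: Hf|exact: Hg]. Qed.

Lemma cok_bigmax (I : Type) (s : seq I) (P : pred I) (x0 : R -> R) (F : I -> R -> R) a b :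
  cok x0 a b -> (forall i, cok (F i) a b) ->
  cok (fun t => \big[Num.max/x0 t]_(i <- s | P i) F i t) a b.
Proof.
move=> H0 HF; elim: s => [|i s ih].
  by have -> : (fun t => \big[Num.max/x0 t]_(i <- [::] | P i) F i t) = x0
    by apply/funext => t; rewrite big_nil.
have -> : (fun t => \big[Num.max/x0 t]_(i <- i :: s | P i) F i t) =
   (fun t => if P i then Num.max (F i t) (\big[Num.max/x0 t]_(i <- s | P i) F i t)
     else \big[Num.max/x0 t]_(i <- s | P i) F i t).
  by apply/funext => t; rewrite big_cons.
by case: (P i) => //; exact: cok_max.
Qed.

Lemma bigmax_attained (I : finType) (P : pred I) (i0 : I) (F : I -> R) : P i0 ->
  exists2 i, P i & \big[Num.max/F i0]_(i | P i) F i = F i.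
Proof.
move=> Pi0; elim/big_ind: _ => [|x y [i Pi ->] [j Pj ->]|i Pi].
- by exists i0.
- by rewrite /Num.max; case: ifP => _; [exists j|exists i].
- by exists i.
Qed.

Variables (m : nat) (h : 'I_m -> R[i] -> R) (L : 'I_m -> R[i] -> R[i]).
Variables (al be : 'I_m -> R[i]) (k0 : 'I_m) (C : R).
Hypothesis Hh : forall k z, hpt (h k) (L k) z.
Hypothesis HL : forall k z, L k z = al k * z + be k.
Hypothesis h0 : forall z, h k0 z = 0.
Hypothesis L0 : forall z, L k0 z = 0.
Hypothesis Htie : forall z j k, (forall l, h l z <= h j z) ->
  (forall l, h l z <= h k z) -> cmod (L j z - L k z) <= C.

(** The [h k] are quadratic polynomials; [h k0] is zero, and the gradients of two of
    them differ by at most [C] where they tie for the maximum.  Then all quadratic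
    parts vanish.  Otherwise let [a] be one of the [al l] of largest modulus.  Far
    from 0, the maximum is attained only at indices with [al l = a] in the
    direction [u], and only at other indices in the direction [u * 'i]; on the
    segment between these directions there is a tie between indices of both
    kinds, whose gradients are far apart. *)
Lemma no_quadratic k : al k = 0.
Proof.
apply/eqP; apply: contraT => ak.
have [k1 Hk1] : exists k1, forall l, cmod (al l) <= cmod (al k1).
  case: (@Order.TotalTheory.arg_maxP _ _ _ k0 xpredT (fun k => cmod (al k)) isT) => j _ H.
  by exists j => l; exact: H.
set a := al k1 in Hk1.
have a0 : 0 < cmod a by apply: lt_le_trans (Hk1 k); rewrite cmod_gt0.
have al0 : al k0 = 0.
  have := L0 0; rewrite HL mulr0 add0r => b0; have := L0 1; rewrite HL b0 addr0 mulr1.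
  by [].
have k0a : al k0 != a by rewrite al0 eq_sym -cmod_gt0.
(* [u] is chosen so that [a * u ^+ 2] is the modulus of [a] *)
pose u := sqrtc (conjc a / (cmod a)%:C).
have u2 : u ^+ 2 = conjc a / (cmod a)%:C by rewrite sqr_sqrtc.
have cu2 : cmod u ^+ 2 = 1.
  rewrite -cmodX u2 cmodM cmodJ cmodV cmodC ger0_norm ?cmod_ge0//.
  by rewrite divff// gt_eqF.
have u1 : cmod u = 1.
  by apply/eqP; rewrite -(eqrXn2 (n := 2))// ?cmod_ge0// cu2 expr1n.
have au : a * u ^+ 2 = (cmod a)%:C.
  rewrite u2 mulrA mulcJ rmorphXn /= expr2 mulfK//.
  by rewrite (inj_eq (@complexI R)) gt_eqF.
have hv l (t : R) (w : R[i]) : h l (t%:C * w) =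
   h l 0 + complex.Re (be l * w) * t + complex.Re (al l * w ^+ 2) / 2 * t ^+ 2.
  rewrite (hpt_affine_value (Hh l) (HL l)) -addrA; congr (_ + _).
  have -> : al l * (t%:C * w) ^+ 2 / 2 + be l * (t%:C * w) =
     t%:C * (be l * w) + (t ^+ 2 / 2)%:C * (al l * w ^+ 2).
    by rewrite rmorphM fmorphV rmorph_nat rmorphXn /=; field.
  by move: (be l * w) (al l * w ^+ 2) => [p q] [p' q']; rewrite !ReImE /=; field.
have [r1 Hr1] : exists r, forall l t, al l != a -> r <= t -> h l (t%:C * u) < h k1 (t%:C * u).
  suff [r Hr] : exists r, forall l, forall t, al l != a -> r <= t -> h l (t%:C * u) < h k1 (t%:C * u).
    by exists r.
  apply: (@finite_large _ (fun l r => forall t, al l != a -> r <= t -> h l (t%:C * u) < h k1 (t%:C * u))).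
    by move=> l r r' rr H t la rt; apply: H => //; exact: le_trans rt.
  move=> l; have [la|la] := eqVneq (al l) a; first by exists 0 => t /negP.
  have cl : 0 < (cmod a - complex.Re (al l * u ^+ 2)) / 2.
    rewrite divr_gt0// subr_gt0 ltNge; apply/negP => hle.
    have e1 : cmod (al l * u ^+ 2) <= cmod a by rewrite cmodM cmodX cu2 mulr1.
    have e2 : complex.Re (al l * u ^+ 2) = cmod a.
      by apply: le_anti; rewrite hle andbT; apply: le_trans (Re_le_cmod _) e1.
    have e3 : complex.Im (al l * u ^+ 2) = 0.
      have : cmod (al l * u ^+ 2) ^+ 2 <= cmod a ^+ 2 by rewrite lerXn2r ?nnegrE ?cmod_ge0.
      rewrite cmod_sqr e2 gerDl => i0; apply/eqP; rewrite -sqrf_eq0 eq_le i0 sqr_ge0.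
      by [].
    have : al l * u ^+ 2 = a * u ^+ 2 by rewrite au; apply: eqcP.
    move/(mulIf _) => E; move: la; rewrite E ?eqxx// expf_neq0// -cmod_gt0 u1.
    exact: ltr01.
  have [r Hr] := quadratic_large (h k1 0 - h l 0) (complex.Re (be k1 * u) - complex.Re (be l * u)) cl.
  exists r => t _ rt; rewrite !hv -/a au -subr_gt0; apply: lt_le_trans (Hr t rt) _.
  by rewrite le_eqVlt; apply/orP; left; apply/eqP => /=; field.
have [r2 Hr2] : exists r, forall l t, al l = a -> r <= t -> h l (t%:C * (u * 'i)) < 0.
  apply: (@finite_large _ (fun l r => forall t, al l = a -> r <= t -> h l (t%:C * (u * 'i)) < 0)).
    by move=> l r r' rr H t la rt; apply: H => //; exact: le_trans rt.
  move=> l; have a2 : 0 < cmod a / 2 by rewrite divr_gt0.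
  have [r Hr] := quadratic_large (- h l 0) (- complex.Re (be l * (u * 'i))) a2.
  exists r => t la rt; rewrite hv la -oppr_gt0; apply: lt_le_trans (Hr t rt) _.
  have -> : a * (u * 'i) ^+ 2 = - (cmod a)%:C by rewrite exprMn sqr_i mulrN1 mulrN au.
  by rewrite ReN /= le_eqVlt; apply/orP; left; apply/eqP; field.
have [r3 Hr3] : exists r, forall j l z, al j = a -> al l != a -> r <= cmod z -> C < cmod (L j z - L l z).
  apply: (@finite_large _ (fun j r => forall l z, al j = a -> al l != a -> r <= cmod z -> C < cmod (L j z - L l z))).
    by move=> l r r' rr H k' z la ka rt; apply: H => //; exact: le_trans rt.
  move=> j; apply: (@finite_large _ (fun l r => forall z, al j = a -> al l != a -> r <= cmod z -> C < cmod (L j z - L l z))).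
    by move=> l r r' rr H z la ka rt; apply: H => //; exact: le_trans rt.
  move=> l; have [la|la] := eqVneq (al l) a; first by exists 0 => z _ /negP.
  have d0 : a - al l != 0 by rewrite subr_eq0 eq_sym.
  have [r Hr] := linear_large (be j - be l) C d0; exists r => z ja _ rz.
  rewrite !HL ja; have -> : a * z + be j - (al l * z + be l) = (a - al l) * z + (be j - be l) by ring.
  exact: Hr.
pose t := Num.max (Num.max r1 r2) (2 * `|r3|).
have t1 : r1 <= t by rewrite !le_max lexx.
have t2 : r2 <= t by rewrite !le_max lexx orbT.
have t3 : 2 * `|r3| <= t by rewrite !le_max lexx !orbT.
have t0 : 0 <= t by apply: le_trans t3; rewrite mulr_ge0.
pose ga (x : R) := t%:C * u + x%:C * (t%:C * (u * 'i) - t%:C * u).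
have ga0 : ga 0 = t%:C * u by rewrite /ga rmorph0 mul0r addr0.
have ga1 : ga 1 = t%:C * (u * 'i) by rewrite /ga rmorph1 mul1r subrKC.
have gar x : r3 <= cmod (ga x).
  have -> : ga x = t%:C * u * ((1 - x) +i* x).
    rewrite /ga; have -> : (1 - x) +i* x = 1 - x%:C + x%:C * 'i.
      by apply: eqcP; rewrite !ReImE /=; ring.
    by ring.
  rewrite !cmodM cmodC ger0_norm// u1 mulr1.
  have h2 : 1 / 2 <= cmod ((1 - x) +i* x).
    rewrite -(ler_pXn2r (n := 2))// ?nnegrE ?cmod_ge0// cmod_sqr /=.
    by have := sqr_ge0 (2 * x - 1); rewrite !expr2; nra.
  apply: le_trans (ler_norm _) _; have := ler_wpM2l t0 h2; lra.
pose P x := \big[Num.max/h k1 (ga x)]_(l | al l == a) h l (ga x).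
pose Q x := \big[Num.max/h k0 (ga x)]_(l | al l != a) h l (ga x).
have ch l : cok (fun x => h l (ga x)) 0 1.
  by move=> x _; exact: is_derive_continuous (wder_line (f := fun z => (h l z)%:C) (Hh l _).1).
have cPQ : cok (fun x => P x - Q x) 0 1.
  by apply: cokB; apply: cok_bigmax.
have PQ0 : 0 <= P 0 - Q 0.
  rewrite subr_ge0 /Q; apply: bigmax_le; rewrite /P.
    apply: le_trans (bigmax_ge_id _ _ _ _); rewrite ga0; exact/ltW/Hr1.
  move=> l la; apply: le_trans (bigmax_ge_id _ _ _ _); rewrite ga0; exact/ltW/Hr1.
have PQ1 : P 1 - Q 1 <= 0.
  rewrite subr_le0; apply: (@le_trans _ _ 0).
    apply: bigmax_le; rewrite ga1; first exact/ltW/Hr2.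
    by move=> l /eqP la; exact/ltW/Hr2.
  by apply: le_trans (bigmax_ge_id _ _ _ _); rewrite h0.
have [x _ /eqP] : exists2 c, c \in `[0, 1] & P c - Q c = 0.
  apply: IVT => //; first exact: cok_within.
  by rewrite ge_min le_max PQ0 PQ1 orbT.
rewrite subr_eq0 => /eqP PQ.
have [j ja Pj] := @bigmax_attained _ (fun l => al l == a) k1 (fun l => h l (ga x)) (eqxx _).
have [l la Ql] := @bigmax_attained _ (fun l => al l != a) k0 (fun l => h l (ga x)) k0a.
have Pge i : h i (ga x) <= P x.
  have [ia|ia] := eqVneq (al i) a.
    by rewrite /P; apply: le_bigmax_cond; rewrite ia.
  by rewrite PQ /Q; apply: le_bigmax_cond.
have := Htie (z := ga x) (j := j) (k := l).
rewrite -Pj -Ql -/(P x) -/(Q x) -PQ => /(_ Pge Pge).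
by rewrite leNgt => /negP[]; apply: Hr3 (gar x) => //; exact/eqP.
Qed.

End NoQuadratic.

(** * Exponential growth *)

Section LinearGrowth.
Variable R : realType.
Implicit Types (z w e : R[i]).

Lemma wder_unique (f : R[i] -> R[i]) z a b : wder f z a 0 -> wder f z b 0 -> a = b.
Proof. by move=> /wder_holomorphic[_ <-] /wder_holomorphic[_ <-]. Qed.

Variables (m : nat) (G G1 : 'I_m -> R[i] -> R[i]) (k0 : 'I_m) (g g1 : R[i] -> R[i]) (K : R).
Variables (al be : 'I_m -> R[i]).
Hypothesis HG : forall k z, wder (G k) z (G1 k z) 0.
Hypothesis HG1 : forall k z, holo (G1 k) z.
Hypothesis G0 : forall k z, G k z != 0.
Hypothesis Gk0 : forall z, G k0 z = 1.
Hypothesis Hg : forall z, wder g z (g1 z) 0.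
Hypothesis Hg1 : forall z, holo g1 z.
Hypothesis K0 : 0 < K.
Hypothesis BW : forall z B k, cmod (g z) <= B -> (forall l, cmod (G l z) <= B) ->
  cmod (g1 z * G k z - g z * G1 k z) <= K * B ^+ 2.
Hypothesis BG : forall z B j k, cmod (g z) <= B -> (forall l, cmod (G l z) <= B) ->
  cmod (G1 j z * G k z - G j z * G1 k z) <= K * B ^+ 2.
Hypothesis Hal : forall k z, ldG G G1 k z = al k * z + be k.

Lemma ld_unit z : ldG G G1 k0 z = 0.
Proof.
have E : G k0 = (fun=> 1) by apply/funext => x; exact: Gk0.
have := HG k0 z; rewrite E => /wder_unique/(_ (wder_cst 1 z)) G10.
by rewrite /ldG G10 mul0r.
Qed.

Lemma al0 k : al k = 0.
Proof.
apply: (@no_quadratic R m (logG G) (ldG G G1) al be k0 (16 * K)).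
- by move=> j z; exact: hpt_logG.
- exact: Hal.
- by move=> z; exact: logG0.
- exact: ld_unit.
- move=> z i j Hi Hj; apply: (tie_bound k0 HG HG1 G0 Hg Hg1 K0 BW BG) => l.
    exact: (log_top G0 Hi).
  exact: (log_top G0 Hj).
Qed.

(** All components have exponential type: the [G k] have constant logarithmic
    derivatives, and [g] is at most a dominant [G l], or exceeds it by a factor
    which [outside_low] bounds. *)
Lemma linear_growth : exists2 C : R, 0 < C & forall z,
  cmod (g z) <= expR (C * (1 + cmod z)) /\
  forall k, cmod (G k z) <= expR (C * (1 + cmod z)).
Proof.
pose C1 := \sum_k (`|logG G k 0| + cmod (be k)).
have C10 : 0 <= C1 by apply: sumr_ge0 => k _; rewrite addr_ge0 ?cmod_ge0.
have hG k z : logG G k z <= C1 * (1 + cmod z).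
  rewrite (hpt_affine_value (hpt_logG HG HG1 G0 k) (Hal k)) al0 !mul0r add0r.
  have c0 := cmod_ge0 z.
  apply: (@le_trans _ _ ((`|logG G k 0| + cmod (be k)) * (1 + cmod z))).
    have h1 := ler_norm (logG G k 0); have := Re_le_cmod (be k * z); rewrite cmodM => h2.
    have h3 : 0 <= `|logG G k 0| * cmod z by rewrite mulr_ge0.
    have := cmod_ge0 (be k); nra.
  rewrite ler_wpM2r ?addr_ge0// /C1 (bigD1 k)//= lerDl.
  by apply: sumr_ge0 => j _; rewrite addr_ge0 ?cmod_ge0.
have eG k z : cmod (G k z) = expR (logG G k z) by rewrite /logG lnK// posrE cG_gt0.
have mono (c C z : _) : 0 <= c -> c <= C -> expR (c * (1 + cmod z)) <= expR (C * (1 + cmod z)) :> R.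
  by move=> c0 cC; rewrite ler_expR ler_wpM2r// addr_ge0// cmod_ge0.
have [[e le]|no] := pselect (exists e, low G g e).
  pose C := C1 + 2 * K * (1 + cmod e).
  have cKe : 0 < 2 * K * (1 + cmod e) by rewrite !mulr_gt0// ltr_wpDr ?cmod_ge0.
  exists C; first by rewrite ltr_wpDl.
  have hC k z : cmod (G k z) <= expR (C * (1 + cmod z)).
    rewrite eG; apply: le_trans (mono C1 C z _ _); rewrite ?lerDl ?(ltW cKe)//.
    by rewrite ler_expR.
  move=> z; split=> [|k]; last exact: hC.
  have [[k lz]|nz] := pselect (low G g z); first exact: le_trans lz (hC k z).
  have [r [l [r0 re _ hl]]] := outside_low k0 HG HG1 G0 Hg Hg1 BW nz le.
  have gz := nlow_g k0 G0 nz.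
  rewrite -[leLHS]lnK ?posrE ?cmod_gt0// ler_expR.
  have h1 := hG l z; have h2 : r <= cmod e + cmod z := le_trans re (cmodB _ _).
  have h3 : 2 * r * K <= 2 * K * (1 + cmod e) * (1 + cmod z).
    have := cmod_ge0 e; have := cmod_ge0 z; move: (cmod e) (cmod z) h2 => x y h2 y0 x0.
    have q1 : r <= (1 + x) * (1 + y) by nra.
    have -> : 2 * r * K = 2 * K * r by ring.
    by rewrite -[leRHS]mulrA ler_wpM2l// mulr_ge0// ltW.
  by rewrite /C mulrDl; lra.
(* here [g1 / g] is the logarithmic derivative of the constant component *)
have no' w : ~ low G g w by move=> lw; apply: no; exists w.
have g10 z : g1 z = 0.
  have := no_low_ld k0 HG HG1 G0 Hg Hg1 no' k0 z; rewrite ld_unit => /eqP.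
  by rewrite mulf_eq0 invr_eq0 (negbTE (nlow_g k0 G0 (no' z))) orbF => /eqP.
have gc : forall z, g z = g 0 by apply: deriv0_cst => z; have := Hg z; rewrite g10.
exists (C1 + 1 + cmod (g 0)); first by rewrite ltr_pwDl ?cmod_ge0// ltr_wpDl.
move=> z; split=> [|k].
  rewrite gc; apply: (@le_trans _ _ (1 + cmod (g 0))); first by rewrite lerDr.
  apply: le_trans (expR_ge1Dx _) _; rewrite ler_expR.
  by have := cmod_ge0 (g 0); have := cmod_ge0 z; nra.
rewrite eG ler_expR; apply: le_trans (hG k z) _.
by rewrite ler_wpM2r ?addr_ge0 ?cmod_ge0// -addrA lerDl addr_ge0// cmod_ge0.
Qed.

End LinearGrowth.

(** * Masses of rectangles in the plane *)

Section PlaneMeasure.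
Variable R : realType.

Local Notation leb2 := (@lebesgue_measure R \x @lebesgue_measure R)%E.

(** No measurability is needed, the integral of a nonnegative function being a
    supremum over simple functions. *)
Lemma ge0_integral_mono d (X : measurableType d) (mu : {measure set X -> \bar R})
    (D : set X) (f g : X -> \bar R) :
  (forall x, D x -> (0 <= f x)%E) -> (forall x, D x -> (f x <= g x)%E) ->
  (\int[mu]_(x in D) f x <= \int[mu]_(x in D) g x)%E.
Proof.
move=> f0 fg; have g0 x : D x -> (0 <= g x)%E by move=> Dx; apply: le_trans (f0 x Dx) (fg x Dx).
rewrite !ge0_integralE//; apply: ereal_sup_le => _ [h /= hf <-]; exists h => // x.
apply: le_trans (hf x) _; rewrite /patch; case: ifPn => // /set_mem Dx.
exact: fg.
Qed.

(** Continuous functions on the plane are measurable for the product sigma-algebra,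
    an open set being a countable union of rational squares. *)
Lemma continuous2_measurable (f : R * R -> R) :
  (forall p (e : R), 0 < e -> exists2 d, 0 < d & forall q, `|q.1 - p.1| <= d ->
     `|q.2 - p.2| <= d -> `|f q - f p| <= e) -> measurable_fun setT f.
Proof.
move=> cf; apply: (measurability _ (measurable_realfun.RGenOInfty.measurableE R)) => _ /= -[_ [a ->] <-].
rewrite setTI.
pose box (q1 q2 r : rat) : set (R * R) :=
  `[ratr q1 - ratr r, ratr q1 + ratr r]%classic `*` `[ratr q2 - ratr r, ratr q2 + ratr r]%classic.
pose F q1 q2 r := if `[< box q1 q2 r `<=` [set p | a < f p] >] then box q1 q2 r else set0.
have -> : f @^-1` `]a, +oo[%classic = \bigcup_q1 \bigcup_q2 \bigcup_r F q1 q2 r.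
  apply/seteqP; split => [p|p [q1 _ [q2 _ [r _]]]]; last first.
    rewrite /F; case: asboolP => // Hb /Hb /=.
    by rewrite in_itv /= andbT.
  rewrite /= in_itv /= andbT => ap.
  have e0 : 0 < (f p - a) / 2 by rewrite divr_gt0// subr_gt0.
  have [d d0 Hd] := cf p _ e0.
  have [r] := rat_in_itvoo (divr_gt0 d0 (ltr0Sn _ 1)); rewrite in_itv /= => /andP[r0 rd].
  have i0 (x : R) : x - ratr r < x + ratr r by rewrite ltrD2l gtrN.
  have [q1] := rat_in_itvoo (i0 p.1).
  rewrite in_itv /= => /andP[q11 q12].
  have [q2] := rat_in_itvoo (i0 p.2).
  rewrite in_itv /= => /andP[q21 q22].
  exists q1 => //; exists q2 => //; exists r => //.
  rewrite /F asboolT.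
    by split; rewrite /= in_itv /= lerBlDr (ltW q12, ltW q22) -lerBlDr (ltW q11, ltW q21).
  have near (x y z t : R) : x - t < y -> y < x + t -> t < d / 2 -> y - t <= z ->
      z <= y + t -> `|z - x| <= d.
    by move=> *; rewrite ler_norml; apply/andP; split; lra.
  move=> q [/=]; rewrite !in_itv /= => /andP[h1 h2] /andP[h3 h4].
  have : `|f q - f p| <= (f p - a) / 2.
    by apply: Hd; [exact: (near _ (ratr q1) _ (ratr r))|exact: (near _ (ratr q2) _ (ratr r))].
  rewrite ler_norml => /andP[h5 _]; clear -ap h5; lra.
apply: bigcupT_measurable_rat => q1; apply: bigcupT_measurable_rat => q2.
apply: bigcupT_measurable_rat => r; rewrite /F; case: ifP => _ //.
exact: measurableX.
Qed.

Lemma leb2_rect (a b c d : R) : a <= b -> c <= d ->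
  leb2 (`]a, b]%classic `*` `]c, d]%classic) = ((b - a) * (d - c))%:E.
Proof.
move=> ab cd; rewrite product_measure1E//= !lebesgue_measure_itv /= !lte_fin.
have H (x y : R) : x <= y -> (if (x < y)%R then y%:E - x%:E else 0)%E = (y - x)%:E.
  by rewrite le_eqVlt => /orP[/eqP ->|->//]; rewrite ltxx subrr.
by rewrite !H// -EFinM.
Qed.

Section Mass.
Variables (D : set (R * R)) (f : R * R -> R) (B : R).
Hypothesis mD : measurable D.
Hypothesis mf : measurable_fun setT f.
Hypothesis f0 : forall p, 0 <= f p.
Hypothesis fB : forall p, f p <= B.

Let rect (a b c d : R) : set (R * R) := `]a, b]%classic `*` `]c, d]%classic.

Let mrect a b c d : measurable (rect a b c d).
Proof. exact: measurableX. Qed.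

(** The mass in a rectangle of the density [f] restricted to [D]. *)
Definition mass (a b c d : R) : R :=
  fine (\int[leb2]_(p in (`]a, b]%classic `*` `]c, d]%classic) `&` D) (f p)%:E).

Lemma mass_le a b c d (k : R) : a <= b -> c <= d -> 0 <= k ->
  (forall p, a <= p.1 <= b -> c <= p.2 <= d -> D p -> f p <= k) ->
  (\int[leb2]_(p in rect a b c d `&` D) (f p)%:E <= (k * ((b - a) * (d - c)))%:E)%E.
Proof.
move=> ab cd k0 Hk.
apply: (@le_trans _ _ (\int[leb2]_(p in rect a b c d `&` D) (cst k%:E p))%E).
  apply: ge0_integral_mono => p.
    by move=> _; rewrite lee_fin.
  move=> [[/=]]; rewrite !in_itv /= => /andP[/ltW h1 h2] /andP[/ltW h3 h4] Dp.
  by rewrite lee_fin; apply: Hk => //; rewrite ?h1 ?h2 ?h3 ?h4.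
rewrite integral_cst; last exact: (measurableI _ _ (mrect _ _ _ _) mD).
rewrite EFinM; apply: lee_wpmul2l; first by rewrite lee_fin.
rewrite -leb2_rect//; apply: le_measure; rewrite ?inE//.
  exact: (measurableI _ _ (mrect _ _ _ _) mD).
exact: mrect.
Qed.

Let Bf0 : 0 <= B. Proof. exact: le_trans (f0 (0, 0)) (fB (0, 0)). Qed.

Lemma massE a b c d : a <= b -> c <= d ->
  (\int[leb2]_(p in rect a b c d `&` D) (f p)%:E)%E = (mass a b c d)%:E.
Proof.
move=> ab cd; rewrite /mass fineK// ge0_fin_numE.
  apply: le_lt_trans (@mass_le a b c d B ab cd Bf0 _) (ltry _).
  by move=> p _ _ _; exact: fB.
by apply: integral_ge0 => p _; rewrite lee_fin.
Qed.

Lemma mass_bound a b c d (k : R) : a <= b -> c <= d -> 0 <= k ->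
  (forall p, a <= p.1 <= b -> c <= p.2 <= d -> D p -> f p <= k) ->
  mass a b c d <= k * ((b - a) * (d - c)).
Proof. by move=> ab cd k0 Hk; rewrite -lee_fin -massE//; exact: mass_le. Qed.

Let mass_split (X Y Z : set (R * R)) : measurable X -> measurable Y ->
  Z = X `|` Y -> [disjoint X & Y] ->
  (\int[leb2]_(p in Z `&` D) (f p)%:E = \int[leb2]_(p in X `&` D) (f p)%:E
     + \int[leb2]_(p in Y `&` D) (f p)%:E)%E.
Proof.
move=> mX mY -> dXY; rewrite setIUl ge0_integral_setU//.
- exact: (measurableI _ _ mX mD).
- exact: (measurableI _ _ mY mD).
- by apply/measurable_realfun.measurable_EFinP; apply: measurable_funS mf.
- by move=> p _; rewrite lee_fin.
- apply/disj_setPS => p [[Xp _] [Yp _]]; move/disj_setPS : dXY => /(_ p) H; exact: H.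
Qed.

Lemma mass_sub4 a m b c k d : a <= m -> m <= b -> c <= k -> k <= d ->
  mass a b c d = mass a m c k + mass m b c k + mass a m k d + mass m b k d.
Proof.
move=> am mb ck kd; have ab := le_trans am mb; have cd := le_trans ck kd.
apply: EFin_inj; rewrite !EFinD -!massE//.
have hs c' d' : rect a b c' d' = rect a m c' d' `|` rect m b c' d'.
  rewrite /rect; apply/seteqP; split => -[x y] /=; rewrite !in_itv /=.
    by move=> [/andP[ax xb] ->]; have [xm|mx] := leP x m; [left; rewrite ax|right].
  by move=> [] [/andP[h1 h2] ->]; rewrite ?h1 ?h2 ?(le_trans h2)// ?(le_lt_trans am).
have vs a' b' : rect a' b' c d = rect a' b' c k `|` rect a' b' k d.
  rewrite /rect; apply/seteqP; split => -[x y] /=; rewrite !in_itv /=.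
    by move=> [-> /andP[ax xb]]; have [xm|mx] := leP y k; [left; rewrite ax|right].
  by move=> [] [-> /andP[h1 h2]]; rewrite ?h1 ?h2 ?(le_trans h2)// ?(le_lt_trans ck).
have hd c' d' c'' d'' : [disjoint rect a m c' d' & rect m b c'' d''].
  rewrite /rect; apply/disj_setPS => -[x y] [[/= h1 _] [/= h2 _]]; move: h1 h2; rewrite !in_itv /=.
  by move=> /andP[_ h1] /andP[h2 _]; have := le_lt_trans h1 h2; rewrite ltxx.
have vd a' b' a'' b'' : [disjoint rect a' b' c k & rect a'' b'' k d].
  rewrite /rect; apply/disj_setPS => -[x y] [[/= _ h1] [/= _ h2]]; move: h1 h2; rewrite !in_itv /=.
  by move=> /andP[_ h1] /andP[h2 _]; have := le_lt_trans h1 h2; rewrite ltxx.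
rewrite (mass_split (mrect a b c k) (mrect a b k d) (vs a b) (vd _ _ _ _)).
rewrite (mass_split (mrect a m c k) (mrect m b c k) (hs c k) (hd _ _ _ _)).
rewrite (mass_split (mrect a m k d) (mrect m b k d) (hs k d) (hd _ _ _ _)).
by rewrite -!addeA.
Qed.

End Mass.
End PlaneMeasure.

(** * The area covered in a disc *)

Section Cutoff.
Variables (R : realType) (s : R).
Hypothesis s0 : 0 < s.

Local Notation c := (s ^- 2).

(** A polynomial that vanishes to second order at the end points of the interval
    from [- s] to [s], and its first two derivatives. *)
Definition cut (x : R) : R := (1 - c * x ^+ 2) ^+ 2.
Definition cut1 (x : R) : R := - 4 * c * x * (1 - c * x ^+ 2).
Definition cut2 (x : R) : R := - 4 * c + 12 * c ^+ 2 * x ^+ 2.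

Lemma is_derive_cut (x : R) : is_derive x 1 cut (cut1 x).
Proof.
rewrite /cut /cut1; move: (c) => k.
by apply: is_derive_eq; rewrite /GRing.scale /= !(add0r, mulr1, expr1, mulr0, addr0, mul1r); ring.
Qed.

Lemma is_derive_cut1 (x : R) : is_derive x 1 cut1 (cut2 x).
Proof.
rewrite /cut1 /cut2; move: (c) => k.
by apply: is_derive_eq; rewrite /GRing.scale /= !(add0r, mulr1, expr1, mulr0, addr0, mul1r); ring.
Qed.

Let c0 : 0 < c. Proof. by rewrite invr_gt0 exprn_gt0. Qed.

Lemma cut_end (e : R) : `|e| = s -> cut e = 0 /\ cut1 e = 0.
Proof.
move=> es; rewrite /cut /cut1; have -> : e ^+ 2 = s ^+ 2 by rewrite -es real_normK// num_real.
by rewrite mulVf ?expf_neq0 ?gt_eqF// subrr expr0n mulr0.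
Qed.

Let cx1 (x : R) : `|x| <= s -> 0 <= c * x ^+ 2 <= 1.
Proof.
move=> xs; rewrite mulr_ge0 ?sqr_ge0 ?(ltW c0)//= mulrC ler_pdivrMr ?exprn_gt0// mul1r.
by rewrite -real_normK ?num_real// lerXn2r// nnegrE// ltW.
Qed.

Lemma cut_ge0 (x : R) : 0 <= cut x.
Proof. exact: sqr_ge0. Qed.

Lemma cut_le1 (x : R) : `|x| <= s -> cut x <= 1.
Proof.
move=> /cx1; rewrite /cut; move: (c * x ^+ 2) => k /andP[k0 k1].
by rewrite expr_le1// ?subr_ge0// gerBl.
Qed.

Lemma cut2_le (x : R) : `|x| <= s -> `|cut2 x| <= 8 * c.
Proof.
move=> /cx1; have -> : cut2 x = 4 * c * (3 * (c * x ^+ 2) - 1).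
  by rewrite /cut2; move: (c) => k; ring.
move: (c * x ^+ 2) => k /andP[k0 k1]; rewrite normrM (ger0_norm (ltW _)) ?mulr_gt0//.
have -> : 8 * c = 4 * c * 2 by rewrite mulrAC; congr (_ * _); rewrite -natrM.
by rewrite ler_pM2l ?mulr_gt0// ler_norml; apply/andP; split; lra.
Qed.

Lemma cut_half (x : R) : `|x| <= s / 2 -> 1 <= 2 * cut x.
Proof.
move=> xs; have : c * x ^+ 2 <= 1 / 4.
  have -> : 1 / 4 = c * (s / 2) ^+ 2.
    by rewrite exprMn mulrA mulVf ?expf_neq0 ?gt_eqF// exprVn -natrX.
  rewrite ler_pM2l// -real_normK ?num_real// lerXn2r// nnegrE// divr_ge0// ltW//.
rewrite /cut; move: (c * x ^+ 2) => k k4; nra.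
Qed.

End Cutoff.

Lemma dist_in_itv (R : realType) (a b x p r t : R) : a <= x -> x <= b -> a <= p -> p <= b ->
  0 <= t -> (b - a) + t <= r -> `|p - x| <= r.
Proof. by move=> *; rewrite ler_norml; apply/andP; split; lra. Qed.

Section AreaEstimate.
Variables (R : realType) (n : nat) (F F1 F2 : 'I_n.+1 -> R[i] -> R[i]) (M : R).
Hypothesis HF : forall j z, wder (F j) z (F1 j z) 0.
Hypothesis HF1 : forall j z, wder (F1 j) z (F2 j z) 0.
Hypothesis HF0 : forall z, exists j, F j z != 0.
Hypothesis HM : forall z, sph2 F F1 z <= M ^+ 2.

Local Notation U z := (ln (norm2 F z)).

Lemma ccont_plane (u : R[i] -> R) : (forall z, ccont (fun x => (u x)%:C) z) ->
  forall (p : R * R) (e : R), 0 < e -> exists2 d : R, 0 < d &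
    forall q : R * R, `|q.1 - p.1| <= d -> `|q.2 - p.2| <= d ->
      `|u (q.1 +i* q.2) - u (p.1 +i* p.2)| <= e.
Proof.
move=> H p e e0; have [d d0 Hd] := H (p.1 +i* p.2) e e0.
exists (d / 2); first by rewrite divr_gt0.
move=> q h1 h2.
have /Hd : cmod ((q.1 - p.1) +i* (q.2 - p.2)) <= d.
  apply: le_trans (cmod_le_ReIm _) _ => /=.
  by rewrite [d]splitr lerD.
rewrite -rmorphB cmodC; congr (`|u _ - _| <= _).
by apply: eqcP; rewrite /= !subrKC.
Qed.

Lemma ccont_cmod z : ccont (fun x : R[i] => (cmod x)%:C) z.
Proof.
move=> e e0; exists e => // h he; rewrite -rmorphB cmodC.
apply: le_trans he; have h1 := cmodD z h; have h2 := cmodB (z + h) h.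
by rewrite addrK in h2; rewrite ler_norml; apply/andP; split; lra.
Qed.

Lemma measurable_disc (t : R) : measurable [set p : R * R | cmod (p.1 +i* p.2) <= t].
Proof.
have H : measurable_fun setT (fun p : R * R => cmod (p.1 +i* p.2)).
  exact: continuous2_measurable (ccont_plane ccont_cmod).
have := H measurableT _ (measurable_itv `]-oo, t]); rewrite setTI.
by congr measurable; apply/seteqP; split => p /=; rewrite in_itv.
Qed.

Lemma disc_in_square (s : R) : 0 < s -> [set p : R * R | cmod (p.1 +i* p.2) <= s / 2] =
  (`]- s, s]%classic `*` `]- s, s]%classic) `&` [set p : R * R | cmod (p.1 +i* p.2) <= s / 2].
Proof.
move=> s0; apply/seteqP; split => p //=; last by case.
move=> hp; split => //; have s2 : s / 2 < s by rewrite ltr_pdivrMr// ltr_pMr// ltr1n.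
have := le_lt_trans (le_trans (normRe_le (p.1 +i* p.2)) hp) s2.
have := le_lt_trans (le_trans (normIm_le (p.1 +i* p.2)) hp) s2.
rewrite /= !ltr_norml !in_itv /= => /andP[h1 h2] /andP[h3 h4].
by rewrite h1 h3 !ltW.
Qed.

Lemma wder_ex_sum (f : 'I_n.+1 -> R[i] -> R[i]) (P : pred 'I_n.+1) z :
  (forall i, exists a b, wder (f i) z a b) ->
  exists a b, wder (fun x => \sum_(i | P i) f i x) z a b.
Proof.
move=> /choice[a] /choice[b] Hab.
by exists (\sum_(i | P i) a i), (\sum_(i | P i) b i); apply: wder_sum => i _; exact: Hab.
Qed.

Lemma ccont_sph2 z : ccont (fun x => (sph2 F F1 x)%:C) z.
Proof.
have N0 : (norm2 F z)%:C != 0 :> R[i].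
  by rewrite (inj_eq (@complexI R)) gt_eqF ?norm2_gt0.
have [a [b Hn]] : exists a b, wder (fun x => (norm2 F x)%:C) z a b.
  have [a [b H]] := @wder_ex_sum (fun j x => F j x * conjc (F j x)) xpredT z
    (fun j => ex_intro _ _ (ex_intro _ _ (wderM (HF j z) (wderJ (HF j z))))).
  by exists a, b; apply: wder_ext H => x; rewrite norm2E.
pose W i j x := F1 i x * F j x - F i x * F1 j x.
have HW i j : exists a b, wder (fun x => W i j x * conjc (W i j x)) z a b.
  have H := wderB (wderM (HF1 i z) (HF j z)) (wderM (HF i z) (HF1 j z)).
  by eexists; eexists; exact: wderM H (wderJ H).
have [a' [b' HS]] := @wder_ex_sum (fun i x => \sum_(j < n.+1 | (i < j)%N) W i j x * conjc (W i j x))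
  xpredT z (fun i => wder_ex_sum (fun j : 'I_n.+1 => (i < j)%N) (HW i)).
have HV := wderV N0 Hn.
have H := wderM (wderM HV HV) HS.
apply: (wder_ccont (wder_ext _ H)) => x.
rewrite /sph2 rmorphM fmorphV rmorphXn /= expr2 invfM; congr (_ * _).
rewrite rmorph_sum; apply: eq_bigr => i _; rewrite rmorph_sum; apply: eq_bigr => j _.
exact: mulcJ.
Qed.

Variable s : R.
Hypothesis s0 : 0 < s.

Local Notation X z := (complex.Re z).
Local Notation Y z := (complex.Im z).

(* A cut-off function on the square of the points with coordinates between [- s]
   and [s]. *)
Let phi (z : R[i]) : R := cut s (X z) * cut s (Y z).

(* The derivative of [phi] with respect to the conjugate variable. *)
Let psi (z : R[i]) : R[i] :=
  (cut1 s (X z) * cut s (Y z) / 2) +i* (cut s (X z) * cut1 s (Y z) / 2).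

(* The Laplacian of [phi]. *)
Let lap (z : R[i]) : R := cut2 s (X z) * cut s (Y z) + cut s (X z) * cut2 s (Y z).

Let wX (u v : R -> R) (z : R[i]) : (forall x : R, is_derive x 1 u (v x)) ->
  wder (fun x => (u (X x))%:C) z (v (X z) / 2)%:C (v (X z) / 2)%:C.
Proof. by move=> H; exact: wder_Re. Qed.

Let wY (u v : R -> R) (z : R[i]) : (forall x : R, is_derive x 1 u (v x)) ->
  wder (fun x => (u (Y x))%:C) z ((- v (Y z) / 2)%:C * 'i) ((v (Y z) / 2)%:C * 'i).
Proof. by move=> H; exact: wder_Im. Qed.

Let wphi z : wder (fun x => (phi x)%:C) z (conjc (psi z)) (psi z).
Proof.
have H := wderM (wX z (is_derive_cut s)) (wY z (is_derive_cut s)).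
apply: (wder_eq (wder_ext _ H)) => [x||]; first by apply: eqcP; rewrite !ReImE /phi /=; ring.
  by apply: eqcP; rewrite !ReImE /psi /=; ring.
by apply: eqcP; rewrite !ReImE /psi /=; ring.
Qed.

Let wpsi z : exists b, wder psi z (lap z / 4)%:C b.
Proof.
have H := wderD (wderZ (1 / 2)%:C (wderM (wX z (is_derive_cut1 s)) (wY z (is_derive_cut s))))
  (wderZ ((1 / 2)%:C * 'i) (wderM (wX z (is_derive_cut s)) (wY z (is_derive_cut1 s)))).
eexists; apply: (wder_eq (wder_ext _ H) _ erefl) => [x|].
  by apply: eqcP; rewrite !ReImE /psi /=; ring.
apply: eqcP; rewrite !ReImE /lap /=; last by ring.
by field.
Qed.

Variable B : R.
Hypothesis HB : forall z, `|X z| <= s -> `|Y z| <= s -> `|U z| <= B.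

Let B0 : 0 <= B.
Proof. by apply: le_trans (HB (z := 0) _ _) => //; rewrite normr0 ltW. Qed.

(* Large enough for [U * lap / 2 <= kap] on the square. *)
Let kap : R := 8 * s ^- 2 * B.

(* Its divergence is [4 * phi * sph2 - U * lap + 2 * kap]. *)
Let V z : R[i] := (2 : R)%:C * (phi z)%:C * conjc (dlog F F1 z) -
  (2 : R)%:C * (U z)%:C * psi z + kap%:C * z.

Let reV (p d : R[i]) (f S u l k : R) :
  complex.Re ((2 : R)%:C * conjc p * conjc d + (2 : R)%:C * f%:C * conjc S%:C -
    ((2 : R)%:C * d * p + (2 : R)%:C * u%:C * (l / 4)%:C) + k%:C * 1) =
  2 * f * S - u * l / 2 + k.
Proof. by case: p => a b; case: d => a' b'; rewrite !ReImE /=; field. Qed.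

Let wV z : exists a b, wder V z a b /\
  complex.Re a = 2 * phi z * sph2 F F1 z - U z * lap z / 2 + kap.
Proof.
have [a0 Hd] := wder_dlog HF HF1 HF0 z; have [b0 Hp] := wpsi z.
have H := wderD (wderB (wderM (wderZ (2 : R)%:C (wphi z)) (wderJ Hd))
  (wderM (wderZ (2 : R)%:C (wder_log_norm2 HF HF0 z)) Hp)) (wderZ kap%:C (wder_id z)).
by eexists; eexists; split; [exact: H|exact: reV].
Qed.

Let divV z : `|X z| <= s -> `|Y z| <= s -> 2 * phi z * sph2 F F1 z <=
  2 * phi z * sph2 F F1 z - U z * lap z / 2 + kap.
Proof.
move=> Xs Ys; rewrite -addrA lerDl.
have hl : `|lap z| <= 16 * s ^- 2.
  rewrite /lap; apply: le_trans (ler_normD _ _) _.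
  rewrite (normrM (cut2 s (X z))) (normrM (cut s (X z))).
  have -> : 16 * s ^- 2 = 8 * s ^- 2 * 1 + 1 * (8 * s ^- 2).
    by rewrite mulr1 mul1r -mulrDl -natrD.
  rewrite (ger0_norm (cut_ge0 s (X z))) (ger0_norm (cut_ge0 s (Y z))).
  by rewrite lerD// ler_pM ?cut_ge0 ?cut2_le ?cut_le1.
have : `|U z * lap z| <= B * (16 * s ^- 2) by rewrite normrM ler_pM// HB.
rewrite /kap ler_norml => /andP[_]; move: (U z * lap z) (s ^- 2) => u c; lra.
Qed.

Let V_edge z : `|X z| = s \/ `|Y z| = s -> V z = kap%:C * z.
Proof.
move=> h; rewrite /V; have -> : phi z = 0.
  by rewrite /phi; case: h => /(cut_end s0)[-> _]; rewrite ?mul0r ?mulr0.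
have -> : psi z = 0.
  by rewrite /psi; case: h => /(cut_end s0)[-> ->]; rewrite !(mul0r, mulr0).
by rewrite !(mulr0, mul0r) subrr add0r.
Qed.

Let fluxV : flux V (- s) s (- s) s = 64 * B.
Proof.
have ss : - s <= s by rewrite lerNl (le_trans _ (ltW s0))// oppr_le0 ltW.
have ns : `|s| = s by rewrite ger0_norm// ltW.
have re0 k (z : R[i]) : complex.Re (k%:C * z) = k * complex.Re z by rewrite !ReImE /=; ring.
have im0 k (z : R[i]) : complex.Im (k%:C * z) = k * complex.Im z by rewrite !ReImE /=; ring.
rewrite /flux.
have -> : rint (fun y => complex.Re (V (s +i* y))) (- s) s = rint (fun=> kap * s) (- s) s.
  by apply: rint_ext => y _; rewrite V_edge ?re0//=; left.
have -> : rint (fun y => complex.Re (V (- s +i* y))) (- s) s = rint (fun=> kap * - s) (- s) s.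
  by apply: rint_ext => y _; rewrite V_edge ?re0//=; left; rewrite normrN.
have -> : rint (fun x => complex.Im (V (x +i* s))) (- s) s = rint (fun=> kap * s) (- s) s.
  by apply: rint_ext => y _; rewrite V_edge ?im0//=; right.
have -> : rint (fun x => complex.Im (V (x +i* - s))) (- s) s = rint (fun=> kap * - s) (- s) s.
  by apply: rint_ext => y _; rewrite V_edge ?im0//=; right; rewrite normrN.
rewrite !rint_cst// /kap; move: s0; move: (s) => t t0; field.
by rewrite gt_eqF.
Qed.

Let disc : set (R * R) := [set p | cmod (p.1 +i* p.2) <= s / 2].
Let dens (p : R * R) : R := sph2 F F1 (p.1 +i* p.2).

Let mdisc : measurable disc := measurable_disc (s / 2).

Let mdens : measurable_fun setT dens.
Proof. exact: continuous2_measurable (ccont_plane ccont_sph2). Qed.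

(** The divergence of [V] is at least [4 * phi * sph2], hence at least [sph2] on the
    disc of radius [s / 2], and its flux out of the square is that of [kap * z]. *)
Lemma area_le :
  (\int[@lebesgue_measure R \x @lebesgue_measure R]_(p in
      [set p : R * R | (cmod (p.1 +i* p.2) <= s / 2)%R])
    (sph2 F F1 (p.1 +i* p.2))%:E <= (64 * B)%:E)%E.
Proof.
have ss : - s < s by rewrite (lt_trans _ s0)// oppr_lt0.
have d0 p : 0 <= dens p by exact: sph2_ge0.
have dB p : dens p <= M ^+ 2 by exact: HM.
rewrite (disc_in_square s0).
rewrite (massE mdisc d0 dB (ltW ss) (ltW ss)) lee_fin -fluxV.
have /choice[al /choice[be Hal]] := wV.
have Hx (x : R) : - s <= x <= s -> `|x| <= s by rewrite ler_norml.
apply: (@gauss_le _ V al be) => //.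
- by move=> x y _ _; have [] := Hal (x +i* y).
- move=> a b c d _ ab _ _ cd _.
  rewrite -(mass_sub4 mdisc mdens d0 dB)//; lra.
move=> x y /Hx xs /Hx ys e e0.
have [_ ->] := Hal (x +i* y).
have dv := @divV (x +i* y) xs ys.
have ph0 : 0 <= phi (x +i* y) by rewrite mulr_ge0// cut_ge0.
have S0 := sph2_ge0 F1 HF0 (x +i* y).
have k0 : 0 <= 2 * (2 * phi (x +i* y) * sph2 F F1 (x +i* y) - U (x +i* y) * lap (x +i* y) / 2 + kap) + e.
  rewrite addr_ge0 ?(ltW e0)// mulr_ge0//; apply: le_trans dv.
  by apply: mulr_ge0 S0; apply: mulr_ge0 ph0.
have [hxy|hxy] := leP (cmod (x +i* y)) (s / 2).
  have ph1 : 1 <= 4 * phi (x +i* y).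
    have h1 : 1 <= 2 * cut s x by apply: cut_half => //; exact: le_trans (normRe_le (x +i* y)) hxy.
    have h2 : 1 <= 2 * cut s y by apply: cut_half => //; exact: le_trans (normIm_le (x +i* y)) hxy.
    have -> : 4 * phi (x +i* y) = (2 * cut s x) * (2 * cut s y).
      by rewrite [RHS]mulrACA -natrM.
    exact: mulr_ege1.
  have [r r0 Hr] := ccont_plane ccont_sph2 (x, y) e0.
  exists r => // a b c d _ ab _ _ cd _ /andP[ax xb] /andP[cy yd] abcd.
  have dc0 : 0 <= d - c by rewrite subr_ge0 ltW.
  apply: (mass_bound mdisc d0 dB (ltW ab) (ltW cd) k0).
  move=> p /andP[p1 p2] /andP[p3 p4] _.
  have /ler_normlW : `|dens p - dens (x, y)| <= e.
    apply: Hr; first exact: (dist_in_itv ax xb p1 p2 dc0 abcd).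
    by apply: (dist_in_itv cy yd p3 p4 (t := b - a)); rewrite ?subr_ge0 1?addrC ?(ltW ab).
  rewrite lerBlDr => hp; apply: le_trans hp _; rewrite addrC lerD2r.
  have h4 : sph2 F F1 (x +i* y) <= 4 * phi (x +i* y) * sph2 F F1 (x +i* y).
    exact: ler_peMl.
  apply: le_trans h4 _.
  have -> : 4 * phi (x +i* y) * sph2 F F1 (x +i* y) =
      2 * (2 * phi (x +i* y) * sph2 F F1 (x +i* y)) by rewrite !mulrA -natrM.
  by rewrite ler_pM2l.
have t0 : 0 < (cmod (x +i* y) - s / 2) / 2 by rewrite divr_gt0// subr_gt0.
have [r r0 Hr] := ccont_plane ccont_cmod (x, y) t0.
exists r => // a b c d _ ab _ _ cd _ /andP[ax xb] /andP[cy yd] abcd.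
have dc0 : 0 <= d - c by rewrite subr_ge0 ltW.
apply: (mass_bound mdisc d0 dB (ltW ab) (ltW cd) k0).
move=> p /andP[p1 p2] /andP[p3 p4] dp.
have : `|cmod (p.1 +i* p.2) - cmod (x +i* y)| <= (cmod (x +i* y) - s / 2) / 2.
  apply: Hr; first exact: (dist_in_itv ax xb p1 p2 dc0 abcd).
    by apply: (dist_in_itv cy yd p3 p4 (t := b - a)); rewrite ?subr_ge0 1?addrC ?(ltW ab).
move: dp hxy; rewrite /disc /=; move: (cmod (p.1 +i* p.2)) (cmod (x +i* y)) (s / 2).
move=> u v w uw wv; rewrite ler_norml => /andP[h _]; exfalso; lra.
Qed.

End AreaEstimate.

(** * Growth of the norm, and the characteristic *)

Section NevanlinnaBound.
Variables (R : realType) (n : nat) (F F1 F2 : 'I_n.+1 -> R[i] -> R[i]) (M C : R).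
Hypothesis HF : forall j z, wder (F j) z (F1 j z) 0.
Hypothesis HF1 : forall j z, wder (F1 j) z (F2 j z) 0.
Hypothesis HF0 : forall z, exists j, F j z != 0.
Hypothesis HM : forall z, sph2 F F1 z <= M ^+ 2.
Hypothesis C0 : 0 < C.
Hypothesis HC : forall z, `|ln (norm2 F z)| <= C * (1 + cmod z).

Local Notation area t := (\int[@lebesgue_measure R \x @lebesgue_measure R]_(p in
  [set p : R * R | (cmod (p.1 +i* p.2) <= t)%R]) (sph2 F F1 (p.1 +i* p.2))%:E)%E.

(* A square of half side [2 * t] contains the disc and lies in [cmod z <= 4 * t]. *)
Let area_large (t : R) : 1 <= t -> (area t <= (320 * C * t)%:E)%E.
Proof.
move=> t1; have t0 : 0 < t := lt_le_trans ltr01 t1.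
have s0 : 0 < 2 * t by rewrite mulr_gt0.
have HB z : `|complex.Re z| <= 2 * t -> `|complex.Im z| <= 2 * t ->
    `|ln (norm2 F z)| <= C * (1 + 4 * t).
  move=> h1 h2; apply: le_trans (HC z) _; rewrite ler_pM2l// lerD2l.
  apply: le_trans (cmod_le_ReIm z) _; apply: le_trans (lerD h1 h2) _.
  by rewrite -mulrDl -natrD.
have := area_le HF HF1 HF0 HM s0 HB.
have -> : 2 * t / 2 = t by rewrite mulrAC divff ?mul1r.
move=> /le_trans; apply; rewrite lee_fin.
have -> : 64 * (C * (1 + 4 * t)) = C * (64 + 256 * t) by ring.
have -> : 320 * C * t = C * (320 * t) by ring.
rewrite ler_pM2l//; lra.
Qed.

(* Near 0, the area is at most [M ^+ 2] times that of the square. *)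
Let area_small (t : R) : 0 < t -> t <= 1 -> (area t <= (16 * M ^+ 2 * t)%:E)%E.
Proof.
move=> t0 t1; have s0 : 0 < 2 * t by rewrite mulr_gt0.
have ss : - (2 * t) <= 2 * t by rewrite ltW// (lt_trans _ s0)// oppr_lt0.
have := disc_in_square s0; have -> : 2 * t / 2 = t by rewrite mulrAC divff ?mul1r.
move=> ->.
have := mass_le (measurable_disc t) (f := fun p => sph2 F F1 (p.1 +i* p.2))
  (fun p => sph2_ge0 F1 HF0 _) ss ss (sqr_ge0 M) (fun p _ _ _ => HM _).
move=> /le_trans; apply; rewrite lee_fin.
have -> : M ^+ 2 * ((2 * t - - (2 * t)) * (2 * t - - (2 * t))) = 16 * M ^+ 2 * t * t by ring.
by rewrite ler_piMr// mulr_ge0 ?(ltW t0)// mulr_ge0// sqr_ge0.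
Qed.

Lemma nevanlinna_integral_le : exists D : R, forall r : R, 0 < r ->
  (\int[@lebesgue_measure R]_(t in `[0%R, r])
    ((t^-1)%R%:E * ((pi^-1)%R%:E * area t)) <= (D * r)%:E)%E.
Proof.
have [a a0 Ha] : exists2 a, 0 <= a & forall t, 1 <= t -> (area t <= (a * t)%:E)%E.
  by exists (320 * C); [exact: mulr_ge0 (ler0n _ _) (ltW C0)|exact: area_large].
have [b b0 Hb] : exists2 b, 0 <= b & forall t, 0 < t -> t <= 1 -> (area t <= (b * t)%:E)%E.
  by exists (16 * M ^+ 2); [exact: mulr_ge0 (ler0n _ _) (sqr_ge0 _)|exact: area_small].
pose k := a + b; exists (pi^-1 * k) => r r0.
have k0 : 0 <= k by rewrite addr_ge0.
have areaE (t : R) : 0 < t -> (area t <= (k * t)%:E)%E.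
  move=> t0; rewrite mulrDl; have [t1|t1] := leP t 1.
    by apply: le_trans (Hb _ t0 t1) _; rewrite lee_fin lerDr mulr_ge0// ltW.
  by apply: le_trans (Ha _ (ltW t1)) _; rewrite lee_fin lerDl mulr_ge0// ltW.
have A0 (t : R) : (0 <= area t)%E.
  by apply: integral_ge0 => p _; rewrite lee_fin sph2_ge0.
have p0 : 0 <= (pi : R)^-1 by rewrite invr_ge0 pi_ge0.
apply: (@le_trans _ _ (\int[@lebesgue_measure R]_(t in `[0%R, r]) (cst (pi^-1 * k)%:E t))%E).
  apply: ge0_integral_mono => t /=; rewrite in_itv /= => /andP[t0 _].
    by apply: mule_ge0; [rewrite lee_fin invr_ge0|exact: mule_ge0 (p0 : (0 <= pi^-1%:E)%E) _].
  have [->|tn0] := eqVneq t 0; first by rewrite invr0 mul0e lee_fin mulr_ge0.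
  have {}t0 : 0 < t by rewrite lt_def tn0.
  rewrite muleCA EFinM; apply: lee_wpmul2l; first by rewrite lee_fin.
  apply: (@le_trans _ _ ((t^-1)%:E * (k * t)%:E)%E).
    by apply: lee_wpmul2l (areaE t t0); rewrite lee_fin invr_ge0 ltW.
  by rewrite -EFinM lee_fin mulrCA mulVf// mulr1.
rewrite integral_cst//= lebesgue_measure_itv /= lte_fin r0 sube0 -EFinM.
exact: lexx.
Qed.

End NevanlinnaBound.

Section Growth.
Variables (R : realType) (n : nat) (F F1 F2 : 'I_n.+1 -> R[i] -> R[i]) (M : R).
Hypothesis HF : forall j z, wder (F j) z (F1 j z) 0.
Hypothesis HF1 : forall j z, wder (F1 j) z (F2 j z) 0.
Hypothesis HF0 : forall z, exists j, F j z != 0.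
Hypothesis HM : forall z, sph2 F F1 z <= M ^+ 2.
Hypothesis M0 : 0 <= M.

Local Notation S z := (norm2 F z).

(* The sum of the moduli of the coefficients of a linear form. *)
Let weight (a : 'rV[R[i]]_n.+1) : R := \sum_j cmod (a 0 j).

Let weight_ge0 a : 0 <= weight a.
Proof. by apply: sumr_ge0 => j _; exact: cmod_ge0. Qed.

Let cmod_F j z : cmod (F j z) ^+ 2 <= S z.
Proof.
rewrite /norm2 (bigD1 j)//= lerDl; apply: sumr_ge0 => i _.
by rewrite exprn_ge0// cmod_ge0.
Qed.

Let lform_le a z : cmod (lform a (F^~ z)) ^+ 2 <= weight a ^+ 2 * S z.
Proof.
have S0 : 0 <= S z := ltW (norm2_gt0 HF0 z).
rewrite -[S z](sqr_sqrtr S0) -exprMn lerXn2r ?nnegrE ?cmod_ge0//.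
  by rewrite mulr_ge0// sqrtr_ge0.
apply: le_trans (cmod_sum _) _; rewrite mulr_suml; apply: ler_sum => j _.
rewrite cmodM ler_wpM2l ?cmod_ge0//.
by have := cmod_F j z; rewrite -(ler_sqrt _ S0) sqrtr_sqr ger0_norm ?cmod_ge0.
Qed.

(* The Wronskians of the coordinates, from the bound on [sph2]. *)
Let W_le i j z : cmod (F1 i z * F j z - F i z * F1 j z) <= M * S z.
Proof.
have S0 := norm2_gt0 HF0 z.
have H (i' j' : 'I_n.+1) : (i' < j')%N -> cmod (F1 i' z * F j' z - F i' z * F1 j' z) <= M * S z.
  move=> ij; rewrite -(@ler_pXn2r _ 2)// ?nnegrE ?cmod_ge0 ?mulr_ge0 ?(ltW S0)//.
  rewrite exprMn -ler_pdivrMr ?exprn_gt0//; apply: le_trans (HM z).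
  rewrite /sph2 mulrC ler_pM2l ?invr_gt0 ?exprn_gt0//.
  rewrite (bigD1 i')//= (bigD1 j')//= -addrA lerDl addr_ge0//.
    by apply: sumr_ge0 => k _; rewrite exprn_ge0// cmod_ge0.
  by apply: sumr_ge0 => k _; apply: sumr_ge0 => l _; rewrite exprn_ge0// cmod_ge0.
have [/H//|ji|/val_inj ->] := ltngtP i j.
  by have := H _ _ ji; rewrite -cmodN; congr (cmod _ <= _); ring.
by rewrite [F j z * _]mulrC subrr cmod0 mulr_ge0// ltW.
Qed.

Let lform_W_le a b z :
  cmod (lform a (F1^~ z) * lform b (F^~ z) - lform a (F^~ z) * lform b (F1^~ z)) <=
  weight a * weight b * (M * S z).
Proof.
have -> : lform a (F1^~ z) * lform b (F^~ z) - lform a (F^~ z) * lform b (F1^~ z) =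
    \sum_i \sum_j a 0 i * b 0 j * (F1 i z * F j z - F i z * F1 j z).
  rewrite /lform !big_distrlr /= -sumrB; apply: eq_bigr => i _.
  by rewrite -sumrB; apply: eq_bigr => j _; ring.
apply: le_trans (cmod_sum _) _; rewrite /weight big_distrlr /= mulr_suml.
apply: ler_sum => i _; apply: le_trans (cmod_sum _) _; rewrite mulr_suml.
by apply: ler_sum => j _; rewrite !cmodM ler_wpM2l ?mulr_ge0 ?cmod_ge0.
Qed.

(** The linear forms [G k] and one more coordinate [g] satisfy the assumptions of
    [linear_growth], and control all coordinates. *)
Lemma log_norm2_growth (H : 'M[R[i]]_(n, n.+1)) (k0 : 'I_n) : row_free H ->
  (forall k z, lform (row k H) (F^~ z) != 0) ->
  (forall z, lform (row k0 H) (F^~ z) = 1) ->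
  exists2 C : R, 0 < C & forall z, `|ln (S z)| <= C * (1 + cmod z).
Proof.
move=> fH G0 Gk0; have [i0 [c c0 Hc]] := row_free_control fH.
pose G k z := lform (row k H) (F^~ z); pose G1 k z := lform (row k H) (F1^~ z).
pose d : 'rV[R[i]]_n.+1 := delta_mx 0 i0.
have dE v : lform d v = v i0.
  rewrite /lform (bigD1 i0)//= mxE !eqxx mul1r big1 ?addr0// => j ji.
  by rewrite mxE eqxx (negbTE ji) mul0r.
pose N : R := 1 + weight d + \sum_k weight (row k H).
have N1 : 1 <= N.
  by rewrite /N -addrA lerDl addr_ge0// sumr_ge0.
have N0 : 0 < N := lt_le_trans ltr01 N1.
have Nd : weight d <= N.
  by rewrite /N addrAC lerDr addr_ge0// sumr_ge0.
have Nk k : weight (row k H) <= N.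
  rewrite /N (bigD1 k)//= addrCA lerDl !addr_ge0// sumr_ge0//.
have Sgt z : 0 < S z := norm2_gt0 HF0 z.
have GN k z : cmod (G k z) ^+ 2 <= N ^+ 2 * S z.
  apply: le_trans (lform_le _ _) _; rewrite ler_pM2r//.
  by rewrite lerXn2r// nnegrE// ltW.
have N20 : 0 < N ^+ 2 by rewrite exprn_gt0.
have Fc z : - ln (N ^+ 2) <= ln (S z).
  rewrite lerNl -subr_ge0 opprK addrC -lnM ?posrE// ln_ge0//.
  by have := GN k0 z; rewrite /G Gk0 cmod1 expr1n mulrC.
have gK k z : 2 * ln (cmod (G k z)) <= ln (S z) + ln (N ^+ 2).
  have Gz : 0 < cmod (G k z) by rewrite cmod_gt0 G0.
  have -> : 2 * ln (cmod (G k z)) = ln (cmod (G k z) ^+ 2) by rewrite lnXn// mulr_natl.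
  rewrite addrC -lnM ?posrE// ler_ln ?posrE// ?exprn_gt0 ?mulr_gt0//.
have HG k z : wder (G k) z (G1 k z) 0 by apply: wder_lform => j; exact: HF.
have HG1 k z : holo (G1 k) z by eexists; apply: wder_lform => j; exact: HF1.
(* the logarithmic derivative has a constant derivative [L1] *)
have aff k : exists2 a, True & exists b, forall z, ldG G G1 k z = a * z + b.
  have /choice[L1 HL] : forall z, exists L1, wder (fun x => G1 k x / G k x) z L1 0.
    move=> z; have [e He] := HG1 k z; eexists.
    exact: wder_holoM He (wder_eq (wderV (G0 k z) (HG k z)) (erefl _) (mulr0 _)).
  have [L2 HL2] := deriv_holo HL.
  have L20 := dominated_L2 HF HF1 HF0 HM (HG k) (HG1 k) (G0 k) HL HL2 (gK k) Fc.
  have L1c z : L1 z = L1 0.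
    by apply: deriv0_cst => w; apply: (wder_eq (HL2 w)).
  exists (L1 0) => //; exists (ldG G G1 k 0) => z.
  have /(_ z) : forall z, G1 k z / G k z - L1 0 * z = G1 k 0 / G k 0 - L1 0 * 0.
    apply: (@deriv0_cst _ (fun z => G1 k z / G k z - L1 0 * z)) => w.
    apply: (wder_eq (wderB (HL w) (wderZ (L1 0) (wder_id w)))).
      by rewrite L1c mulr1 subrr.
    by rewrite mulr0 subr0.
  by rewrite mulr0 subr0 /ldG => <-; rewrite addrC subrK.
have /choice[al /= Hal] : forall k, exists a, exists b, forall z, ldG G G1 k z = a * z + b.
  by move=> k; have [a _ ?] := aff k; exists a.
have /choice[be {}Hal] := Hal.
pose K : R := N * N * (M * (n.+1%:R * c ^+ 2)) + 1.
have K0 : 0 < K.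
  by rewrite ltr_wpDl// !mulr_ge0 ?(ltW N0) ?(ltW c0).
pose g z := lform d (F^~ z); pose g1 z := lform d (F1^~ z).
have SB z (B : R) : cmod (g z) <= B -> (forall l, cmod (G l z) <= B) ->
    S z <= n.+1%:R * (c ^+ 2 * B ^+ 2).
  rewrite /g dE => gB GB; rewrite /norm2.
  apply: (@le_trans _ _ (\sum_(j < n.+1) (c ^+ 2 * B ^+ 2))); last first.
    by rewrite sumr_const card_ord mulr_natl.
  apply: ler_sum => j _; rewrite -exprMn.
  have H0 := Hc _ _ gB GB j.
  by rewrite lerXn2r// nnegrE ?cmod_ge0// (le_trans (cmod_ge0 _) H0).
have WB a b z (B : R) : weight a <= N -> weight b <= N ->
    cmod (g z) <= B -> (forall l, cmod (G l z) <= B) ->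
    cmod (lform a (F1^~ z) * lform b (F^~ z) - lform a (F^~ z) * lform b (F1^~ z)) <= K * B ^+ 2.
  move=> aN bN gB GB; apply: le_trans (lform_W_le a b z) _.
  apply: (@le_trans _ _ (N * N * (M * (n.+1%:R * (c ^+ 2 * B ^+ 2))))).
    rewrite ler_pM ?mulr_ge0 ?(ltW (Sgt z))//; first by rewrite ler_pM.
    by rewrite ler_wpM2l// SB.
  have -> : N * N * (M * (n.+1%:R * (c ^+ 2 * B ^+ 2))) = (K - 1) * B ^+ 2.
    by rewrite /K addrK; move: (n.+1%:R : R) => q; ring.
  by rewrite ler_wpM2r ?sqr_ge0// gerBl.
have Hg z : wder g z (g1 z) 0 by apply: wder_lform => j; exact: HF.
have Hg1 z : holo g1 z by eexists; apply: wder_lform => j; exact: HF1.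
have [C C0 HC] := linear_growth HG HG1 G0 Gk0 Hg Hg1 K0
  (fun z B k => WB d (row k H) z B Nd (Nk k)) (fun z B j k => WB (row j H) (row k H) z B (Nk j) (Nk k)) Hal.
pose q : R := n.+1%:R * c ^+ 2.
have q0 : 0 < q by rewrite mulr_gt0// exprn_gt0.
exists (`|ln q| + 2 * C + `|ln (N ^+ 2)|) => [|z].
  by rewrite ltr_pwDl// ltr_wpDl// mulr_gt0.
have [hg hG] := HC z; have := SB _ _ hg hG.
rewrite -expRM_natl mulrA -/q => Sle.
have h1 : ln (S z) <= ln q + 2 * (C * (1 + cmod z)).
  have := Sle; rewrite -ler_ln ?posrE ?mulr_gt0 ?expR_gt0//.
  by rewrite lnM ?posrE ?expR_gt0// expRK.
have z0 := cmod_ge0 z; have h2 := Fc z.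
have h3 := ler_norm (ln q); have h4 := ler_norm (ln (N ^+ 2)).
have p1 : 0 <= `|ln q| * cmod z by rewrite mulr_ge0.
have p2 : 0 <= `|ln (N ^+ 2)| * cmod z by rewrite mulr_ge0.
have p3 : 0 <= C * (1 + cmod z) by rewrite mulr_ge0 ?(ltW C0)// addr_ge0.
have n1 := normr_ge0 (ln q); have n2 := normr_ge0 (ln (N ^+ 2)).
have -> : (`|ln q| + 2 * C + `|ln (N ^+ 2)|) * (1 + cmod z) =
   `|ln q| + `|ln q| * cmod z + 2 * (C * (1 + cmod z)) +
   (`|ln (N ^+ 2)| + `|ln (N ^+ 2)| * cmod z) by ring.
move: h1 h2 h3 h4 p1 p2 p3 n1 n2.
move: (ln (S z)) (ln q) (ln (N ^+ 2)) => x y w.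
move: (C * (1 + cmod z)) (`|y| * cmod z) (`|w| * cmod z) (`|y|) (`|w|).
move=> a b e y' w' *; rewrite ler_norml; apply/andP; split; lra.
Qed.

End Growth.

Unset Implicit Arguments.

Theorem mainTheorem1 (R : realType) (n : nat) (hn : (1 <= n)%N)
    (f : R[i] -> projective_space R n) (H : 'M[R[i]]_(n, n.+1)) :
  Brody_curve f ->
  row_free H ->
  (forall k : 'I_n, omits_hyperplane f (row k H)) ->
  exists C : R, \forall r \near +oo, (nevanlinna f r <= (C * r)%:E)%E.
Proof.
move=> [holf [M0 HM0]] fH omf; pose k0 : 'I_n := Ordinal hn.
have [F rF lF] := normalized_representation holf (omf k0).
have [entF repF] := rF.
pose F1 j := cderiv (F j).
have HF j z : wder (F j) z (F1 j z) 0 by exact: holomorphic_wder (entF j z).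
have /choice[F2 HF1] : forall j, exists F2, forall z, wder (F1 j) z (F2 z) 0.
  by move=> j; exact: deriv_holo (HF j).
have HF0 z : exists j, F j z != 0.
  by have [/rV0Pn[j] + _] := repF z; rewrite mxE => ?; exists j.
have sphE z : sph_deriv f z ^+ 2 = sph2 F F1 z.
  by rewrite (sph_derivE rF) sqr_sqrtr//; exact: (sph2_ge0 F1 HF0).
have HM z : sph2 F F1 z <= `|M0| ^+ 2.
  have h : sph_deriv f z <= `|M0| := le_trans (HM0 z) (ler_norm _).
  rewrite -sphE lerXn2r// nnegrE (sph_derivE rF); exact: sqrtr_ge0.
have G0 k z : lform (row k H) (F^~ z) != 0.
  have := omits_lform_neq0 (repF z).2 (omf k); rewrite /lform.
  by under eq_bigr do rewrite mxE.
have [C C0 HC] := log_norm2_growth HF HF1 HF0 HM (normr_ge0 _) fH G0 lF.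
have [D HD] := nevanlinna_integral_le HF HF1 HF0 HM C0 HC.
exists D; near=> r; have r0 : 0 < r by near: r; exact: nbhs_pinfty_gt.
rewrite /nevanlinna; under eq_integral do under eq_integral do rewrite sphE.
exact: HD.
Unshelve. all: by end_near.
Qed.
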